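(* Let $q\in(0,1]$ and, for every $d\in\mathbb{N}$, let $(W_1,\ldots,W_d)^\top$ be a $d$-dimensional Brownian motion with correlation matrix $\Sigma_d=(\rho^{(d)}_{i,j})_{1\le i,j\le d}$ whose entries satisfy $\sup_{1\le i<j\le d}|\rho^{(d)}_{i,j}|\le\rho_+$ for a constant $\rho_+\in[0,1)$ (not depending on $d$). Assume that there exists a sequence $L_d$ such that $\rho^{(d)}_{i,j}=0$ whenever $|i-j|>L_d$ and $$L_d=o(d^{\Delta})\ \text{ as } d\to\infty,\quad\text{for some } \Delta<\left(\frac{1-\rho_+\sqrt{2-\rho_+^2}}{1-\rho_+^2}\right)^2 .$$ For $h=1,\dots,d$ let $M_h=\max_{0\le t\le q}W_h(t)-\min_{0\le t\le q}W_h(t)$. Then, as $d\to\infty$, $$a_d\Big(\max_{h=1}^d M_h-b_d\Big)$$ converges in distribution to a standard Gumbel random variable $G$, i.e. one with distribution function $F_G(x)=\exp(-\exp(-x))$, where $$a_d=\sqrt{\frac{2\log d}{q}},\qquad b_d=\sqrt{2q\log d}-\frac{\sqrt q\,(\log\log d-\log\tfrac{16}{\pi})}{2\sqrt{2\log d}} .$$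
   Context: A $d$-dimensional Brownian motion with correlation matrix $\Sigma_d=(\rho_{i,j}^{(d)})$ (a positive semidefinite matrix with unit diagonal) is a centered Gaussian process with continuous paths, each component being a standard one-dimensional Brownian motion, and $\operatorname{Cov}(W_i(s),W_j(t))=\min(s,t)\,\rho^{(d)}_{i,j}$. *)

(* Defs.v *)
From HB Require Import structures.
From mathcomp Require Import all_boot all_order all_algebra.
From mathcomp Require Import all_classical all_reals all_analysis.

Set Implicit Arguments.
Unset Strict Implicit.
Unset Printing Implicit Defensive.

Import Order.TTheory GRing.Theory Num.Theory.
Import numFieldNormedType.Exports.

Local Open Scope classical_set_scope.
Local Open Scope ring_scope.

(* [normal_prob m 0] is not the point mass at [m], hence the case split. *)
Definition gaussian_law (R : realType) (m s : R) : set R -> \bar R :=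
  if s == 0 then \d_m else normal_prob m s.

Definition is_gaussian d (T : measurableType d) (R : realType)
    (P : probability T R) (X : T -> R) : Prop :=
  measurable_fun setT X /\
  exists m s : R, forall A : set R, measurable A ->
    P (X @^-1` A) = gaussian_law m s A.

Definition mutually_independent d (T : measurableType d) (R : realType)
    (P : probability T R) (I : finType) (X : I -> T -> R) : Prop :=
  forall A : I -> set R, (forall i, measurable (A i)) ->
    P (\bigcap_i (X i @^-1` A i)) = (\prod_i P (X i @^-1` A i))%E.

(* Processes are indexed by the real line; only the times [0 <= t] matter. *)

Record is_standard_BM d (T : measurableType d) (R : realType)
    (P : probability T R) (B : R -> T -> R) : Prop := {
  BM_measurable : forall t : R, 0 <= t -> measurable_fun setT (B t) ;
  BM_start : {ae P, forall w, B 0 w = 0} ;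
  BM_increments : forall s t : R, 0 <= s -> s < t ->
    forall A : set R, measurable A ->
      P ((B t \- B s) @^-1` A) = normal_prob 0 (Num.sqrt (t - s)) A ;
  BM_independent : forall (n : nat) (t : nat -> R),
    0 <= t 0%N -> (forall k, t k <= t k.+1) ->
    mutually_independent P (fun k : 'I_n => B (t k.+1) \- B (t k)) ;
  BM_continuous : forall w, {within `[0, +oo[, continuous (B ^~ w)}
}.

Definition is_gaussian_process d (T : measurableType d) (R : realType)
    (P : probability T R) (I : Type) (X : I -> R -> T -> R) : Prop :=
  forall (n : nat) (c : 'I_n -> R) (i : 'I_n -> I) (t : 'I_n -> R),
    (forall k, 0 <= t k) ->
    is_gaussian P (fun w => \sum_(k < n) c k * X (i k) (t k) w).

Definition is_correlation_mx (R : realType) (n : nat) (S : 'M[R]_n) : Prop :=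
  [/\ S^T = S, forall u : 'rV[R]_n, 0 <= (u *m S *m u^T) 0 0
    & forall i, S i i = 1].

Record is_correlated_BM d (T : measurableType d) (R : realType)
    (P : probability T R) (n : nat) (S : 'M[R]_n) (W : 'I_n -> R -> T -> R)
    : Prop := {
  CBM_correlation : is_correlation_mx S ;
  CBM_gaussian : is_gaussian_process P W ;
  CBM_centered : forall i (t : R), 0 <= t -> ('E_P[W i t] = 0)%E ;
  CBM_continuous : forall i w, {within `[0, +oo[, continuous (W i ^~ w)} ;
  CBM_component : forall i, is_standard_BM P (W i) ;
  CBM_covariance : forall i j (s t : R), 0 <= s -> 0 <= t ->
    covariance P (W i s) (W j t) = (Num.min s t * S i j)%:E
}.

(* For a path [f] that is continuous on [0, q], the sup and the inf are the
   max and the min of [f] over [0, q]. *)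
Definition path_range (R : realType) (q : R) (f : R -> R) : R :=
  sup [set f t | t in `[0, q]] - inf [set f t | t in `[0, q]].

(* Ranges are nonnegative, so [0] is neutral as the default value of the
   maximum; it is only reached as a junk value when [n = 0]. *)
Definition max_range (R : realType) (T : Type) (q : R) (n : nat)
    (W : 'I_n -> R -> T -> R) (w : T) : R :=
  \big[Num.max/0]_(h < n) path_range q (W h ^~ w).

Definition norm_a (R : realType) (q : R) (n : nat) : R :=
  Num.sqrt (2 * ln n%:R / q).

Definition norm_b (R : realType) (q : R) (n : nat) : R :=
  Num.sqrt (2 * q * ln n%:R)
  - Num.sqrt q * (ln (ln n%:R) - ln (16 / pi)) / (2 * Num.sqrt (2 * ln n%:R)).

(* The variables [X n] may live on different probability spaces. *)
Definition cvg_in_distribution (R : realType)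
    (disp : nat -> measure_display) (T : forall n, measurableType (disp n))
    (P : forall n, probability (T n) R) (X : forall n, T n -> R)
    (d' : measure_display) (T' : measurableType d') (P' : probability T' R)
    (G : {RV P' >-> R}) : Prop :=
  (forall n, measurable_fun setT (X n)) /\
  forall x : R, {for x, continuous (cdf G)} ->
    P n [set w | X n w <= x] @[n --> \oo] --> cdf G x.

Definition gumbel_cdf (R : realType) (x : R) : R := expR (- expR (- x)).

Definition is_standard_gumbel (R : realType) (d : measure_display)
    (T : measurableType d) (P : probability T R) (G : {RV P >-> R}) : Prop :=
  forall x : R, cdf G x = (gumbel_cdf x)%:E.

Section gumbel_exists.
Variable R : realType.

Let F : R -> R := @gumbel_cdf R.

Let F_nd : nondecreasing F.
Proof. by move=> x y xy; rewrite ler_expR lerN2 ler_expR lerN2. Qed.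

Let F_continuous : continuous F.
Proof.
move=> x; rewrite /F /gumbel_cdf.
apply: (@continuous_comp _ _ _ (fun x : R => - expR (- x)) expR); last first.
  exact: continuous_expR.
apply: (@cvgN _ R^o).
apply: (@continuous_comp _ _ _ (fun x : R => - x) expR); last first.
  exact: continuous_expR.
exact: opp_continuous.
Qed.

Let F_rc : right_continuous F.
Proof. by move=> x; apply: cvg_at_right_filter; exact: F_continuous. Qed.

HB.instance Definition _ := isCumulative.Build R _ R F F_nd F_rc.

Let F_Ny : F @ -oo --> (0 : R).
Proof.
apply/cvgNy_compNP; rewrite /F /gumbel_cdf /comp.
have expRy : @expR R x @[x --> +oo] --> +oo.
  apply/cvgryPge => A; exists A; split=> [|x Ax]; first exact: num_real.
  by apply: le_trans (expR_ge1Dx x); apply: ler_wpDl => //; exact: ltW.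
under eq_cvg do rewrite opprK.
exact: (cvg_comp _ _ expRy (@cvgr_expR R)).
Qed.

Let F_y : F @ +oo --> (1 : R).
Proof.
rewrite /F /gumbel_cdf -(@expR0 R).
apply: (@cvg_comp _ _ _ (fun x : R => - expR (- x)) expR).
  by apply: (@cvgN _ R^o); exact: cvgr_expR.
by rewrite oppr0; exact: continuous_expR.
Qed.

HB.instance Definition _ := isCumulativeBounded.Build R 0 1 F F_Ny F_y.

Let idTR : measurableTypeR R -> R := idfun.

#[local] HB.instance Definition _ :=
  @isMeasurableFun.Build _ _ _ _ idTR (@measurable_id _ _ setT).

Lemma standard_gumbel_exists :
  exists (d : measure_display) (T : measurableType d) (P : probability T R)
    (G : {RV P >-> R}), is_standard_gumbel G.
Proof.
exists _, _, (lebesgue_stieltjes_measure F), idTR => x.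
exact: (cdf_lebesgue_stieltjes_id F).
Qed.

End gumbel_exists.

(* Main.v *)
(* Write Q(u) = P(W_1(q) > u). Decomposing a random walk at its last, or first,
   oscillation above u, and using the symmetry of the independent increment before,
   or after, that time, one gets for the range M of a Brownian motion, in the limit
   of fine grids,
     (4 Q(u) - 8 Q(2u)) / (1/2 + 4 Q(u)) <= P(M > u) <= 8 Q(u).
   At the level u_d = b_d + x / a_d, Mills' ratio then gives d P(M > u_d) -> exp(-x).

   Let kappa^2 be the bound on Delta; it satisfies
   (1 - rho_+^2) (1 + kappa^2) = 2 kappa. For i <> j, W_j is rho_ij W_i plus an
   independent residual, so M_i, M_j > u forces M_i > c u or a residual range above
   (1 - |rho_ij| c) u. The choice c^2 = 1 + kappa^2 balances both cases and yields
   P(M_i > u, M_j > u) <= 72 exp(- (1 + kappa^2) u^2 / (2q)).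

   By the band condition, {M_m > u} is independent of the joint behaviour of the M_h
   with h < m - L_d. Hence P(M_h <= u for all h <= m) differs from
   P(M_m <= u) P(M_h <= u for all h < m) by at most L_d (p_2 + p^2), with p_2 and p
   the bounds on joint and single exceedances. After d steps the total error
   d L_d (p_2 + p^2) vanishes because Delta < kappa^2, and what remains is
   (1 - exp(-x) / d + o(1 / d))^d -> exp(- exp(-x)). *)

Require Import Defs.
From mathcomp Require Import all_boot all_order all_algebra.
From mathcomp Require Import all_classical all_reals all_analysis.
From mathcomp Require Import measurable_realfun.
From mathcomp Require Import ring lra.

Set Implicit Arguments.
Unset Strict Implicit.
Unset Printing Implicit Defensive.

Import Order.TTheory GRing.Theory Num.Theory.
Import numFieldNormedType.Exports.

Local Open Scope classical_set_scope.
Local Open Scope ring_scope.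

(** * Gaussian integrals *)

(** The hypotheses give the laws of finite linear combinations, while the argument lives on range
    events of whole paths. The link is Fourier analysis in real form, with cosines carrying a phase:
    for orthogonal Gaussian variables the integrals of products of cosines factor, and this is
    upgraded to independence of the generated sigma-algebras. Range events belong to these because a
    range above u shows on every fine enough grid of a continuous path. Working on grids also avoids
    stopping times: a first or last index splits an event into finitely many disjoint pieces, and
    the only input besides independence is that a centered Gaussian variable is nonnegative with
    probability at least 1/2 and positive with probability at most 1/2. The price is an overshoot by
    one step of the walk, whose probability vanishes with the mesh. The limit requires the exact
    first-order constant of the tail. Three reflections give 8 from above; in the lower bound the
    denominator tends to 1/2, and 4 / (1/2) = 8 as well. This 8 is the source of 16 / pi in b_d. *)

Section normal_integrals.
Variables (R : realType) (m s : R).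
Local Notation mu := (@lebesgue_measure R).
Local Notation p := (normal_pdf m s).

(** Change of variables goes through the Radon-Nikodym derivative, which is almost everywhere [p]
    because both have the same integral over every measurable set. *)
Lemma ge0_integral_normal_prob (f : R -> R) : measurable_fun setT f ->
    (forall x, 0 <= f x) ->
  (\int[normal_prob m s]_x (f x)%:E = \int[mu]_x (f x * p x)%:E)%E.
Proof.
move=> mf f0.
have numu := normal_prob_dominates m s.
rewrite -(Radon_Nikodym_SigmaFinite.change_of_variables numu) //=; last first.
  exact/measurable_EFinP.
have mp : measurable_fun setT (fun x => (p x)%:E).
  by apply/measurable_EFinP; exact: measurable_normal_pdf.
have iRN := Radon_Nikodym_SigmaFinite.f_integrable numu.
under [RHS]eq_integral do rewrite EFinM.
apply: ae_eq_integral => //.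
- apply: emeasurable_funM; first exact/measurable_EFinP.
  exact: measurable_int iRN.
- by apply: emeasurable_funM => //; exact/measurable_EFinP.
- apply: ae_eqe_mul2l.
  apply: integral_ae_eq => //.
  by move=> E _ mE; rewrite -Radon_Nikodym_SigmaFinite.f_integral.
Qed.

Lemma integrable_normal_prob (f : R -> R) : measurable_fun setT f ->
  mu.-integrable setT (fun x => (f x * p x)%:E) ->
  (normal_prob m s).-integrable setT (EFin \o f).
Proof.
move=> mf /integrableP[mfp ifp]; apply/integrableP; split.
  exact/measurable_EFinP.
rewrite (ge0_integral_normal_prob (f := fun x => `|f x|)) //; last first.
  exact: measurableT_comp.
move: ifp; apply: le_lt_trans; apply: ge0_le_integral => //.
- by move=> x _; rewrite lee_fin mulr_ge0 ?normal_pdf_ge0.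
- apply/measurable_EFinP; apply: measurable_funM; first exact: measurableT_comp.
  exact: measurable_normal_pdf.
- exact: measurableT_comp.
- by move=> x _ /=; rewrite lee_fin normrM (ger0_norm (normal_pdf_ge0 m s x)).
Qed.

Lemma Rintegral_normal_prob (f : R -> R) : measurable_fun setT f ->
  mu.-integrable setT (fun x => (f x * p x)%:E) ->
  \int[normal_prob m s]_x f x = \int[mu]_x (f x * p x).
Proof.
move=> mf ifp.
have iN := integrable_normal_prob mf ifp.
have fE x : f x = f^\+ x - f^\- x by rewrite -{1}(funrposBneg f).
have mfp : measurable_fun setT (fun x => f^\+ x).
  exact: measurable_funrpos.
have mfn : measurable_fun setT (fun x => f^\- x).
  exact: measurable_funrneg.
have ip : mu.-integrable setT (fun x => (f^\+ x * p x)%:E).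
  apply: (le_integrable measurableT _ _ ifp).
    apply/measurable_EFinP; apply: measurable_funM => //.
    exact: measurable_normal_pdf.
  move=> x _ /=; rewrite lee_fin !normrM ler_wpM2r //.
  rewrite ger0_norm ?funrpos_ge0 // /funrpos /Num.max.
  by case: ifPn => // _; exact: ler_norm.
have inn : mu.-integrable setT (fun x => (f^\- x * p x)%:E).
  apply: (le_integrable measurableT _ _ ifp).
    apply/measurable_EFinP; apply: measurable_funM => //.
    exact: measurable_normal_pdf.
  move=> x _ /=; rewrite lee_fin !normrM ler_wpM2r //.
  rewrite ger0_norm ?funrneg_ge0 // /funrneg /Num.max.
  by case: ifPn => // _; rewrite -normrN; exact: ler_norm.
rewrite (_ : (fun x => f x) = (fun x => f^\+ x - f^\- x)); last first.
  exact/funext.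
rewrite RintegralB //; [|exact: integrable_normal_prob|exact: integrable_normal_prob].
have key (g : R -> R) : measurable_fun setT g -> (forall x, 0 <= g x) ->
    \int[normal_prob m s]_x g x = \int[mu]_x (g x * p x).
  by move=> mg g0; rewrite /Rintegral ge0_integral_normal_prob.
rewrite !key //.
rewrite -RintegralB //.
by apply: eq_Rintegral => x _; rewrite -mulrBl -fE.
Qed.

End normal_integrals.

Section improper_FTC.
Variable R : realType.
Local Notation mu := (@lebesgue_measure R).

(** Stands in for integration by parts on the line: the Gaussian identities below come from
    primitives that vanish at both infinities. The fundamental theorem is applied on [-(n+1), n+1],
    and dominated convergence gives the limit. *)
Lemma integralT_FTC (F f : R -> R) :
  continuous f -> (forall x : R, is_derive x 1 F (f x)) ->
  mu.-integrable setT (EFin \o f) ->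
  F x @[x --> +oo] --> 0 -> F x @[x --> -oo] --> 0 ->
  \int[mu]_x f x = 0.
Proof.
move=> cf dF fi Fy FNy.
have dFF x : derivable F x 1 by have [] := dF x.
have cF : continuous F.
  by move=> x; apply: differentiable_continuous; exact/derivable1_diffP.
pose A (n : nat) : set R := `[- (n.+1%:R), n.+1%:R]%classic.
have step n : (\int[mu]_x (f \_ (A n) x)%:E = (F n.+1%:R - F (- n.+1%:R))%:E)%E.
  transitivity (\int[mu]_(x in A n) (f x)%:E)%E.
    rewrite [RHS]integral_mkcond; apply: eq_integral => x _.
    by rewrite !patchE; case: ifP.
  rewrite EFinB; apply: continuous_FTC2.
  - by rewrite gtrN // ltr0n.
  - exact: continuous_subspaceT.
  - split; first by move=> x _.
    + by apply: cvg_at_right_filter; exact: cF.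
    + by apply: cvg_at_left_filter; exact: cF.
  - by move=> x _; rewrite derive1E; exact: derive_val.
have lim1 : (\int[mu]_x (f \_ (A n) x)%:E)%E @[n --> \oo] --> (\int[mu]_x (f x)%:E)%E.
  have mf : measurable_fun setT f by exact: continuous_measurable_fun.
  apply: (@dominated_cvg _ _ _ mu setT measurableT
      (fun n x => (f \_ (A n) x)%:E) (EFin \o f) (abse \o (EFin \o f))).
  - move=> n; apply/measurable_EFinP; apply/measurable_restrict => //=.
      exact: measurable_itv.
    exact: measurable_funTS.
  - move=> x _; apply: cvg_EFin; first exact: nearW.
    apply: cvg_near_cst; exists (Num.bound `|x|) => // n /= hn.
    rewrite /= patchE mem_set // /A /= in_itv /= -ler_norml.
    apply: (le_trans (ltW (archi_boundP (normr_ge0 x)))).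
    by rewrite ler_nat (leq_trans hn).
  - by [].
  - exact: integrable_abse.
  - move=> n x _; rewrite /= lee_fin patchE.
    by case: ifPn => // _; rewrite normr0.
have lim2 : (F n.+1%:R - F (- n.+1%:R)) @[n --> \oo] --> (0:R).
  rewrite -(subrr 0); apply: cvgB.
    have := @cvg_comp _ _ _ (fun n : nat => n.+1%:R : R) F _ _ _ _ Fy; apply.
    by have := @cvgr_idn R; rewrite -(@cvg_shiftS _ (fun n => n%:R : R)).
  have := @cvg_comp _ _ _ (fun n : nat => - n.+1%:R : R) F _ _ _ _ FNy; apply.
  apply/cvgNrNy.
  by have := @cvgr_idn R; rewrite -(@cvg_shiftS _ (fun n => n%:R : R)).
rewrite /Rintegral.
have -> : (\int[mu]_x (f x)%:E = 0%:E)%E.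
  rewrite (funext step) in lim1.
  by apply: cvg_unique lim1 _ => //; apply: cvg_EFin => //; exact: nearW.
by [].
Qed.
End improper_FTC.

Lemma expRN_le_inv (R : realType) (y : R) : 0 < y -> expR (- y) <= y^-1.
Proof.
move=> y0; rewrite expRN lef_pV2 ?posrE ?expR_gt0 //.
by apply: le_trans (expR_ge1Dx y); lra.
Qed.

Section normal_moments.
Variables (R : realType) (m s : R).
Hypothesis s0 : s != 0.
Local Notation mu := (@lebesgue_measure R).
Local Notation p := (normal_pdf m s).

Lemma normal_pdfN0 x : p x = normal_peak s * expR (- (x - m) ^+ 2 / (s ^+ 2 *+ 2)).
Proof. by rewrite normal_pdfE. Qed.

Lemma is_derive_normal_pdf (x : R) : is_derive x 1 p (- ((x - m) / s ^+ 2 * p x)).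
Proof.
rewrite (_ : normal_pdf m s =
  (fun x => normal_peak s * expR (- (x - m) ^+ 2 / (s ^+ 2 *+ 2)))); last first.
  by apply/funext => y; rewrite normal_pdfN0.
apply: is_derive_eq; rewrite /GRing.scale /=; field.
exact: s0.
Qed.

(** Half of the exponent absorbs the square, since y exp(-y) <= 1 at y = (x - m)^2 / (4 s^2); the
    other half is a normal density of variance 2 s^2 up to a constant. Integrability and decay of
    the second moment both follow. *)
Lemma sqrM_normal_pdf_bound :
  exists2 C : R, 0 <= C &
    forall x, (x - m) ^+ 2 * p x <= C * normal_pdf m (s * Num.sqrt 2) x.
Proof.
have s20 : s * Num.sqrt 2 != 0 by rewrite mulf_neq0 // gt_eqF // sqrtr_gt0.
have q0 := normal_peak_gt0 s20.
exists (normal_peak s * (4 * s ^+ 2) / normal_peak (s * Num.sqrt 2)) => [|x].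
  by rewrite divr_ge0 ?normal_peak_ge0 // mulr_ge0 ?normal_peak_ge0 // mulr_ge0 ?sqr_ge0.
rewrite normal_pdfN0 normal_pdfE // /normal_fun [leRHS]mulrA divfK ?gt_eqF //.
set e := expR (- _ / (_ *+ 2)).
set e' := (X in _ <= _ * X).
have -> : e = e' * e'.
  rewrite /e /e' -expRD; congr expR; rewrite exprMn sqr_sqrtr //.
  by field; rewrite s0.
rewrite [leLHS](_ : _ = normal_peak s * ((x - m) ^+ 2 * e') * e'); last by ring.
rewrite ler_wpM2r ?expR_ge0 // ler_wpM2l ?normal_peak_ge0 //.
have [->|xm] := eqVneq (x - m) 0.
  by rewrite expr0n mul0r mulr_ge0 ?sqr_ge0.
have x2 : 0 < (x - m) ^+ 2 by rewrite exprn_even_gt0.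
have s2 : 0 < s ^+ 2 by rewrite exprn_even_gt0.
have := @expRN_le_inv _ ((x - m) ^+ 2 / (4 * s ^+ 2)) (divr_gt0 x2 (mulr_gt0 _ s2)).
rewrite (_ : - _ = - (x - m) ^+ 2 / ((s * Num.sqrt 2) ^+ 2 *+ 2)); last first.
  by rewrite exprMn sqr_sqrtr //; field; rewrite s0.
rewrite -/e' invf_div => /(_ (ltr0Sn _ 3)) h.
by rewrite mulrC -ler_pdivlMr.
Qed.

Lemma integrable_sqrM_normal_pdf :
  mu.-integrable setT (fun x => ((x - m) ^+ 2 * p x)%:E).
Proof.
have [C C0 hC] := sqrM_normal_pdf_bound.
have := integrable_normal_pdf m (s * Num.sqrt 2).
move=> /(integrableZl measurableT C); apply: le_integrable => //.
  apply/measurable_EFinP; apply: measurable_funM; last exact: measurable_normal_pdf.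
  by apply: measurable_funX; exact: measurable_funB.
move=> x _; rewrite -EFinM /= lee_fin !ger0_norm //.
  by rewrite mulr_ge0 ?normal_pdf_ge0.
by apply: mulr_ge0; rewrite ?sqr_ge0 ?normal_pdf_ge0.
Qed.

Lemma integrable_mul_normal_pdf :
  mu.-integrable setT (fun x => ((x - m) * p x)%:E).
Proof.
have := integrableD measurableT (integrable_normal_pdf m s) integrable_sqrM_normal_pdf.
apply: le_integrable => //.
  apply/measurable_EFinP; apply: measurable_funM; last exact: measurable_normal_pdf.
  exact: measurable_funB.
move=> x _; rewrite /= lee_fin.
rewrite -{2}[p x]mul1r -mulrDl !normrM ler_wpM2r // [leRHS]ger0_norm; last first.
  by rewrite addr_ge0 ?sqr_ge0.
have := sqr_ge0 (`|x - m| - 1); rewrite -(@real_normK _ (x - m)) ?num_real //.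
by have := normr_ge0 (x - m); nra.
Qed.

Lemma integrableM_normal_pdf (g h : R -> R) (C : R) :
  measurable_fun setT g -> (forall x, `|g x| <= C) ->
  mu.-integrable setT (fun x => (h x * p x)%:E) ->
  mu.-integrable setT (fun x => (h x * g x * p x)%:E).
Proof.
move=> mg gC ih.
have := integrableZl measurableT C ih; apply: le_integrable => //.
  have /integrableP[/measurable_EFinP mh _] := ih.
  apply/measurable_EFinP.
  rewrite (_ : (fun x => _) = (fun x => (h x * p x) * g x)); last first.
    by apply/funext => x; ring.
  exact: measurable_funM.
move=> x _; rewrite -EFinM /= lee_fin mulrAC mulrC normrM [leRHS]normrM.
by rewrite ler_wpM2r // (le_trans (gC x)) // ler_norm.
Qed.

(** Covers the boundary terms of all integrations by parts over the line, where [g] is 1, [x - m] or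
    a sine. The quadratic bound above leaves a decay of order 1 / |x - m|. *)
Lemma normal_pdf_cvg0 (g : R -> R) (C : R) : (forall x, `|g x| <= C * (1 + `|x - m|)) ->
  (g x * p x @[x --> +oo] --> 0) /\ (g x * p x @[x --> -oo] --> 0).
Proof.
move=> gC.
have [C' C'0 hC'] := sqrM_normal_pdf_bound.
have s20 : s * Num.sqrt 2 != 0 by rewrite mulf_neq0 // gt_eqF // sqrtr_gt0.
pose K := 2 * C' * normal_peak (s * Num.sqrt 2).
have K0 : 0 <= K by rewrite !mulr_ge0 ?normal_peak_ge0.
have C0 : 0 <= C.
  have := gC m; rewrite subrr normr0 addr0 mulr1; exact: le_trans.
have bnd x : 1 <= `|x - m| -> `|g x * p x| <= C * K / `|x - m|.
  move=> x1; have x0 : 0 < `|x - m| by exact: lt_le_trans x1.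
  rewrite ler_pdivlMr // normrM (ger0_norm (normal_pdf_ge0 _ _ _)).
  apply: (@le_trans _ _ (C * (1 + `|x - m|) * p x * `|x - m|)).
    by rewrite !ler_wpM2r ?normal_pdf_ge0.
  rewrite -!mulrA; apply: ler_wpM2l => //.
  apply: (@le_trans _ _ (2 * ((x - m) ^+ 2 * p x))).
    rewrite -(@real_normK _ (x - m)) ?num_real //.
    have := normal_pdf_ge0 m s x; move: x1; set a := `|x - m|; set b := p x => a1 b0.
    rewrite (_ : (1 + a) * (b * a) = (1 + a) * a * b); last by ring.
    by rewrite mulrA ler_wpM2r //; nra.
  rewrite /K -mulrA ler_wpM2l // (le_trans (hC' x)) // ler_wpM2l //.
  exact: normal_pdf_ub.
split.
- apply/cvgrPdist_le => e e0; near=> x.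
  have x1 : 1 <= `|x - m|.
    rewrite (le_trans _ (ler_norm _)) // lerBrDr.
    by near: x; apply: nbhs_pinfty_ge; exact: num_real.
  rewrite sub0r normrN (le_trans (bnd x x1)) // ler_pdivrMr ?(lt_le_trans _ x1) //.
  rewrite -ler_pdivrMl // (le_trans _ (ler_norm _)) // lerBrDr.
  by near: x; apply: nbhs_pinfty_ge; exact: num_real.
- apply/cvgrPdist_le => e e0; near=> x.
  have x1 : 1 <= `|x - m|.
    rewrite -normrN (le_trans _ (ler_norm _)) // opprB lerBrDr addrC -lerBrDr.
    by near: x; apply: nbhs_ninfty_le; exact: num_real.
  rewrite sub0r normrN (le_trans (bnd x x1)) // ler_pdivrMr ?(lt_le_trans _ x1) //.
  rewrite -ler_pdivrMl // -normrN (le_trans _ (ler_norm _)) // opprB.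
  rewrite lerBrDr addrC -lerBrDr.
  by near: x; apply: nbhs_ninfty_le; exact: num_real.
Unshelve. all: by end_near. Qed.

End normal_moments.

Section normal_characteristic.
Variables (R : realType) (m s : R).
Hypothesis s0 : s != 0.
Local Notation mu := (@lebesgue_measure R).
Local Notation p := (normal_pdf m s).

Let cp : continuous p. Proof. exact: continuous_normal_pdf. Qed.
Let mp : measurable_fun setT p. Proof. exact: measurable_normal_pdf. Qed.

Variable t : R.

Lemma continuous_affine_comp (g : R -> R) (a : R) : continuous g ->
  continuous (fun x => g (a * (x - m) + t)).
Proof.
move=> cg x; apply: (@continuous_comp _ _ _ (fun x => a * (x - m) + t) g); last exact: cg.
apply: cvgD; last exact: cvg_cst.
by apply: cvgMl_tmp; apply: cvgB; [exact: cvg_id|exact: cvg_cst].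
Qed.

Lemma Rintegral_normal_pdf_center : \int[mu]_x ((x - m) * p x) = 0.
Proof.
have im := integrable_mul_normal_pdf m s0.
have := @integralT_FTC _ p (fun x => - ((x - m) / s ^+ 2 * p x)) _
  (is_derive_normal_pdf m s0).
have -> : (fun x => - ((x - m) / s ^+ 2 * p x)) =
    (fun x => (- (s ^+ 2)^-1) * ((x - m) * p x)).
  by apply/funext => x; ring.
rewrite RintegralZl // => h; apply/eqP.
suff /eqP : - (s ^+ 2)^-1 * \int[mu]_x ((x - m) * p x) = 0.
  by rewrite mulf_eq0 oppr_eq0 invr_eq0 expf_eq0 /= (negbTE s0).
have [cy cNy] : p x @[x --> +oo] --> 0 /\ p x @[x --> -oo] --> 0.
  have [|] := @normal_pdf_cvg0 _ m s s0 (cst 1) 1.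
    by move=> x; rewrite /= normr1 mul1r lerDl.
  have -> : (fun x => cst 1 x * p x) = p by apply/funext => x; rewrite mul1r.
  by [].
apply: h => //.
- move=> x; apply: cvgMl_tmp; apply: cvgM; last exact: cp.
  by apply: cvgB; [exact: cvg_id|exact: cvg_cst].
- rewrite /comp; under eq_fun do rewrite EFinM.
  exact: integrableZl.
Qed.

Lemma Rintegral_normal_pdf_sqr : \int[mu]_x ((x - m) ^+ 2 * p x) = s ^+ 2.
Proof.
have im := integrable_sqrM_normal_pdf m s0.
have ip := integrable_normal_pdf m s.
(* The derivative of [(x - m) * p x]. *)
pose f x := p x - (s ^+ 2)^-1 * ((x - m) ^+ 2 * p x).
have s2 : s ^+ 2 != 0 by rewrite expf_neq0.
have ip' : mu.-integrable setT (EFin \o (fun x => (s ^+ 2)^-1 * ((x - m) ^+ 2 * p x))).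
  by rewrite /comp; under eq_fun do rewrite EFinM; exact: integrableZl.
have : \int[mu]_x f x = 0.
  have [cy cNy] : (x - m) * p x @[x --> +oo] --> 0 /\ (x - m) * p x @[x --> -oo] --> 0.
    apply: (@normal_pdf_cvg0 _ m s s0 (fun x => x - m) 1).
    by move=> x; rewrite mul1r lerDr.
  apply: (@integralT_FTC _ (fun x => (x - m) * p x) f _ _ _ cy cNy).
  - have cx : continuous (fun x : R => x - m).
      by move=> x; apply: cvgB; [exact: cvg_id|exact: cvg_cst].
    move=> x; apply: cvgB; first exact: cp.
    apply: cvgMl_tmp; apply: cvgM; last exact: cp.
    by apply: cvgM; exact: cx.
  - move=> x; have := is_derive_normal_pdf m s0 x => dp.
    apply: is_derive_eq; rewrite /f /GRing.scale /=; field.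
    exact: s0.
  - exact: (integrableB measurableT ip ip').
rewrite /f RintegralB // RintegralZl //.
have -> : \int[mu]_x p x = 1 by rewrite /Rintegral integral_normal_pdf.
move/eqP; rewrite subr_eq0 => /eqP/esym h.
by apply: (mulfI (invr_neq0 s2)); rewrite h mulVf.
Qed.

Let psi (l : R) := \int[mu]_x (cos (l * (x - m) + t) * p x).

Let cosi (l : R) : mu.-integrable setT (EFin \o (fun x => cos (l * (x - m) + t) * p x)).
Proof.
have ip : mu.-integrable setT (fun x => (1 * p x)%:E).
  by under eq_fun do rewrite mul1r; exact: integrable_normal_pdf.
have -> : EFin \o (fun x => cos (l * (x - m) + t) * p x) =
    (fun x => (1 * cos (l * (x - m) + t) * p x)%:E).
  by apply/funext => x; rewrite /= mul1r.
apply: (@integrableM_normal_pdf _ m s (fun x => cos (l * (x - m) + t)) (cst 1) 1 _ _ ip).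
  apply: continuous_measurable_fun.
  exact: (continuous_affine_comp (@continuous_cos R)).
by move=> x; rewrite ler_norml cos_geN1 cos_le1.
Qed.

Let sini (l : R) : mu.-integrable setT (EFin \o (fun x => (x - m) * sin (l * (x - m) + t) * p x)).
Proof.
apply: (@integrableM_normal_pdf _ m s (fun x => sin (l * (x - m) + t)) (fun x => x - m) 1).
- apply: continuous_measurable_fun.
  exact: (continuous_affine_comp (@continuous_sin R)).
- by move=> x; rewrite ler_norml sin_geN1 sin_le1.
- exact: integrable_mul_normal_pdf.
Qed.

(** Integration by parts with primitive [sin (l * (x - m) + t) * p x]. The left side is minus the
    derivative of [psi], so this is the differential equation that determines [psi]. *)
Let psi_sin (l : R) :
  \int[mu]_x ((x - m) * sin (l * (x - m) + t) * p x) = s ^+ 2 * l * psi l.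
Proof.
pose f x := l * (cos (l * (x - m) + t) * p x) - (s ^+ 2)^-1 * ((x - m) * sin (l * (x - m) + t) * p x).
have s2 : s ^+ 2 != 0 by rewrite expf_neq0.
have i1 : mu.-integrable setT (EFin \o (fun x => l * (cos (l * (x - m) + t) * p x))).
  by rewrite /comp; under eq_fun do rewrite EFinM; apply: integrableZl => //; exact: cosi.
have i2 : mu.-integrable setT (EFin \o (fun x => (s ^+ 2)^-1 * ((x - m) * sin (l * (x - m) + t) * p x))).
  by rewrite /comp; under eq_fun do rewrite EFinM; apply: integrableZl => //; exact: sini.
have : \int[mu]_x f x = 0.
  have [cy cNy] : sin (l * (x - m) + t) * p x @[x --> +oo] --> 0 /\
      sin (l * (x - m) + t) * p x @[x --> -oo] --> 0.
    apply: (@normal_pdf_cvg0 _ m s s0 (fun x => sin (l * (x - m) + t)) 1).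
    move=> x; rewrite mul1r (@le_trans _ _ 1) // ?lerDl //.
    by rewrite ler_norml sin_geN1 sin_le1.
  apply: (@integralT_FTC _ (fun x => sin (l * (x - m) + t) * p x) f _ _ _ cy cNy).
  - have cx : continuous (fun x : R => x - m).
      by move=> x; apply: cvgB; [exact: cvg_id|exact: cvg_cst].
    move=> x; apply: cvgB; apply: cvgMl_tmp; apply: cvgM; try exact: cp.
      exact: (continuous_affine_comp (@continuous_cos R)).
    apply: cvgM; first exact: cx.
    exact: (continuous_affine_comp (@continuous_sin R)).
  - move=> x; have := is_derive_normal_pdf m s0 x => dp.
    apply: is_derive_eq; rewrite /f /GRing.scale /=; field.
    exact: s0.
  - exact: (integrableB measurableT i1 i2).
rewrite /f RintegralB // !RintegralZl //.
rewrite -/(psi l).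
move/eqP; rewrite subr_eq0 => /eqP/esym h.
by apply: (mulfI (invr_neq0 s2)); rewrite h; field.
Qed.

(** The characteristic function in real form, the phase [t] replacing complex exponentials.
    Differentiating under the integral gives psi' = - s^2 l psi, so
    [psi l * expR (s ^+ 2 * l ^+ 2 / 2)] is constant, equal to its value [cos t] at 0. *)
Lemma Rintegral_cos_normal_pdf (l : R) :
  \int[mu]_x (cos (l * (x - m) + t) * p x) = cos t * expR (- (s ^+ 2 * l ^+ 2 / 2)).
Proof.
have dpsi (a : R) : is_derive a 1 psi (- (s ^+ 2 * a * psi a)).
  pose f (l x : R) := cos (l * (x - m) + t) * p x.
  have df (b x : R) : is_derive b 1 (f ^~ x) (- ((x - m) * sin (b * (x - m) + t) * p x)).
    by rewrite /f; apply: is_derive_eq; rewrite /GRing.scale /=; ring.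
  have d1 b x : partial1of2 f b x = - ((x - m) * sin (b * (x - m) + t) * p x).
    by rewrite partial1of2E; exact: derive_val.
  have aI : `]a - 1, a + 1[%classic a by rewrite /= in_itv /=; apply/andP; split; lra.
  have iG : mu.-integrable setT (EFin \o (fun x => `|x - m| * p x)).
    have -> : EFin \o (fun x => `|x - m| * p x) = abse \o (fun x => ((x - m) * p x)%:E).
      by apply/funext => x; rewrite /= normrM (ger0_norm (normal_pdf_ge0 _ _ _)).
    exact: integrable_abse (integrable_mul_normal_pdf m s0).
  have h1 x : `]a - 1, a + 1[%classic x -> mu.-integrable setT (EFin \o f x).
    by move=> _; exact: cosi.
  have h2 (b x : R) : `]a - 1, a + 1[%classic b -> setT x -> derivable (f ^~ x) b 1.
    by move=> _ _; have [] := df b x.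
  have h3 x : 0 <= `|x - m| * p x by rewrite mulr_ge0 // normal_pdf_ge0.
  have h4 b x : `]a - 1, a + 1[%classic b -> setT x -> `|partial1of2 f b x| <= `|x - m| * p x.
    move=> _ _; rewrite d1 normrN !normrM (ger0_norm (normal_pdf_ge0 _ _ _)).
    rewrite ler_wpM2r ?normal_pdf_ge0 // ler_piMr //.
    by rewrite ler_norml sin_geN1 sin_le1.
  split; first exact: (derivable_under_integral measurableT aI h1 h2 h3 iG h4).
  rewrite -derive1E (differentiation_under_integral measurableT aI h1 h2 h3 iG h4).
  rewrite -psi_sin -mulN1r -RintegralZl //.
  by apply: eq_Rintegral => x _; rewrite d1 mulN1r.
pose h l := psi l * expR (s ^+ 2 * l ^+ 2 / 2).
have dh (a : R) : is_derive a 1 h 0.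
  by rewrite /h; have := dpsi a => ?; apply: is_derive_eq; rewrite /GRing.scale /=; field.
have hc := is_derive_0_is_cst l 0 dh.
have : h 0 = cos t.
  rewrite /h expr0n /= mulr0 mul0r expR0 mulr1 /psi /Rintegral.
  under eq_integral do rewrite mul0r add0r.
  rewrite -/(Rintegral _ _ _) RintegralZl //; last exact: integrable_normal_pdf.
  by rewrite /Rintegral integral_normal_pdf mulr1.
rewrite -hc /h => e; rewrite -/(psi l) expRN.
have E0 : expR (s ^+ 2 * l ^+ 2 / 2) != 0 by rewrite gt_eqF // expR_gt0.
by rewrite -e mulfK.
Qed.

End normal_characteristic.

Section normal_tails.
Variables (R : realType).
Local Notation mu := (@lebesgue_measure R).

(** Chebyshev's inequality. *)
Lemma normal_prob_deviation (m s e : R) (A : set R) : s != 0 -> 0 < e ->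
  measurable A -> (forall x, A x -> e <= `|x - m|) ->
  (normal_prob m s A <= (s ^+ 2 / e ^+ 2)%:E)%E.
Proof.
move=> s0 e0 mA hA.
have e2 : 0 < e ^+ 2 by rewrite exprn_gt0.
have i2 := integrable_sqrM_normal_pdf m s0.
have <- : (\int[mu]_x ((x - m) ^+ 2 * normal_pdf m s x / e ^+ 2)%:E = (s ^+ 2 / e ^+ 2)%:E)%E.
  have i3 : mu.-integrable setT (EFin \o (fun x => (x - m) ^+ 2 * normal_pdf m s x / e ^+ 2)).
    by rewrite /comp; under eq_fun do rewrite EFinM; exact: integrableZr.
  rewrite -[LHS]fineK; last exact: integrable_fin_num.
  congr EFin; rewrite -/(Rintegral _ _ _) RintegralZr //.
  by rewrite Rintegral_normal_pdf_sqr.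
rewrite /normal_prob [leLHS]integral_mkcond; apply: ge0_le_integral => //.
- by move=> x _; rewrite patchE; case: ifP => // _; rewrite lee_fin normal_pdf_ge0.
- apply/(measurable_restrictT _ _).1 => //; apply: measurable_funTS.
  by apply/measurable_EFinP; exact: measurable_normal_pdf.
- have /integrableP[/measurable_EFinP m2 _] := i2.
  by apply/measurable_EFinP; exact: measurable_funM.
- move=> x _; rewrite patchE; case: ifPn => [/set_mem Ax|_]; rewrite lee_fin.
    rewrite mulrAC ler_peMl ?normal_pdf_ge0 // ler_pdivlMr // mul1r.
    rewrite -(@real_normK _ (x - m)) ?num_real // lerXn2r ?nnegrE //; first exact: ltW.
    exact: hA.
  by rewrite divr_ge0 ?(ltW e2) // mulr_ge0 ?sqr_ge0 ?normal_pdf_ge0.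
Qed.

Variable s : R.
Hypothesis s_gt0 : 0 < s.
Let s0 : s != 0. Proof. by rewrite gt_eqF. Qed.
Local Notation p := (normal_pdf 0 s).

Let cp : continuous p. Proof. exact: continuous_normal_pdf. Qed.
Let mp : measurable_fun setT (EFin \o p).
Proof. by apply/measurable_EFinP; exact: measurable_normal_pdf. Qed.

Let p_cvg : p x @[x --> +oo] --> 0.
Proof.
have [|+ _] := @normal_pdf_cvg0 _ 0 s s0 (cst 1) 1.
  by move=> x; rewrite /= normr1 mul1r lerDl.
by have -> : (fun x => cst 1 x * p x) = p by apply/funext => x; rewrite mul1r.
Qed.

Lemma normal_prob_itvoy (u : R) :
  normal_prob 0 s `]u, +oo[ = (\int[mu]_(x in `[u, +oo[) (p x)%:E)%E.
Proof.
by rewrite /normal_prob integral_itv_obnd_cbnd //; exact: measurable_funTS.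
Qed.

(** On the ray x / u >= 1, and [x / u * p x] has an explicit primitive, a multiple of [p]. *)
Lemma mills_ub (u : R) : 0 < u ->
  (normal_prob 0 s `]u, +oo[ <= (s ^+ 2 * p u / u)%:E)%E.
Proof.
move=> u0; rewrite normal_prob_itvoy.
have -> : ((s ^+ 2 * p u / u)%:E = \int[mu]_(x in `[u, +oo[) (x / u * p x)%:E)%E.
  rewrite (@ge0_continuous_FTC2y _ _ (fun x => - (s ^+ 2 / u * p x)) u 0).
  - by rewrite -EFinB sub0r opprK mulrAC.
  - by move=> x ux; rewrite mulr_ge0 ?normal_pdf_ge0 // divr_ge0 ?(ltW u0) // (le_trans (ltW u0)).
  - apply: continuous_subspaceT => x; apply: cvgM; last exact: cp.
    by apply: cvgMr_tmp; exact: cvg_id.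
  - rewrite -[X in _ --> X]oppr0; apply: cvgN; rewrite -[X in _ --> X](mulr0 (s ^+ 2 / u)).
    by apply: cvgMl_tmp; exact: p_cvg.
  - by move=> x _; have := is_derive_normal_pdf 0 s0 x => dp.
  - apply: cvg_at_right_filter; apply: cvgN; apply: cvgMl_tmp; exact: cp.
  - move=> x; rewrite in_itv /= andbT => ux; rewrite derive1E.
    have := is_derive_normal_pdf 0 s0 x => dp; rewrite derive_val.
    by rewrite /GRing.scale /= subr0; field; rewrite s0 gt_eqF.
apply: ge0_le_integral => //.
- by move=> x _; rewrite lee_fin normal_pdf_ge0.
- exact: measurable_funTS.
- apply: measurable_funTS; apply/measurable_EFinP; apply: measurable_funM.
    exact: measurable_funM.
  exact: measurable_normal_pdf.
- move=> x; rewrite /= in_itv /= andbT => ux; rewrite lee_fin ler_peMl ?normal_pdf_ge0 //.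
  by rewrite ler_pdivlMr // mul1r.
Qed.

Lemma mills_lb (u : R) : 0 < u ->
  ((s ^+ 2 * p u / u / (1 + s ^+ 2 / u ^+ 2))%:E <= normal_prob 0 s `]u, +oo[)%E.
Proof.
move=> u0; rewrite normal_prob_itvoy.
have s2 : 0 < s ^+ 2 by rewrite exprn_gt0.
have u2 : 0 < u ^+ 2 by rewrite exprn_gt0.
have k0 : 0 < 1 + s ^+ 2 / u ^+ 2 by rewrite addr_gt0 // divr_gt0.
pose f x := (1 + s ^+ 2 / x ^+ 2) / (1 + s ^+ 2 / u ^+ 2) * p x.
have f0 x : 0 <= f x.
  rewrite mulr_ge0 ?normal_pdf_ge0 // divr_ge0 ?(ltW k0) // addr_ge0 //.
  by rewrite divr_ge0 ?sqr_ge0.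
have cV x : u <= x -> {for x, continuous (fun x : R => x^-1)}.
  by move=> ux; apply: cvgV; [rewrite gt_eqF // (lt_le_trans u0)|exact: cvg_id].
have cf x : u <= x -> {for x, continuous f}.
  move=> ux; apply: cvgM; last exact: cp.
  apply: cvgMr_tmp; apply: cvgD; first exact: cvg_cst.
  apply: cvgMl_tmp; apply: cvgV.
    by rewrite expf_neq0 // gt_eqF // (lt_le_trans u0).
  exact: sqr_continuous.
have -> : ((s ^+ 2 * p u / u / (1 + s ^+ 2 / u ^+ 2))%:E =
    \int[mu]_(x in `[u, +oo[) (f x)%:E)%E.
  pose F x := - (s ^+ 2 / (1 + s ^+ 2 / u ^+ 2) * (x^-1 * p x)).
  rewrite (@ge0_continuous_FTC2y _ _ F u 0).
  - by rewrite -EFinB sub0r opprK; congr EFin; rewrite -!mulrA; congr (_ * _); ring.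
  - by move=> x ux.
  - apply: (@continuous_in_subspaceT _ _ `[u, +oo[%classic f) => x.
    by rewrite inE /= in_itv /= andbT => ux; exact: cf.
  - rewrite /F -[X in _ --> X]oppr0; apply: cvgN.
    rewrite -[X in _ --> X](mulr0 (s ^+ 2 / (1 + s ^+ 2 / u ^+ 2))).
    apply: cvgMl_tmp; rewrite -[X in _ --> X](mulr0 0).
    apply: cvgM; last exact: p_cvg.
    by apply/gtr0_cvgV0; [apply: nbhs_pinfty_gt; exact: num_real|exact: cvg_id].
  - move=> x ux; have := is_derive_normal_pdf 0 s0 x => dp.
    have x0 : x != 0 by rewrite gt_eqF // (lt_trans u0).
    by have dV := @is_deriveV _ id x 1 1 x0 (is_derive_id _ _); rewrite /F.
  - apply: cvg_at_right_filter; apply: cvgN; apply: cvgMl_tmp.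
    by apply: cvgM; [exact: cV|exact: cp].
  - move=> x; rewrite in_itv /= andbT => ux; rewrite derive1E.
    have := is_derive_normal_pdf 0 s0 x => dp.
    have x0 : x != 0 by rewrite gt_eqF // (lt_trans u0).
    have dV := @is_deriveV _ id x 1 1 x0 (is_derive_id _ _).
    rewrite /F derive_val /f /GRing.scale /= subr0.
    by field; rewrite s0 x0 gt_eqF //= gt_eqF // addr_gt0.
apply: ge0_le_integral => //.
- by move=> x _; rewrite lee_fin.
- apply/measurable_EFinP; apply: subspace_continuous_measurable_fun => //.
  apply: (@continuous_in_subspaceT _ _ `[u, +oo[%classic f) => x.
  by rewrite inE /= in_itv /= andbT => ux; exact: cf.
- exact: measurable_funTS.
- move=> x; rewrite /= in_itv /= andbT => ux; rewrite lee_fin ler_piMl ?normal_pdf_ge0 //.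
  rewrite ler_pdivrMr // mul1r lerD2l ler_wpM2l ?(ltW s2) //.
  rewrite lef_pV2 ?posrE ?exprn_gt0 // ?(lt_le_trans u0) //.
  by rewrite lerXn2r ?nnegrE // ltW // (lt_le_trans u0).
Qed.

End normal_tails.

(** * Independence in Gaussian spaces *)

Section bounded_measurable.
Context d (T : measurableType d) (R : realType).

Definition bounded_measurable (f : T -> R) :=
  measurable_fun setT f /\ exists C, forall x, `|f x| <= C.

Lemma bm_cst (c : R) : bounded_measurable (cst c).
Proof. by split; [exact: measurable_cst|exists `|c|]. Qed.

Lemma bmD f g : bounded_measurable f -> bounded_measurable g ->
  bounded_measurable (fun x => f x + g x).
Proof.
move=> [mf [C hC]] [mg [D hD]]; split; first exact: measurable_funD.
by exists (C + D) => x; rewrite (le_trans (ler_normD _ _)) // lerD.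
Qed.

Lemma bmM f g : bounded_measurable f -> bounded_measurable g ->
  bounded_measurable (fun x => f x * g x).
Proof.
move=> [mf [C hC]] [mg [D hD]]; split; first exact: measurable_funM.
by exists (C * D) => x; rewrite normrM ler_pM.
Qed.

Lemma bmZ c f : bounded_measurable f -> bounded_measurable (fun x => c * f x).
Proof. by move=> bf; apply: bmM => //; exact: bm_cst. Qed.

Lemma bmB f g : bounded_measurable f -> bounded_measurable g ->
  bounded_measurable (fun x => f x - g x).
Proof.
move=> bf bg; have := bmD bf (bmZ (-1) bg); congr bounded_measurable.
by apply/funext => x; rewrite mulN1r.
Qed.

Lemma bm_cos f : measurable_fun setT f -> bounded_measurable (fun x => cos (f x)).
Proof.
move=> mf; split; last by exists 1 => x; rewrite ler_norml cos_geN1 cos_le1.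
by apply: measurableT_comp mf; apply: continuous_measurable_fun; exact: continuous_cos.
Qed.

Lemma bm_indic (A : set T) : measurable A -> bounded_measurable (\1_A : T -> R).
Proof.
move=> mA; split; first exact: measurable_indic.
by exists 1 => x; rewrite indicE; case: (_ \in _); rewrite ?normr1 ?normr0.
Qed.

Variable P : probability T R.

Lemma bm_integrable f : bounded_measurable f -> P.-integrable setT (EFin \o f).
Proof.
move=> [mf [C hC]].
apply: (le_integrable measurableT _ _ (finite_measure_integrable_cst P C measurableT)).
  exact/measurable_EFinP.
by move=> x _; rewrite /= lee_fin (le_trans (hC x)) // ler_norm.
Qed.

Lemma Rintegral_indic (A : set T) : measurable A -> \int[P]_x (\1_A x : R) = fine (P A).
Proof. by move=> mA; rewrite /Rintegral integral_indic // setIT. Qed.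

Lemma bounded_cvg (f_ : nat -> T -> R) (f : T -> R) (C : R) :
  (forall n, measurable_fun setT (f_ n)) -> (forall n x, `|f_ n x| <= C) ->
  (forall x, f_ n x @[n --> \oo] --> f x) -> (forall x, `|f x| <= C) ->
  measurable_fun setT f ->
  \int[P]_x f_ n x @[n --> \oo] --> \int[P]_x f x.
Proof.
move=> mf_ f_C f_f fC mf.
have bf : bounded_measurable f by split => //; exists C.
have := @dominated_cvg _ T R P setT measurableT (fun n => EFin \o f_ n) (EFin \o f)
  (EFin \o cst C).
move=> /(_ _ _ _ (finite_measure_integrable_cst P C measurableT)) h.
apply: fine_cvg; rewrite -/(Rintegral _ _ _) fineK.
  apply: h => //.
  - by move=> n; exact/measurable_EFinP.
  - by move=> x _; apply: cvg_EFin; [exact: nearW|exact: f_f].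
  - by move=> n x _; rewrite /= lee_fin.
by apply: integrable_fin_num => //; exact: bm_integrable.
Qed.

End bounded_measurable.

Lemma probability_integral_cst d (T : measurableType d) (R : realType)
  (P : probability T R) (c : R) : (\int[P]_x c%:E = c%:E)%E.
Proof. by rewrite integral_cst // [X in (_ * X)%E]probability_setT mule1. Qed.

Lemma bounded_Fubini d1 d2 (T1 : measurableType d1) (T2 : measurableType d2)
    (R : realType) (P1 : probability T1 R) (P2 : probability T2 R)
    (f : T1 * T2 -> R) (C : R) :
  measurable_fun setT f -> (forall z, `|f z| <= C) ->
  \int[P1]_x \int[P2]_y f (x, y) = \int[P2]_y \int[P1]_x f (x, y).
Proof.
move=> mf fC.
have b1 x : P2.-integrable setT (EFin \o (fun y => f (x, y))).
  apply: bm_integrable; split; last by exists C => y.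
  exact: (measurableT_comp mf (pair1_measurable x)).
have b2 y : P1.-integrable setT (EFin \o (fun x => f (x, y))).
  apply: bm_integrable; split; last by exists C => x.
  exact: (measurableT_comp mf (pair2_measurable y)).
have imf : (P1 \x P2)%E.-integrable setT (EFin \o f).
  apply/integrable12ltyP; first exact/measurable_EFinP.
  apply: (@le_lt_trans _ _ (\int[P1]_x \int[P2]_y (C%:E))%E).
    apply: ge0_le_integral => //.
    - by move=> x _; exact: integral_ge0.
    - apply: (@measurable_fun_fubini_tonelli_F _ _ _ _ _ P2 (abse \o (EFin \o f))) => //.
        by apply: measurableT_comp => //; exact/measurable_EFinP.
      by move=> z; exact: abse_ge0.
    - move=> x _; apply: ge0_le_integral => //.
      + apply: measurableT_comp => //; apply/measurable_EFinP.
        exact: (measurableT_comp mf (pair1_measurable x)).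
      + by move=> z _; rewrite /= lee_fin.
  under eq_integral do rewrite probability_integral_cst.
  by rewrite probability_integral_cst ltry.
have := Fubini imf; rewrite /Rintegral => h.
transitivity (fine (\int[P1]_x \int[P2]_y (EFin \o f) (x, y))%E).
  congr fine; apply: eq_integral => x _; rewrite fineK //.
  exact: (integrable_fin_num measurableT (b1 x)).
rewrite h; congr fine; apply: eq_integral => y _; rewrite fineK //.
exact: (integrable_fin_num measurableT (b2 y)).
Qed.

Lemma normal_pdfC (R : realType) (x y s : R) : s != 0 ->
  normal_pdf x s y = normal_pdf y s x.
Proof. by move=> s0; rewrite !normal_pdfE // /normal_fun -sqrrN opprB. Qed.

Lemma normal_prob_indic (R : realType) (m s : R) (A : set R) : measurable A ->
  normal_prob m s A = (\int[lebesgue_measure]_z (normal_pdf m s z * \1_A z)%:E)%E.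
Proof.
move=> mA; transitivity (\int[lebesgue_measure]_(z in A) (normal_pdf m s z)%:E)%E => //.
rewrite integral_mkcond; apply: eq_integral => z _.
by rewrite patchE indicE; case: ifP => _; rewrite ?mulr1 ?mulr0.
Qed.

Lemma measurable_normal_pdf2 (R : realType) (s : R) : s != 0 ->
  measurable_fun setT (fun z : R * R => normal_pdf z.1 s z.2).
Proof.
move=> s0.
rewrite (_ : (fun z : R * R => _) = (fun z : R * R => normal_pdf 0 s (z.2 - z.1))).
  apply: measurableT_comp; first exact: measurable_normal_pdf.
  by apply: measurable_funB; [exact: measurable_snd|exact: measurable_fst].
by apply/funext => z; rewrite !normal_pdfE // /normal_fun subr0.
Qed.

Lemma measurable_normal_prob (R : realType) (s : R) (A : set R) :
  s != 0 -> measurable A ->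
  measurable_fun setT (fun x => fine (normal_prob x s A)).
Proof.
move=> s0 mA; apply: (measurableT_comp (f := fine)) => //.
pose f (z : R * R) := (normal_pdf z.1 s z.2 * \1_A z.2)%:E.
rewrite (_ : (fun x => _) = (fun x => \int[lebesgue_measure]_y f (x, y))%E); last first.
  by apply/funext => x; rewrite normal_prob_indic.
apply: measurable_fun_fubini_tonelli_F => [|z]; last first.
  by rewrite lee_fin mulr_ge0 ?normal_pdf_ge0.
apply/measurable_EFinP; apply: measurable_funM; first exact: measurable_normal_pdf2.
by apply: measurableT_comp => //; exact: measurable_snd.
Qed.

(** * Fourier uniqueness for a bounded weight *)

Section fourier_uniqueness.
Context d (T : measurableType d) (R : realType) (P : probability T R).
Local Notation mu := (@lebesgue_measure R).
Variables (H X : T -> R).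
Hypothesis bH : bounded_measurable H.
Hypothesis mX : measurable_fun setT X.
Hypothesis HX : forall s t, \int[P]_w (H w * cos (s * X w + t)) = 0.

Let mH : measurable_fun setT H. Proof. by case: bH. Qed.

(* A Gaussian density is the Fourier transform of a Gaussian one, so [HX] kills
   [H] against [normal_pdf y s \o X]; integrating in [y] and letting [s] tend
   to [0] then reaches the indicators of rays. *)
Let kernel_zero (s y : R) : 0 < s -> \int[P]_w (H w * normal_pdf y s (X w)) = 0.
Proof.
move=> s0; have sn0 : s != 0 by rewrite gt_eqF.
have [C hC] : exists C : R, forall w, `|H w| <= C := bH.2.
pose N : probability (measurableTypeR R) R := normal_prob 0 s^-1.
pose f (z : T * R) := H z.1 * cos (z.2 * X z.1 + - z.2 * y).
have mf : measurable_fun setT f.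
  apply: measurable_funM; first by apply: measurableT_comp => //; exact: measurable_fst.
  apply: (measurableT_comp (f := cos)).
    by apply: continuous_measurable_fun; exact: continuous_cos.
  apply: measurable_funD; apply: measurable_funM.
  - exact: measurable_snd.
  - by apply: measurableT_comp => //; exact: measurable_fst.
  - by apply: measurableT_comp => //; exact: measurable_snd.
  - exact: measurable_cst.
have fC z : `|f z| <= C.
  rewrite normrM (le_trans _ (hC z.1)) // ler_piMr //.
  by rewrite ler_norml cos_geN1 cos_le1.
have := bounded_Fubini P N mf fC.
have -> : \int[N]_z \int[P]_w f (w, z) = 0.
  transitivity (\int[N]_z (cst 0 z : R)); last by rewrite Rintegral_cst // mul0r.
  by apply: eq_Rintegral => z _; rewrite /f /= (HX z (- z * y)).
have -> : \int[P]_w \int[N]_z f (w, z) =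
    \int[P]_w ((normal_peak s)^-1 * (H w * normal_pdf y s (X w))).
  apply: eq_Rintegral => w _.
  have bc : bounded_measurable (fun z : R => cos (z * X w + - z * y)).
    by apply: bm_cos; apply: measurable_funD; apply: measurable_funM => //.
  have bc' : N.-integrable setT (EFin \o (fun z : R => cos (z * X w + - z * y))).
    exact: bm_integrable.
  rewrite /f /= RintegralZl //.
  have sV : s^-1 != 0 by rewrite invr_eq0.
  rewrite Rintegral_normal_prob //; last 2 first.
  - by case: bc.
  - have ip : mu.-integrable setT (fun x => (1 * normal_pdf 0 s^-1 x)%:E).
      by under eq_fun do rewrite mul1r; exact: integrable_normal_pdf.
    have [mc [D hD]] := bc.
    have := integrableM_normal_pdf mc hD ip.
    by under eq_fun do rewrite mul1r.
  have -> : \int[mu]_x (cos (x * X w + - x * y) * normal_pdf 0 s^-1 x) =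
      \int[mu]_x (cos ((X w - y) * (x - 0) + 0) * normal_pdf 0 s^-1 x).
    by apply: eq_Rintegral => x _; congr (cos _ * _); ring.
  rewrite Rintegral_cos_normal_pdf // cos0 mul1r normal_pdfE // /normal_fun.
  rewrite [RHS]mulrCA mulKf; last by rewrite gt_eqF // normal_peak_gt0.
  by congr (_ * expR _); field; rewrite sn0.
have np : normal_peak s != 0 by rewrite gt_eqF // normal_peak_gt0.
have bk : bounded_measurable (fun w => H w * normal_pdf y s (X w)).
  apply: bmM => //; split.
    by apply: measurableT_comp => //; exact: measurable_normal_pdf.
  exists (normal_peak s) => w.
  by rewrite ger0_norm ?normal_pdf_ge0 // normal_pdf_ub.
rewrite RintegralZl //; last exact: bm_integrable.
by move/eqP; rewrite mulf_eq0 invr_eq0 (negbTE np) => /eqP.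
Qed.

Let smoothed_zero (s c : R) : 0 < s ->
  \int[P]_w (H w * fine (normal_prob (X w) s `]c, +oo[)) = 0.
Proof.
move=> s0; have sn0 : s != 0 by rewrite gt_eqF.
have [C hC] : exists C : R, forall w, `|H w| <= C := bH.2.
pose A : set R := `]c, +oo[%classic.
have mA : measurable A by exact: measurable_itv.
pose f (z : T * R) := H z.1 * (normal_pdf (X z.1) s z.2 * \1_A z.2).
have mf : measurable_fun setT f.
  apply: measurable_funM; first by apply: measurableT_comp => //; exact: measurable_fst.
  apply: measurable_funM; last first.
    by apply: measurableT_comp => //; exact: measurable_snd.
  rewrite (_ : (fun z : T * R => _) = (fun z : T * R => normal_pdf 0 s (z.2 - X z.1))).
    apply: measurableT_comp; first exact: measurable_normal_pdf.
    apply: measurable_funB; first exact: measurable_snd.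
    by apply: measurableT_comp => //; exact: measurable_fst.
  by apply/funext => z; rewrite !normal_pdfE // /normal_fun subr0.
have C0 : 0 <= C by apply: le_trans (hC point).
have fle z : `|f z| <= C * normal_pdf (X z.1) s z.2.
  rewrite normrM ler_pM // ger0_norm; last first.
    by rewrite mulr_ge0 ?normal_pdf_ge0.
  by rewrite ler_piMr ?normal_pdf_ge0 // indicE; case: (_ \in _).
have imf : (P \x mu)%E.-integrable setT (EFin \o f).
  apply/integrable12ltyP; first exact/measurable_EFinP.
  apply: (@le_lt_trans _ _ (\int[P]_w (C%:E))%E).
    apply: ge0_le_integral => //.
    - by move=> w _; exact: integral_ge0.
    - apply: (@measurable_fun_fubini_tonelli_F _ _ _ _ _ mu (abse \o (EFin \o f))) => //.
        by apply: measurableT_comp => //; exact/measurable_EFinP.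
      by move=> z; exact: abse_ge0.
    - move=> w _; apply: (@le_trans _ _ (\int[mu]_x (C%:E * (normal_pdf (X w) s x)%:E))%E).
        apply: ge0_le_integral => //.
        + apply: measurableT_comp => //; apply/measurable_EFinP.
          exact: (measurableT_comp mf (pair1_measurable w)).
        + apply: emeasurable_funM => //; apply/measurable_EFinP.
          exact: measurable_normal_pdf.
        + by move=> z _; rewrite /= -EFinM lee_fin fle.
      by rewrite integralZl ?integral_normal_pdf ?mule1 //; exact: integrable_normal_pdf.
  by rewrite probability_integral_cst ltry.
have := Fubini imf.
have -> : (\int[mu]_z \int[P]_w (EFin \o f) (w, z) = 0)%E.
  apply: integral0_eq => z _; rewrite -[LHS]fineK; last first.
    apply: integrable_fin_num => //; apply: bm_integrable.
    split; first exact: (measurableT_comp mf (pair2_measurable z)).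
    exists (C * normal_peak s) => w; rewrite (le_trans (fle (w, z))) //.
    by rewrite ler_wpM2l // normal_pdf_ub.
  congr EFin; rewrite /= /f /=.
  transitivity (\int[P]_w (\1_A z * (H w * normal_pdf z s (X w)))).
    by apply: eq_Rintegral => w _; rewrite normal_pdfC //; ring.
  rewrite RintegralZl ?kernel_zero ?mulr0 //.
  apply: bm_integrable; apply: bmM => //; split.
    by apply: measurableT_comp => //; exact: measurable_normal_pdf.
  exists (normal_peak s) => w.
  by rewrite ger0_norm ?normal_pdf_ge0 // normal_pdf_ub.
move=> h; rewrite /Rintegral.
suff -> : (\int[P]_w (H w * fine (normal_prob (X w) s `]c, +oo[))%:E = 0)%E by [].
rewrite -h; apply: eq_integral => w _ /=.
transitivity (\int[mu]_z ((H w)%:E * (normal_pdf (X w) s z * \1_A z)%:E))%E; last first.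
  by apply: eq_integral => z _; rewrite -EFinM.
have ip := integrable_normal_pdf (X w) s.
rewrite integralZl //; last first.
  apply: (le_integrable measurableT _ _ ip).
    apply/measurable_EFinP; apply: measurable_funM => //.
    exact: measurable_normal_pdf.
  move=> z _ /=; rewrite lee_fin !ger0_norm ?normal_pdf_ge0 //; last first.
    by rewrite mulr_ge0 ?normal_pdf_ge0.
  by rewrite ler_piMr ?normal_pdf_ge0 // indicE; case: (_ \in _).
rewrite EFinM; congr (_ * _)%E; rewrite fineK; last exact: fin_num_measure.
exact: normal_prob_indic.
Qed.

(** The noise has standard deviation e^2 and the ray is moved to the right by e. Chebyshev's bound
    e^4 / e^2 then vanishes even at the endpoint x = b, which the open ray excludes; for x > b the
    distance to the moved ray's complement stays at least (x - b) / 2. *)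
Lemma fourier_uniqueness_ray (b : R) : \int[P]_w (H w * \1_`]b, +oo[ (X w)) = 0.
Proof.
have [C hC] : exists C : R, forall w, `|H w| <= C := bH.2.
pose e (n : nat) : R := n.+1%:R^-1.
have e0 n : 0 < e n by rewrite invr_gt0.
have ecvg : e n @[n --> \oo] --> (0 : R) by exact: cvg_harmonic.
pose g n x := fine (normal_prob x (e n ^+ 2) `]b + e n, +oo[).
have z0 n : \int[P]_w (H w * g n (X w)) = 0 by apply: smoothed_zero; rewrite exprn_gt0.
have g01 n x : 0 <= g n x <= 1.
  by rewrite fine_ge0 //= -lee_fin fineK ?fin_num_measure // probability_le1.
have gcvg x : g n x @[n --> \oo] --> (\1_`]b, +oo[ x : R).
  have e1 n : e n <= 1 by rewrite invf_le1 // ler1n.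
  rewrite indicE; have [xb|bx] := leP x b.
    rewrite memNset; last by rewrite /= in_itv /= andbT; apply/negP; rewrite -leNgt.
    apply: (@squeeze_cvgr _ _ _ _ (cst 0) (fun n => e n)) => //; last exact: cvg_cst.
    near=> n; have /andP[-> _] /= := g01 n x.
    rewrite -lee_fin fineK ?fin_num_measure //.
    apply: (@le_trans _ _ ((e n ^+ 2) ^+ 2 / (e n) ^+ 2)%:E).
      apply: normal_prob_deviation => //; first by rewrite gt_eqF // exprn_gt0.
      move=> y; rewrite /= in_itv /= andbT => hy.
      by rewrite (le_trans _ (ler_norm _)) //; lra.
    rewrite lee_fin expr2 mulfK ?gt_eqF ?exprn_gt0 //.
    by rewrite expr2 ler_piMl // ltW.
  rewrite mem_set; last by rewrite /= in_itv /= bx.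
  pose k := (x - b) / 2; have k0 : 0 < k by rewrite divr_gt0 // subr_gt0.
  apply: (@squeeze_cvgr _ _ _ _ (fun n => 1 - e n / k ^+ 2) (cst 1)) => //; last exact: cvg_cst.
    near=> n; have /andP[_ ->] /= := g01 n x; rewrite andbT.
    rewrite lerBlDr -lerBlDl.
    pose A : set R := `]-oo, b + e n]%classic.
    have mA : measurable A by exact: measurable_itv.
    have -> : 1 - g n x = fine (normal_prob x (e n ^+ 2) A).
      rewrite /g (_ : `]b + e n, +oo[%classic = ~` A); last by rewrite /A setCitvl.
      rewrite probability_setC // fineB ?fin_num_measure // /=; lra.
    rewrite -lee_fin fineK ?fin_num_measure //.
    apply: (@le_trans _ _ ((e n ^+ 2) ^+ 2 / k ^+ 2)%:E).
      apply: normal_prob_deviation => //; first by rewrite gt_eqF // exprn_gt0.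
      move=> y; rewrite /A /= in_itv /= => hy.
      rewrite -normrN (le_trans _ (ler_norm _)) //.
      have : e n <= k by near: n; apply: (cvgr_le _ ecvg).
      by rewrite /k; lra.
    rewrite lee_fin ler_wpM2r ?invr_ge0 ?sqr_ge0 // -exprM.
    by rewrite -[leRHS]expr1 ler_wiXn2l // ltW.
  rewrite (_ : true%:R = 1 - 0 * (k ^+ 2)^-1); last by rewrite mul0r subr0.
  by apply: cvgB; [exact: cvg_cst|apply: cvgMr_tmp; exact: ecvg].
have mI : measurable_fun setT (fun w => \1_`]b, +oo[ (X w) : R).
  by apply: measurableT_comp => //; apply: measurable_indic; exact: measurable_itv.
have I1 w : `|\1_`]b, +oo[ (X w) : R| <= 1.
  by rewrite indicE; case: (_ \in _); rewrite ?normr1 ?normr0.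
have mg n : measurable_fun setT (fun w => g n (X w)).
  apply: (measurableT_comp (f := g n)) => //; apply: measurable_normal_prob.
    by rewrite gt_eqF // exprn_gt0.
  exact: measurable_itv.
have : \int[P]_w (H w * g n (X w)) @[n --> \oo] --> \int[P]_w (H w * \1_`]b, +oo[ (X w)).
  apply: (@bounded_cvg _ _ _ _ _ _ C).
  - by move=> n; exact: measurable_funM.
  - move=> n w; rewrite normrM (le_trans _ (hC w)) // ler_piMr //.
    by have /andP[h1 h2] := g01 n (X w); rewrite ger0_norm.
  - by move=> w; apply: cvgMl_tmp; exact: gcvg.
  - by move=> w; rewrite normrM (le_trans _ (hC w)) // ler_piMr.
  - exact: measurable_funM.
rewrite (funext z0) => h.
by apply: cvg_unique h _ => //; exact: cvg_cst.
Unshelve. all: by end_near. Qed.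

(** Dynkin induction from the open rays, which are stable under intersection. *)
Lemma fourier_uniqueness (A : set R) : measurable A ->
  \int[P]_w (H w * \1_(X @^-1` A) w) = 0.
Proof.
pose Q (A : set R) := \int[P]_w (H w * \1_(X @^-1` A) w) = 0.
have bHI (B : set R) : measurable B -> bounded_measurable (fun w => H w * \1_(X @^-1` B) w).
  move=> mB; apply: bmM => //; apply: bm_indic.
  by rewrite -[X in measurable X]setTI; exact: mX.
have iHI B mB := bm_integrable P (bHI B mB).
have iH := bm_integrable P bH.
(* Frequency and phase zero; the induction uses this for the full set and for complements. *)
have H0 : \int[P]_w H w = 0.
  rewrite -[RHS](HX 0 0); apply: eq_Rintegral => w _.
  by rewrite mul0r addr0 cos0 mulr1.
move=> mA; have := @dynkin_induction _ (measurableTypeR R) (@RGenOInfty.G R) Q.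
apply => //; first exact: RGenOInfty.measurableE.
- move=> _ _ [x ->] [y ->]; exists (Num.max x y).
  by apply/seteqP; split => z /=; rewrite !in_itv /= !andbT gt_max => /andP.
- rewrite /Q; under eq_Rintegral do rewrite preimage_setT indicT mulr1.
  exact: H0.
- move=> _ [x ->]; rewrite /Q -[RHS](fourier_uniqueness_ray x).
  by apply: eq_Rintegral => w _; rewrite !indicE; congr (_ * (_%:R)); rewrite !mem_setE.
- move=> S mS QS; rewrite /Q.
  transitivity (\int[P]_w (H w - H w * \1_(X @^-1` S) w)).
    apply: eq_Rintegral => w _; rewrite !indicE preimage_setC in_setC.
    by case: (_ \in _); rewrite /= ?mulr1 ?mulr0 ?subr0 ?subrr.
  rewrite RintegralB //; last exact: iHI.
  by rewrite H0 QS subr0.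
- move=> F mF tF QF; rewrite /Q.
  have [C hC] : exists C : R, forall w, `|H w| <= C := bH.2.
  pose S n w : R := \sum_(k < n) \1_(F k) (X w).
  have [S01 Scvg] : (forall n w, 0 <= S n w <= 1) /\
      (forall w, S n w @[n --> \oo] --> (\1_(X @^-1` \bigcup_k F k) w : R)).
    (* By disjointness at most one [F k] contains [X w], so the partial sums stay at 0 or jump once
       to 1; this gives both the bound and the limit. *)
    have SE w : (forall n, S n w = 0) /\ ~ (\bigcup_k F k) (X w) \/
        exists2 k0, (forall n, S n w = (k0 < n)%:R) & (\bigcup_k F k) (X w).
      have [[k0 _ Fk0]|nF] := pselect ((\bigcup_k F k) (X w)); last first.
        left; split => // n; apply: big1 => k _; rewrite indicE memNset //.
        by move=> Fk; apply: nF; exists k.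
      right; exists k0; last by exists k0.
      elim=> [|n IH]; first by rewrite /S big_ord0.
      rewrite /S big_ord_recr /= -/(S n w) IH indicE.
      have [<-|nk] := eqVneq k0 n; first by rewrite ltnn mem_set // ltnSn add0r.
      rewrite memNset; first by rewrite addr0 ltnS [in RHS]leq_eqVlt (negbTE nk).
      move=> Fn; move/eqP: nk; apply.
      by apply: (tF k0 n) => //; exists (X w).
    split=> [n w|w].
      by have [[-> _]|[k0 -> _]] := SE w; [rewrite lexx ler01|case: (_ < _)%N; rewrite ?lexx ler01].
    rewrite indicE; have [[Sw nF]|[k0 Sw iF]] := SE w.
      rewrite memNset //; under eq_fun do rewrite Sw; exact: cvg_cst.
    rewrite mem_set //; apply: cvg_near_cst; exists k0.+1 => // n /= hn.
    by rewrite Sw hn.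
  have mS n : measurable_fun setT (S n).
    apply: measurable_sum => k; apply: measurableT_comp => //.
    by apply: measurable_indic; exact: mF.
  have bHS n : bounded_measurable (fun w => H w * S n w).
    apply: bmM => //; split => //; exists 1 => w.
    by have /andP[h1 h2] := S01 n w; rewrite ger0_norm.
  have S0 n : \int[P]_w (H w * S n w) = 0.
    elim: n => [|n IH].
      transitivity (\int[P]_w (cst 0 w : R)); last by rewrite Rintegral_cst // mul0r.
      by apply: eq_Rintegral => w _; rewrite /S big_ord0 mulr0.
    transitivity (\int[P]_w (H w * S n w + H w * \1_(X @^-1` F n) w)).
      by apply: eq_Rintegral => w _; rewrite /S big_ord_recr mulrDr.
    rewrite RintegralD //; [|exact: bm_integrable|exact: (iHI (F n) (mF n))].
    by rewrite IH QF addr0.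
  have mU : measurable (\bigcup_k F k) by exact: bigcup_measurable.
  have : \int[P]_w (H w * S n w) @[n --> \oo] -->
      \int[P]_w (H w * \1_(X @^-1` \bigcup_k F k) w).
    apply: (@bounded_cvg _ _ _ _ _ _ C).
    - by move=> n; case: (bHS n).
    - move=> n w; rewrite normrM (le_trans _ (hC w)) // ler_piMr //.
      by have /andP[h1 h2] := S01 n w; rewrite ger0_norm.
    - by move=> w; apply: cvgMl_tmp; exact: Scvg.
    - move=> w; rewrite normrM (le_trans _ (hC w)) // ler_piMr //.
      by rewrite indicE; case: (_ \in _); rewrite ?normr1 ?normr0.
    - by case: (bHI _ mU).
  rewrite (funext S0) => h.
  by apply: cvg_unique h _ => //; exact: cvg_cst.
- change ((@RGenOInfty.G R).-sigma.-measurable A).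
  by rewrite -RGenOInfty.measurableE.
Qed.

End fourier_uniqueness.

Lemma cosM (R : realType) (a b : R) :
  cos a * cos b = 2^-1 * (cos (a + b) + cos (a - b)).
Proof. by rewrite cosD cosB; field. Qed.

(** * Independence of sigma-algebras from integrals of cosines *)

Section cylinders.
Context d (T : measurableType d) (R : realType).
Implicit Types U V : set (T -> R).

(** A generating pi-system of the sigma-algebra of [U]. It is built one constraint at a time, as
    [lin_span] is built one term at a time, so that an induction can trade the constraint on [X] for
    a multiple of [X] in a linear combination. *)
Inductive cylinder U : set (set T) :=
| cylinderT : cylinder U setT
| cylinderI X B A : U X -> measurable B -> cylinder U A ->
    cylinder U (X @^-1` B `&` A).

Inductive lin_span U : set (T -> R) :=
| lin_span0 : lin_span U (cst 0)
| lin_spanD a X Y : U X -> lin_span U Y -> lin_span U (fun w => a * X w + Y w).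

Lemma cylinder_setI U : setI_closed (cylinder U).
Proof.
move=> A B; elim=> [|X C A' UX mC _ IH] cB; first by rewrite setTI.
by rewrite -setIA; apply: cylinderI => //; exact: IH.
Qed.

Lemma cylinder_measurable U : (forall X, U X -> measurable_fun setT X) ->
  cylinder U `<=` measurable.
Proof.
move=> mU A; elim=> [|X C A' UX mC _ IH]; first exact: measurableT.
by apply: measurableI => //; rewrite -[X in measurable X]setTI; exact: mU.
Qed.

Lemma lin_span_measurable U : (forall X, U X -> measurable_fun setT X) ->
  forall X, lin_span U X -> measurable_fun setT X.
Proof.
move=> mU X; elim=> [|a Y Z UY _ IH]; first exact: measurable_cst.
by apply: measurable_funD => //; apply: measurable_funM => //; exact: mU.
Qed.

Variable P : probability T R.

(** The induction carries a factor [cos (Y w + t)] with [Y] in the span. For one more constraint on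
    [X], the product with [cos (s * X w + t')] splits into cosines of s X + Y and - s X + Y, covered
    by the induction hypothesis, and [fourier_uniqueness] passes from cosines of [X] to the
    indicator of the constraint. *)
Lemma cylinder_fourier U (G : T -> R) :
  bounded_measurable G -> (forall X, U X -> measurable_fun setT X) ->
  (forall X t, lin_span U X -> \int[P]_w (G w * cos (X w + t)) = 0) ->
  forall A, cylinder U A -> \int[P]_w (G w * \1_A w) = 0.
Proof.
move=> bG mU G0 A cA.
suff key : forall X t, lin_span U X -> \int[P]_w (G w * \1_A w * cos (X w + t)) = 0.
  rewrite -[RHS](key (cst 0) 0 (lin_span0 U)); apply: eq_Rintegral => w _.
  by rewrite /= addr0 cos0 mulr1.
elim: cA => [X t sX|X B A' UX mB cA' IH Y t sY].
  by rewrite -[RHS](G0 X t sX); apply: eq_Rintegral => w _; rewrite indicT mulr1.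
have mX := mU X UX.
have mY := lin_span_measurable mU sY.
have mA' := cylinder_measurable mU cA'.
have bGA : bounded_measurable (fun w => G w * \1_A' w).
  by apply: bmM => //; exact: bm_indic.
have bc (f : T -> R) : measurable_fun setT f ->
    bounded_measurable (fun w => G w * \1_A' w * cos (f w)).
  by move=> mf; apply: bmM => //; exact: bm_cos.
pose H w := G w * \1_A' w * cos (Y w + t).
have bH : bounded_measurable H by apply: bc; exact: measurable_funD.
have HX s t' : \int[P]_w (H w * cos (s * X w + t')) = 0.
  have mXs u : measurable_fun setT (fun w => u * X w + Y w).
    by apply: measurable_funD => //; exact: measurable_funM.
  transitivity (\int[P]_w (2^-1 * (G w * \1_A' w * cos (s * X w + Y w + (t + t')) +
      G w * \1_A' w * cos (- s * X w + Y w + (t - t'))))).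
    apply: eq_Rintegral => w _; rewrite /H -mulrDr mulrCA -!mulrA; congr (_ * (_ * _)).
    rewrite (_ : s * X w + Y w + (t + t') = (Y w + t) + (s * X w + t')); last by ring.
    rewrite (_ : - s * X w + Y w + (t - t') = (Y w + t) - (s * X w + t')); last by ring.
    exact: cosM.
  have i1 : P.-integrable setT (EFin \o (fun w => G w * \1_A' w * cos (s * X w + Y w + (t + t')))).
    by apply: bm_integrable; apply: (bc (fun w => s * X w + Y w + _)); exact: measurable_funD.
  have i2 : P.-integrable setT (EFin \o (fun w => G w * \1_A' w * cos (- s * X w + Y w + (t - t')))).
    by apply: bm_integrable; apply: (bc (fun w => - s * X w + Y w + _)); exact: measurable_funD.
  rewrite RintegralZl //; last exact: (integrableD measurableT i1 i2).
  rewrite RintegralD // (IH (fun w => s * X w + Y w)) ?(IH (fun w => - s * X w + Y w)).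
  - by rewrite addr0 mulr0.
  - exact: lin_spanD.
  - exact: lin_spanD.
rewrite -[RHS](fourier_uniqueness bH mX HX mB); apply: eq_Rintegral => w _.
by rewrite /H indicI /=; ring.
Qed.

(** Cosines are replaced by indicators one side at a time: [cylinder_fourier] is applied over [U] to
    a centered cosine of [Y], then over [V] to the centered indicator of [A]. Uniqueness of measures
    extends the product formula from cylinders to the sigma-algebras, again one side at a time. *)
Lemma sigma_algebra_indep U V :
  (forall X, U X -> measurable_fun setT X) ->
  (forall Y, V Y -> measurable_fun setT Y) ->
  (forall X Y t t', lin_span U X -> lin_span V Y ->
    \int[P]_w (cos (X w + t) * cos (Y w + t')) =
    \int[P]_w cos (X w + t) * \int[P]_w cos (Y w + t')) ->
  forall A B, <<s cylinder U >> A -> <<s cylinder V >> B ->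
  P (A `&` B) = (P A * P B)%E.
Proof.
move=> mU mV UV.
have mcU := cylinder_measurable mU; have mcV := cylinder_measurable mV.
have cyl A B : cylinder U A -> cylinder V B -> P (A `&` B) = (P A * P B)%E.
  move=> cA cB; have mA := mcU _ cA; have mB := mcV _ cB.
  have iA := bm_integrable P (bm_indic R mA).
  have bA := bm_indic R mA.
  have : \int[P]_w ((\1_A w - fine (P A)) * \1_B w) = 0.
    apply: (cylinder_fourier _ mV _ cB).
      by apply: bmB => //; exact: bm_cst.
    move=> Y t sY; have bY : bounded_measurable (fun w => cos (Y w + t)).
      by apply: bm_cos; apply: measurable_funD => //; exact: (lin_span_measurable mV).
    have iY := bm_integrable P bY.
    pose e := \int[P]_w cos (Y w + t).
    have bYe : bounded_measurable (fun w => cos (Y w + t) - e).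
      by apply: bmB => //; exact: bm_cst.
    have h : \int[P]_w ((cos (Y w + t) - e) * \1_A w) = 0.
      apply: (cylinder_fourier bYe mU _ cA) => X t' sX.
      have bX : bounded_measurable (fun w => cos (X w + t')).
        by apply: bm_cos; apply: measurable_funD => //; exact: (lin_span_measurable mU).
      transitivity (\int[P]_w (cos (X w + t') * cos (Y w + t) - e * cos (X w + t'))).
        by apply: eq_Rintegral => w _; ring.
      have iX := bm_integrable P bX.
      have iXY := bm_integrable P (bmM bX bY).
      rewrite RintegralB //; last by apply: bm_integrable; exact: bmZ.
      by rewrite RintegralZl // UV // -/e mulrC subrr.
    transitivity (\int[P]_w (cos (Y w + t) * \1_A w - fine (P A) * cos (Y w + t))).
      by apply: eq_Rintegral => w _; ring.
    have bYA := bmM bY bA; have iYA := bm_integrable P bYA.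
    rewrite RintegralB //; last by apply: bm_integrable; exact: bmZ.
    rewrite RintegralZl //.
    have : \int[P]_w (cos (Y w + t) * \1_A w - e * \1_A w) = 0.
      by rewrite -[RHS]h; apply: eq_Rintegral => w _; ring.
    rewrite RintegralB //; last by apply: bm_integrable; exact: bmZ.
    rewrite RintegralZl // Rintegral_indic // => /eqP; rewrite subr_eq0 => /eqP ->.
    by rewrite -/e mulrC subrr.
  have bB := bm_indic R mB; have iB := bm_integrable P bB.
  have -> : \int[P]_w ((\1_A w - fine (P A)) * \1_B w) =
      \int[P]_w (\1_(A `&` B) w - fine (P A) * \1_B w).
    by apply: eq_Rintegral => w _; rewrite indicI /=; ring.
  have mAB := measurableI _ _ mA mB.
  have iAB := bm_integrable P (bm_indic R mAB).
  rewrite RintegralB //; last by apply: bm_integrable; exact: bmZ.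
  rewrite RintegralZl // !Rintegral_indic // => /eqP; rewrite subr_eq0 => /eqP h.
  rewrite -[LHS]fineK ?fin_num_measure // h EFinM !fineK ?fin_num_measure //.
have msU A : <<s cylinder U >> A -> measurable A.
  by move=> h; apply: h; split => //; exact: sigma_algebra_measurable.
have ext (W : set (T -> R)) (B : set T) : measurable B -> cylinder W `<=` measurable ->
    (forall A, cylinder W A -> P (A `&` B) = (P A * P B)%E) ->
    forall A, <<s cylinder W >> A -> P (A `&` B) = (P A * P B)%E.
  move=> mB mW h A sA.
  (* For fixed [B] both sides are finite measures in [A]: [P] restricted to [B], and [P] scaled by
     [P B]. *)
  pose c := NngNum (fine_ge0 (measure_ge0 P B)).
  have cE A0 : mscale c P A0 = (P A0 * P B)%E.
    by rewrite /mscale /= muleC fineK // fin_num_measure.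
  rewrite -cE -/(mrestr P mB A).
  apply: (@g_sigma_algebra_measure_unique _ _ _ (cylinder W) mW (fun=> setT)
    (fun=> cylinderT W) _ _ _ (@cylinder_setI W)) => //.
  - by apply/seteqP; split => // w _; exists 0%N.
  - by move=> A' cA'; rewrite [RHS]cE; exact: h.
  - by move=> k; rewrite /= /mrestr setTI ltey_eq fin_num_measure.
have msV B : <<s cylinder V >> B -> measurable B.
  by move=> h; apply: h; split => //; exact: sigma_algebra_measurable.
move=> A B sA sB; apply: (ext U B) => //; first exact: msV.
move=> A' cA'; rewrite setIC muleC; apply: (ext V A') => //; first exact: mcU.
by move=> B' cB'; rewrite setIC muleC; exact: cyl.
Qed.

End cylinders.

Section law_transfer.
Context d (T : measurableType d) (R : realType) (P : probability T R).
Variables (X : T -> R) (nu : {measure set (measurableTypeR R) -> \bar R}).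
Hypothesis mX : measurable_fun setT X.
Hypothesis lawX : forall A : set R, measurable A -> P (X @^-1` A) = nu A.

Lemma ge0_integral_law (f : R -> R) : measurable_fun setT f -> (forall x, 0 <= f x) ->
  (\int[P]_w (f (X w))%:E = \int[nu]_x (f x)%:E)%E.
Proof.
move=> mf f0.
have mf' : measurable_fun [set: measurableTypeR R] (EFin \o f) by exact/measurable_EFinP.
have := @ge0_integral_pushforward _ _ T (measurableTypeR R) R X mX P setT (EFin \o f)
  measurableT mf' _.
rewrite preimage_setT => <-; last by move=> y _; rewrite /= lee_fin.
by apply: eq_measure_integral => A mA _; exact: lawX.
Qed.

Lemma integrable_law (f : R -> R) : measurable_fun setT f ->
  nu.-integrable setT (EFin \o f) -> P.-integrable setT (EFin \o (fun w => f (X w))).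
Proof.
move=> mf /integrableP[_ fi]; apply/integrableP; split.
  by apply/measurable_EFinP; exact: measurableT_comp.
have := @ge0_integral_law (fun x => `|f x|) _ (fun x => normr_ge0 _).
by rewrite /= => -> //; exact: measurableT_comp.
Qed.

Lemma Rintegral_law (f : R -> R) : measurable_fun setT f ->
  nu.-integrable setT (EFin \o f) -> \int[P]_w f (X w) = \int[nu]_x f x.
Proof.
move=> mf fi.
have mf' : measurable_fun [set: measurableTypeR R] (EFin \o f) by exact/measurable_EFinP.
have := @integral_pushforward _ _ T (measurableTypeR R) R X mX P setT (EFin \o f) mf'.
rewrite preimage_setT => /(_ (integrable_law mf fi) measurableT) h.
rewrite /Rintegral -h; congr fine.
by apply: eq_measure_integral => A mA _; exact: lawX.
Qed.

End law_transfer.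

Section centered_gaussian.
Context d (T : measurableType d) (R : realType) (P : probability T R).
Local Notation mu := (@lebesgue_measure R).

Definition has_gaussian_law (s : R) (X : T -> R) :=
  [/\ measurable_fun setT X, 0 <= s &
      forall A : set R, measurable A -> P (X @^-1` A) = gaussian_law 0 s A].

Lemma normal_probN (m s : R) : normal_prob m (- s) = normal_prob m s.
Proof.
apply/funext => A; rewrite /normal_prob; apply: eq_integral => x _.
by rewrite /normal_pdf /normal_peak /normal_fun oppr_eq0 sqrrN.
Qed.

Local Notation dir a := (@dirac _ (measurableTypeR R) a R :
  {measure set (measurableTypeR R) -> \bar R}).

Lemma integrable_dirac (a : R) (f : R -> R) : measurable_fun setT f ->
  (dir a).-integrable setT (EFin \o f).
Proof.
move=> mf; apply/integrableP; split; first exact/measurable_EFinP.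
rewrite integral_dirac //; last by apply: measurableT_comp => //; exact/measurable_EFinP.
by rewrite diracT mul1e ltry.
Qed.

Lemma Rintegral_dirac (a : R) (f : R -> R) : measurable_fun setT f ->
  \int[(dir a)]_x f x = f a.
Proof.
move=> mf; rewrite /Rintegral integral_dirac //; last exact/measurable_EFinP.
by rewrite diracT mul1e.
Qed.

(** [is_gaussian] leaves the location [m] free and the sign of [s] open. Integration against the law
    shows that [m] is the mean, hence 0, and changing the sign of [s] does not change the law. *)
Lemma is_gaussian_centered (X : T -> R) : is_gaussian P X -> ('E_P[X] = 0)%E ->
  exists s, has_gaussian_law s X.
Proof.
move=> [mX [m [s lawX]]] EX.
have EX0 : \int[P]_w X w = 0 by move: EX; rewrite unlock /Rintegral => ->.
move: lawX; rewrite /gaussian_law; have [s0 lawX|s0 lawX] := eqVneq s 0.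
  have := Rintegral_law (nu := dir m) mX lawX (@measurable_id _ _ setT) (integrable_dirac m (@measurable_id _ _ setT)).
  rewrite EX0 Rintegral_dirac // => m0.
  by exists 0; split => // A mA; rewrite /gaussian_law eqxx lawX // -m0.
have im := integrable_mul_normal_pdf m s0.
have ip := integrable_normal_pdf m s.
have ix : mu.-integrable setT (fun x => (x * normal_pdf m s x)%:E).
  have := integrableD measurableT im (integrableZl measurableT m ip).
  apply: eq_integrable => // x _.
  by rewrite /= -EFinD; congr EFin; ring.
have := Rintegral_law mX lawX (@measurable_id _ _ setT) (integrable_normal_prob (@measurable_id _ _ setT) ix).
rewrite EX0 Rintegral_normal_prob // => h.
have m0 : m = 0.
  apply: oppr_inj; rewrite oppr0 -[RHS](Rintegral_normal_pdf_center m s0).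
  transitivity (\int[mu]_x (x * normal_pdf m s x) - m * \int[mu]_x normal_pdf m s x).
    by rewrite -h /Rintegral integral_normal_pdf sub0r mulr1.
  rewrite -RintegralZl // -RintegralB //; last exact: (integrableZl measurableT m ip).
  by apply: eq_Rintegral => x _; ring.
exists `|s|; split => // A mA; rewrite lawX // m0 /gaussian_law normr_eq0 (negbTE s0).
by have [_|_] := ger0P s; [|rewrite normal_probN].
Qed.

Variables (s : R) (X : T -> R).
Hypothesis gX : has_gaussian_law s X.

Lemma gaussian_cos (t : R) :
  \int[P]_w cos (X w + t) = cos t * expR (- (s ^+ 2 / 2)).
Proof.
have [mX _ lawX] := gX.
have mc : measurable_fun setT (fun x : R => cos (x + t)).
  by case: (@bm_cos _ _ R (fun x : R => x + t)) => //; exact: measurable_funD.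
move: lawX; rewrite /gaussian_law; have [-> lawX|s0 lawX] := eqVneq s 0.
  rewrite (Rintegral_law (nu := dir 0) mX lawX mc (integrable_dirac _ mc)) Rintegral_dirac //.
  by rewrite add0r expr0n /= mul0r oppr0 expR0 mulr1.
have ic : mu.-integrable setT (fun x => (cos (x + t) * normal_pdf 0 s x)%:E).
  apply: (le_integrable measurableT _ _ (integrable_normal_pdf 0 s)).
    by apply/measurable_EFinP; apply: measurable_funM => //; exact: measurable_normal_pdf.
  move=> x _; rewrite /= lee_fin normrM ler_piMl //.
  by rewrite ler_norml cos_geN1 cos_le1.
rewrite (Rintegral_law mX lawX mc (integrable_normal_prob mc ic)) Rintegral_normal_prob //.
transitivity (\int[mu]_x (cos (1 * (x - 0) + t) * normal_pdf 0 s x)).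
  by apply: eq_Rintegral => x _; rewrite mul1r subr0.
by rewrite Rintegral_cos_normal_pdf // expr1n mulr1.
Qed.

Lemma gaussian_sqr : P.-integrable setT (EFin \o (fun w => X w ^+ 2)) /\
  \int[P]_w X w ^+ 2 = s ^+ 2.
Proof.
have [mX _ lawX] := gX.
have m2 : measurable_fun setT (fun x : R => x ^+ 2) by exact: measurable_funX.
move: lawX; rewrite /gaussian_law; have [-> lawX|s0 lawX] := eqVneq s 0.
  have i0 := integrable_dirac 0 m2.
  split; first exact: (integrable_law (nu := dir 0) mX lawX m2 i0).
  by rewrite (Rintegral_law (nu := dir 0) mX lawX m2 i0) Rintegral_dirac.
have i2 : mu.-integrable setT (fun x => (x ^+ 2 * normal_pdf 0 s x)%:E).
  have := integrable_sqrM_normal_pdf 0 s0; apply: eq_integrable => // x _.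
  by rewrite subr0.
have iN := integrable_normal_prob m2 i2.
split; first exact: (integrable_law mX lawX m2 iN).
rewrite (Rintegral_law mX lawX m2 iN) Rintegral_normal_prob //.
rewrite -[RHS](Rintegral_normal_pdf_sqr 0 s0).
by apply: eq_Rintegral => x _; rewrite subr0.
Qed.

End centered_gaussian.

Section gaussian_space.
Context d (T : measurableType d) (R : realType) (P : probability T R).

(** A linear space of centered, possibly degenerate, Gaussian variables. Means being zero, the
    integral of [X w * Y w] is the covariance, and second moments determine all laws. *)
Definition gaussian_space (H : set (T -> R)) :=
  [/\ H (cst 0), forall a X Y, H X -> H Y -> H (fun w => a * X w + Y w) &
      forall X, H X -> exists s, has_gaussian_law P s X].

Variable H : set (T -> R).
Hypothesis gH : gaussian_space H.
Local Notation "''E' X" := (\int[P]_w X w) (at level 10, X at level 8, only parsing).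

Lemma gs_measurable X : H X -> measurable_fun setT X.
Proof. by move=> HX; have [_ _ /(_ X HX)[s []]] := gH. Qed.

Lemma gsD X Y : H X -> H Y -> H (fun w => X w + Y w).
Proof.
move=> HX HY; have [_ HD _] := gH; have := HD 1 X Y HX HY.
by congr H; apply/funext => w; rewrite mul1r.
Qed.

Lemma gsZ a X : H X -> H (fun w => a * X w).
Proof.
move=> HX; have [H0 HD _] := gH; have := HD a X _ HX H0.
by congr H; apply/funext => w; rewrite /= addr0.
Qed.

Lemma gsB X Y : H X -> H Y -> H (fun w => X w - Y w).
Proof.
move=> HX HY; have := gsD HX (gsZ (-1) HY).
by congr H; apply/funext => w; rewrite mulN1r.
Qed.

Lemma gs_law X : H X -> has_gaussian_law P (Num.sqrt (\int[P]_w (X w ^+ 2))) X.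
Proof.
move=> HX; have [_ _ /(_ X HX)[s gX]] := gH.
rewrite (gaussian_sqr gX).2.
by have [_ s0 _] := gX; rewrite sqrtr_sqr ger0_norm.
Qed.

Lemma gs_integrable_sqr X : H X -> P.-integrable setT (EFin \o (fun w => X w ^+ 2)).
Proof. by move=> HX; have [_ _ /(_ X HX)[s gX]] := gH; case: (gaussian_sqr gX). Qed.

Lemma gs_integrableM X Y : H X -> H Y ->
  P.-integrable setT (EFin \o (fun w => X w * Y w)).
Proof.
move=> HX HY.
have iX := gs_integrable_sqr HX; have iY := gs_integrable_sqr HY.
apply: (le_integrable measurableT _ _ (integrableD measurableT iX iY)).
  by apply/measurable_EFinP; apply: measurable_funM; exact: gs_measurable.
move=> w _; rewrite /= lee_fin.
rewrite normrM [leRHS]ger0_norm ?addr_ge0 ?sqr_ge0 //.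
rewrite -(@real_normK _ (X w)) ?num_real // -(@real_normK _ (Y w)) ?num_real //.
by have := sqr_ge0 (`|X w| - `|Y w|); have := normr_ge0 (X w); have := normr_ge0 (Y w); nra.
Qed.

Lemma gs_covDl a X Y Z : H X -> H Y -> H Z ->
  \int[P]_w ((a * X w + Y w) * Z w) = a * \int[P]_w (X w * Z w) + \int[P]_w (Y w * Z w).
Proof.
move=> HX HY HZ.
have iX := gs_integrableM HX HZ; have iY := gs_integrableM HY HZ.
rewrite -RintegralZl // -RintegralD //.
  by apply: eq_Rintegral => w _; ring.
have iXa := gs_integrableM (gsZ a HX) HZ.
rewrite (_ : EFin \o _ = EFin \o (fun w => a * X w * Z w)) //.
by apply/funext => w; rewrite /= mulrA.
Qed.

Lemma gs_covC X Y : \int[P]_w (X w * Y w) = \int[P]_w (Y w * X w).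
Proof. by apply: eq_Rintegral => w _; rewrite mulrC. Qed.

Lemma gs_covDr a X Y Z : H X -> H Y -> H Z ->
  \int[P]_w (Z w * (a * X w + Y w)) = a * \int[P]_w (Z w * X w) + \int[P]_w (Z w * Y w).
Proof.
move=> HX HY HZ; rewrite (gs_covC Z (fun w => _)) gs_covDl //.
by rewrite (gs_covC X) (gs_covC Y).
Qed.

Lemma gs_covBl X Y Z : H X -> H Y -> H Z ->
  \int[P]_w ((X w - Y w) * Z w) = \int[P]_w (X w * Z w) - \int[P]_w (Y w * Z w).
Proof.
move=> HX HY HZ.
rewrite addrC -mulN1r -(gs_covDl (-1) HY HX HZ).
by apply: eq_Rintegral => w _; ring.
Qed.

Lemma gs_covBr X Y Z : H X -> H Y -> H Z ->
  \int[P]_w (Z w * (X w - Y w)) = \int[P]_w (Z w * X w) - \int[P]_w (Z w * Y w).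
Proof.
move=> HX HY HZ; rewrite (gs_covC Z (fun w => _)) gs_covBl //.
by rewrite (gs_covC X) (gs_covC Y).
Qed.

Lemma gs_cos X t : H X -> \int[P]_w cos (X w + t) =
  cos t * expR (- (\int[P]_w (X w * X w) / 2)).
Proof.
move=> HX; rewrite (gaussian_cos (gs_law HX)) sqr_sqrtr //.
by apply: Rintegral_ge0 => w _; rewrite sqr_ge0.
Qed.

Lemma gs_lin_span U : U `<=` H -> lin_span U `<=` H.
Proof.
have [H0 HD _] := gH.
by move=> UH X; elim=> [|a Y Z UY _ IH] //; apply: HD => //; exact: UH.
Qed.

(** Orthogonality extends from the generators to their spans by linearity. For orthogonal X and Y
    the sums X + Y and X - Y have the same variance, so the two terms of [cosM] share their
    exponential factor and the integral of a product of cosines factors. *)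
Lemma gaussian_space_indep (U V : set (T -> R)) : U `<=` H -> V `<=` H ->
  (forall X Y, U X -> V Y -> \int[P]_w (X w * Y w) = 0) ->
  forall A B, <<s cylinder U >> A -> <<s cylinder V >> B ->
  P (A `&` B) = (P A * P B)%E.
Proof.
move=> UH VH UV.
have UV1 X Y : lin_span U X -> V Y -> \int[P]_w (X w * Y w) = 0.
  move=> sX VY; elim: sX => [|a X1 X2 UX1 sX2 IH].
    transitivity (\int[P]_w (cst 0 w : R)); last by rewrite Rintegral_cst // mul0r.
    by apply: eq_Rintegral => w _; rewrite /= mul0r.
  rewrite (gs_covDl _ (UH _ UX1) (gs_lin_span UH sX2) (VH _ VY)).
  by rewrite UV // IH mulr0 addr0.
have UV2 X Y : lin_span U X -> lin_span V Y -> \int[P]_w (X w * Y w) = 0.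
  move=> sX; elim=> [|a Y1 Y2 VY1 sY2 IH].
    transitivity (\int[P]_w (cst 0 w : R)); last by rewrite Rintegral_cst // mul0r.
    by apply: eq_Rintegral => w _; rewrite /= mulr0.
  rewrite (gs_covDr _ (VH _ VY1) (gs_lin_span VH sY2) (gs_lin_span UH sX)).
  by rewrite UV1 // IH mulr0 addr0.
apply: sigma_algebra_indep.
- by move=> X /UH; exact: gs_measurable.
- by move=> Y /VH; exact: gs_measurable.
move=> X Y t t' sX sY.
have HX := gs_lin_span UH sX; have HY := gs_lin_span VH sY.
have XY := UV2 _ _ sX sY; have YX : \int[P]_w (Y w * X w) = 0 by rewrite gs_covC.
have mX := gs_measurable HX; have mY := gs_measurable HY.
transitivity (\int[P]_w (2^-1 * (cos (X w + Y w + (t + t')) + cos (X w - Y w + (t - t'))))).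
  apply: eq_Rintegral => w _; rewrite cosM.
  by congr (_ * (cos _ + cos _)); ring.
have i1 : P.-integrable setT (EFin \o (fun w => cos (X w + Y w + (t + t')))).
  apply: bm_integrable; apply: bm_cos; apply: measurable_funD => //.
  exact: measurable_funD.
have i2 : P.-integrable setT (EFin \o (fun w => cos (X w - Y w + (t - t')))).
  apply: bm_integrable; apply: bm_cos; apply: measurable_funD => //.
  exact: measurable_funB.
rewrite RintegralZl //; last exact: (integrableD measurableT i1 i2).
rewrite RintegralD // (gs_cos _ (gsD HX HY)) (gs_cos _ (gsB HX HY)) !gs_cos //.
have -> : \int[P]_w ((X w + Y w) * (X w + Y w)) =
    \int[P]_w (X w * X w) + \int[P]_w (Y w * Y w).
  have HXY := gsD HX HY.
  transitivity (\int[P]_w ((1 * X w + Y w) * (X w + Y w))).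
    by apply: eq_Rintegral => w _; rewrite mul1r.
  rewrite gs_covDl // mul1r; congr (_ + _).
    transitivity (\int[P]_w (X w * (1 * X w + Y w))).
      by apply: eq_Rintegral => w _; rewrite mul1r.
    by rewrite gs_covDr // mul1r XY addr0.
  transitivity (\int[P]_w (Y w * (1 * X w + Y w))).
    by apply: eq_Rintegral => w _; rewrite mul1r.
  by rewrite gs_covDr // mul1r YX add0r.
have -> : \int[P]_w ((X w - Y w) * (X w - Y w)) =
    \int[P]_w (X w * X w) + \int[P]_w (Y w * Y w).
  by rewrite gs_covBl ?gs_covBr // ?XY ?YX; [ring|exact: gsB].
set a := \int[P]_w (X w * X w); set b := \int[P]_w (Y w * Y w).
rewrite -mulrDl mulrA -cosM mulrACA -expRD; congr (_ * expR _); ring.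
Qed.

End gaussian_space.

(** * The range of a Brownian motion *)

Section real_probability.
Context d (T : measurableType d) (R : realType) (P : probability T R).
Local Notation pr A := (fine (P A)).

Lemma pr_ge0 A : 0 <= pr A. Proof. exact: fine_ge0. Qed.

Lemma pr_le1 A : measurable A -> pr A <= 1.
Proof. by move=> mA; rewrite -lee_fin fineK ?fin_num_measure // probability_le1. Qed.

Lemma pr_le A B : measurable A -> measurable B -> A `<=` B -> pr A <= pr B.
Proof. by move=> mA mB AB; rewrite fine_le ?fin_num_measure // le_measure ?inE. Qed.

Lemma prU A B : measurable A -> measurable B -> pr (A `|` B) <= pr A + pr B.
Proof.
move=> mA mB; rewrite -lee_fin EFinD !fineK ?fin_num_measure //.
  exact: measureU2.
exact: measurableU.
Qed.

Lemma prUI A B : measurable A -> measurable B -> pr (A `|` B) = pr A + pr B - pr (A `&` B).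
Proof.
move=> mA mB; rewrite measureUfinl // ?ltey_eq ?fin_num_measure //.
rewrite fineB ?fineD ?fin_num_measure //.
- by rewrite fin_numD !fin_num_measure.
- by rewrite ?fin_num_measure //; exact: measurableI.
Qed.

Lemma prC A : measurable A -> pr (~` A) = 1 - pr A.
Proof. by move=> mA; rewrite probability_setC // fineB // fin_num_measure. Qed.

Lemma pr_indep A B : measurable A -> measurable B ->
  P (A `&` B) = (P A * P B)%E -> pr (A `&` B) = pr A * pr B.
Proof. by move=> mA mB ->; rewrite fineM // fin_num_measure. Qed.

Lemma pr_bigcup (E : nat -> set T) n : (forall k, measurable (E k)) ->
  trivIset `I_n E -> pr (\bigcup_(k < n) E k) = \sum_(k < n) pr (E k).
Proof.
move=> mE tE; rewrite bigcup_mkord.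
have -> : P (\big[setU/set0]_(k < n) E k) = (\sum_(k < n) P (E k))%E.
  by apply: measure_semi_additive_ord_I => //; exact: bigsetU_measurable.
rewrite -[RHS]/(fine (\sum_(k < n) fine (P (E k)))%:E) -sumEFin.
by congr fine; apply: eq_bigr => k _; rewrite fineK // fin_num_measure.
Qed.

Lemma pr_bigcup_le (E : nat -> set T) n (c : R) : (forall k, measurable (E k)) ->
  (forall k, (k < n)%N -> pr (E k) <= c) -> pr (\bigcup_(k < n) E k) <= n%:R * c.
Proof.
move=> mE Ec; rewrite bigcup_mkord; elim: n Ec => [|n IH] Ec.
  by rewrite big_ord0 measure0 mul0r.
rewrite big_ord_recr /= (le_trans (prU _ _)) //; first exact: bigsetU_measurable.
rewrite -natr1 mulrDl mul1r lerD // ?Ec // IH // => k kn; apply: Ec.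
exact: ltn_trans kn _.
Qed.

Variables (n : nat) (E G : nat -> set T).
Hypotheses (mE : forall k, measurable (E k)) (mG : forall k, measurable (G k)).
Hypothesis tE : trivIset `I_n E.
Hypothesis EG : forall k, (k < n)%N -> P (E k `&` G k) = (P (E k) * P (G k))%E.

Let mEG k : measurable (E k `&` G k). Proof. exact: measurableI. Qed.

Let tEG : trivIset `I_n (fun k => E k `&` G k).
Proof.
apply/trivIsetP => i j ni nj ij; apply/seteqP; split => // w [[Ei _] [Ej _]].
by move/trivIsetP : tE => /(_ i j ni nj ij) <-; split.
Qed.

(** The common core of the reflection arguments: the disjoint events [E k] locate an index, and the
    independent [G k], of probability at least 1/2, completes [E k] to [C]. *)
Lemma half_decomp_ge (C : set T) : measurable C ->
  (forall k, (k < n)%N -> 2^-1 <= pr (G k)) ->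
  (forall k, (k < n)%N -> E k `&` G k `<=` C) ->
  pr (\bigcup_(k < n) E k) <= 2 * pr C.
Proof.
move=> mC G2 EGC.
have : pr (\bigcup_(k < n) (E k `&` G k)) <= pr C.
  apply: pr_le => //; first exact: bigcup_measurable.
  by move=> w [k kn EGk]; exact: EGC EGk.
rewrite !pr_bigcup // => h; rewrite (le_trans _ (ler_wpM2l _ h)) //.
rewrite mulr_sumr; apply: ler_sum => k _.
rewrite (pr_indep (mE k) (mG k)) ?EG // mulrCA.
by rewrite ler_peMr ?pr_ge0 //; have := G2 k (ltn_ord k); lra.
Qed.

(** The reverse use of a decomposition: when an event forces [G k] at the located index, it inherits
    the factor [c]. *)
Lemma decomp_le (c : R) : (forall k, (k < n)%N -> pr (G k) <= c) ->
  pr (\bigcup_(k < n) (E k `&` G k)) <= c * pr (\bigcup_(k < n) E k).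
Proof.
move=> Gc; rewrite !pr_bigcup // mulr_sumr; apply: ler_sum => k _.
by rewrite (pr_indep (mE k) (mG k)) ?EG // mulrC ler_wpM2r ?pr_ge0 // Gc.
Qed.

End real_probability.

Section measurable_events.
Context d (T : measurableType d) (R : realType).

Lemma measurable_gtB (X Y : T -> R) (u : R) :
  measurable_fun setT X -> measurable_fun setT Y ->
  measurable [set w | u < X w - Y w].
Proof.
move=> mX mY; rewrite [X in measurable X](_ : _ = (fun w => X w - Y w) @^-1` `]u, +oo[).
  by rewrite -[X in measurable X]setTI; apply: (measurable_funB mX mY) => //; exact: measurable_itv.
by apply/seteqP; split => w /=; rewrite in_itv /= andbT.
Qed.

Lemma measurable_leB (X Y : T -> R) (u : R) :
  measurable_fun setT X -> measurable_fun setT Y ->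
  measurable [set w | X w - Y w <= u].
Proof.
move=> mX mY; rewrite [X in measurable X](_ : _ = ~` [set w | u < X w - Y w]).
  by apply: measurableC; exact: measurable_gtB.
by apply/seteqP; split => w /=; rewrite leNgt => /negP.
Qed.

Lemma ge0B_setC (X Y : T -> R) :
  [set w | 0 <= X w - Y w] = ~` [set w | 0 < Y w - X w].
Proof.
apply/seteqP; split => w /=; first by move=> h h'; lra.
by move=> h; rewrite leNgt; apply/negP => h'; apply: h; lra.
Qed.

Lemma measurable_forall (D : nat -> Prop) (Q : nat -> set T) :
  (forall k, D k -> measurable (Q k)) -> measurable [set w | forall k, D k -> Q k w].
Proof. by move=> mQ; exact: (@bigcap_measurableType _ T Q D mQ). Qed.

Lemma measurable_exists (D : nat -> Prop) (Q : nat -> set T) :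
  (forall k, D k -> measurable (Q k)) -> measurable [set w | exists2 k, D k & Q k w].
Proof. by move=> mQ; exact: (@bigcup_measurable _ T Q D mQ). Qed.

End measurable_events.

(** Allows general measurability lemmas to be reused over a sub-sigma-algebra, viewed as a
    measurable type of its own. Past, future and component-wise range events are recognised in this
    way. *)
Lemma cylinder_measurable_fun d (T : measurableType d) (R : realType)
    (U : set (T -> R)) (X : T -> R) : U X ->
  @measurable_fun _ _ (g_sigma_algebraType (cylinder U)) R setT X.
Proof.
move=> UX _ B mB; rewrite setTI; apply: sub_sigma_algebra.
by rewrite -[X @^-1` B]setIT; apply: cylinderI => //; exact: cylinderT.
Qed.

Section scaled_BM.
Context d (T : measurableType d) (R : realType) (P : probability T R).
Local Notation pr A := (fine (P A)).

(* [v] is the variance per unit of time. The covariance forces [B 0 = 0] only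
   almost everywhere, hence the increments [B q - B 0] in the tail bounds. *)
Record scaled_BM (H : set (T -> R)) (v : R) (B : R -> T -> R) : Prop := {
  sbm_in : forall t, 0 <= t -> H (B t) ;
  sbm_cov : forall s t, 0 <= s -> 0 <= t ->
    \int[P]_w (B s w * B t w) = v * Num.min s t ;
  sbm_cont : forall w, {within `[0, +oo[, continuous (B ^~ w)}
}.

Variable H : set (T -> R).
Hypothesis gH : gaussian_space P H.

Lemma gsN X : H X -> H (fun w => - X w).
Proof.
by move=> HX; have := gsZ gH (-1) HX; congr H; apply/funext => w; rewrite mulN1r.
Qed.

Lemma gs_sym X u : H X -> P [set w | u < X w] = P [set w | u < - X w].
Proof.
move=> HX; have [_ s0 lX] := gs_law gH HX.
have := gs_law gH (gsN HX).
rewrite (_ : \int[P]_w (- X w) ^+ 2 = \int[P]_w (X w ^+ 2)); last first.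
  by apply: eq_Rintegral => w _; rewrite sqrrN.
move=> [_ _ lN].
have mI : measurable (`]u, +oo[%classic : set R) by exact: measurable_itv.
have pI (Y : T -> R) : [set w | u < Y w] = Y @^-1` `]u, +oo[.
  by apply/seteqP; split => w /=; rewrite in_itv /= andbT.
by rewrite (pI X) (pI (fun w => - X w)) lX // lN.
Qed.

Lemma measurable_gt0 X u : measurable_fun setT X -> measurable [set w : T | u < X w :> R].
Proof.
move=> mX; rewrite [Y in measurable Y](_ : _ = [set w | u < X w - cst 0 w]).
  by apply: measurable_gtB => //; exact: measurable_cst.
by apply/seteqP; split => w /=; rewrite subr0.
Qed.

(** Strict and weak inequalities are kept apart because [X] may be degenerate, with an atom at 0. *)
Lemma gs_half_gt X : H X -> pr [set w | 0 < X w] <= 2^-1.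
Proof.
move=> HX; have mX := gs_measurable gH HX.
have mN := gs_measurable gH (gsN HX).
have m1 := measurable_gt0 0 mX; have m2 := measurable_gt0 0 mN.
have : pr ([set w | 0 < X w] `|` [set w | 0 < - X w]) <= 1.
  by apply: pr_le1; exact: measurableU.
rewrite prUI // -(gs_sym 0 HX) (_ : _ `&` _ = set0) ?measure0; first by rewrite /=; lra.
by apply/seteqP; split => // w /= [? ?]; lra.
Qed.

Lemma gs_half_ge X : H X -> 2^-1 <= pr [set w | 0 <= X w].
Proof.
move=> HX; have mX := gs_measurable gH HX.
have mN := gs_measurable gH (gsN HX).
have -> : [set w | 0 <= X w] = ~` [set w | 0 < - X w].
  by apply/seteqP; split => w /=; rewrite oppr_gt0 leNgt => /negP.
rewrite prC; last exact: measurable_gt0.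
by rewrite -gs_sym //; have := gs_half_gt HX; lra.
Qed.

Lemma sbm_opp v B : scaled_BM H v B -> scaled_BM H v (fun t w => - B t w).
Proof.
move=> [h1 h2 h3]; split.
- by move=> t t0; exact: gsN (h1 t t0).
- move=> s t s0 t0; rewrite -h2 //; apply: eq_Rintegral => w _; ring.
- by move=> w x; apply: cvgN; exact: h3.
Qed.

Variables (v : R) (B : R -> T -> R).
Hypothesis bB : scaled_BM H v B.

Definition past (t : R) : set (T -> R) := [set X | exists2 s, 0 <= s <= t & X = B s].
Definition future (t : R) : set (T -> R) :=
  [set X | exists2 s, t <= s & X = (fun w => B s w - B t w)].

Lemma sbm_inB s t : 0 <= s -> 0 <= t -> H (fun w => B t w - B s w).
Proof. by move=> s0 t0; apply: (gsB gH); apply: (sbm_in bB). Qed.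

Lemma sbm_measurable t : 0 <= t -> measurable_fun setT (B t).
Proof. by move=> t0; apply: (gs_measurable gH); exact: (sbm_in bB). Qed.

Lemma past_future_indep t : 0 <= t -> forall A C,
  <<s cylinder (past t) >> A -> <<s cylinder (future t) >> C ->
  P (A `&` C) = (P A * P C)%E.
Proof.
move=> t0; apply: (gaussian_space_indep gH).
- by move=> X [s /andP[s0 _] ->]; exact: (sbm_in bB).
- by move=> X [s ts ->]; apply: sbm_inB => //; exact: le_trans ts.
- move=> X Y [s /andP[s0 st] ->] [r tr ->].
  have r0 := le_trans t0 tr.
  rewrite (gs_covBr gH); try by apply: (sbm_in bB).
  by rewrite !(sbm_cov bB) // !min_l ?subrr // (le_trans st).
Qed.

Lemma sbm_incr_law s t : 0 <= s -> s <= t ->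
  has_gaussian_law P (Num.sqrt (v * (t - s))) (fun w => B t w - B s w).
Proof.
move=> s0 st; have t0 := le_trans s0 st.
have := gs_law gH (sbm_inB s0 t0).
rewrite (_ : \int[P]_w (B t w - B s w) ^+ 2 = v * (t - s)) //.
have hs := sbm_in bB s0; have ht := sbm_in bB t0.
transitivity (\int[P]_w ((B t w - B s w) * (B t w - B s w))); first by [].
rewrite (gs_covBl gH) ?(gs_covBr gH) //; last exact: sbm_inB.
by rewrite !(sbm_cov bB) // !minxx min_r // min_l //; ring.
Qed.

End scaled_BM.

(** * Reflection arguments for a walk sampled at discrete times *)

Section discrete_walk.
Context d (T : measurableType d) (R : realType) (P : probability T R).
Local Notation pr A := (fine (P A)).
Variable H : set (T -> R).
Hypothesis gH : gaussian_space P H.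
Variables (v : R) (B : R -> T -> R).
Hypothesis bB : scaled_BM P H v B.
Variable tau : nat -> R.
Hypothesis tau_ge0 : forall k, 0 <= tau k.
Hypothesis tau_le : forall i j, (i <= j)%N -> tau i <= tau j.
Variable n : nat.
Local Notation S k := (B (tau k)).

Let mS k : measurable_fun setT (S k). Proof. exact: (sbm_measurable gH bB). Qed.

Let HSB i j : H (fun w => S j w - S i w). Proof. exact: (sbm_inB gH bB). Qed.

Let pastT k := g_sigma_algebraType (cylinder (past B (tau k))).
Let futureT k := g_sigma_algebraType (cylinder (future B (tau k))).

Let mpast k i : (i <= k)%N -> @measurable_fun _ _ (pastT k) R setT (S i).
Proof.
move=> ik; apply: cylinder_measurable_fun; exists (tau i) => //.
by rewrite tau_ge0 tau_le.
Qed.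

Let mfuture k i : (k <= i)%N ->
  @measurable_fun _ _ (futureT k) R setT (fun w => S i w - S k w).
Proof.
by move=> ki; apply: cylinder_measurable_fun; exists (tau i) => //; exact: tau_le.
Qed.

Let past_gtB k i j u : (i <= k)%N -> (j <= k)%N ->
  @measurable _ (pastT k) [set w | u < S j w - S i w].
Proof. by move=> ik jk; apply: measurable_gtB; exact: mpast. Qed.

Let past_leB k i j u : (i <= k)%N -> (j <= k)%N ->
  @measurable _ (pastT k) [set w | S j w - S i w <= u].
Proof. by move=> ik jk; apply: measurable_leB; exact: mpast. Qed.

Let future_gtB k i j u : (k <= i)%N -> (k <= j)%N ->
  @measurable _ (futureT k) [set w | u < S j w - S i w].
Proof.
move=> ki kj; rewrite (_ : [set w | _] =
    [set w | u < (S j w - S k w) - (S i w - S k w)]).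
  by apply: measurable_gtB; exact: mfuture.
by apply/seteqP; split => w /=; rewrite opprB addrA subrK.
Qed.

Let future_leB k i j u : (k <= i)%N -> (k <= j)%N ->
  @measurable _ (futureT k) [set w | S j w - S i w <= u].
Proof.
move=> ki kj; rewrite (_ : [set w | _] = ~` [set w | u < S j w - S i w]).
  by apply: measurableC; exact: future_gtB.
by apply/seteqP; split => w /=; rewrite leNgt => /negP.
Qed.

Let indep k A C : @measurable _ (pastT k) A -> @measurable _ (futureT k) C ->
  P (A `&` C) = (P A * P C)%E.
Proof. by move=> mA mC; exact: (past_future_indep gH bB (tau_ge0 k)). Qed.

(** [rise], [drawup] and [grid_range] are the stages between the end-to-end increment and the range;
    each passage to the next costs a factor 2 in the upper bound. [big_step] is the overshoot error
    of the lower bounds. *)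
Definition rise u := [set w | exists2 j, (j <= n)%N & u < S n w - S j w].
Definition drawup u :=
  [set w | exists2 j, (j <= n)%N & exists2 i, (i <= j)%N & u < S j w - S i w].
Definition grid_range u :=
  [set w | exists2 j, (j <= n)%N & exists2 i, (i <= n)%N & u < S j w - S i w].
Definition big_step e := [set w | exists2 j, (j < n)%N & e < `|S j.+1 w - S j w|].

Lemma measurable_rise u : measurable (rise u).
Proof. by apply: measurable_exists => j _; exact: measurable_gtB. Qed.

Lemma measurable_drawup u : measurable (drawup u).
Proof.
by apply: measurable_exists => j _; apply: measurable_exists => i _; exact: measurable_gtB.
Qed.

Lemma measurable_grid_range u : measurable (grid_range u).
Proof.
by apply: measurable_exists => j _; apply: measurable_exists => i _; exact: measurable_gtB.
Qed.

Lemma measurable_big_step e : measurable (big_step e).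
Proof.
apply: measurable_exists => j _.
apply: (@measurable_gt0 _ _ _ (fun w => `|S j.+1 w - S j w|)).
by apply: measurableT_comp => //; exact: measurable_funB.
Qed.

Let last u k := [set w | u < S n w - S k w] `&`
  [set w | forall i, (k < i <= n)%N -> S n w - S i w <= u].

Let last_future u k : (k <= n)%N -> @measurable _ (futureT k) (last u k).
Proof.
move=> kn; apply: measurableI; first exact: future_gtB.
by apply: measurable_forall => i /andP[ki _]; apply: future_leB => //; exact: ltnW.
Qed.

Let last_triv u : trivIset `I_n.+1 (last u).
Proof.
apply/trivIsetP => i j /= iN jN ij; apply/seteqP; split => // w [[hi1 hi2] [hj1 hj2]].
move: ij; rewrite neq_ltn => /orP[ij|ji].
  by have := hi2 j; rewrite ij -ltnS jN => /(_ isT); rewrite leNgt hj1.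
by have := hj2 i; rewrite ji -ltnS iN => /(_ isT); rewrite leNgt hi1.
Qed.

Let rise_last u : rise u = \bigcup_(k < n.+1) last u k.
Proof.
apply/seteqP; split => [w [j jn uj]|w [k kn [h1 h2]]]; last by exists k.
have ex : exists j, (j <= n)%N && (u < S n w - S j w) by exists j; rewrite jn uj.
have bnd j' : (j' <= n)%N && (u < S n w - S j' w) -> (j' <= n)%N by case/andP.
case: (ex_maxnP ex bnd) => k /andP[kn uk] kmax.
exists k => //; split => // i /andP[ki iN]; rewrite leNgt; apply/negP => ui.
by have := kmax i; rewrite iN ui => /(_ isT); rewrite leqNgt ki.
Qed.

Let last_measurable u k : measurable (last u k).
Proof.
apply: measurableI; first exact: measurable_gtB.
by apply: measurable_forall => i _; exact: measurable_leB.
Qed.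

(** The last index [k] with [u < S n - S k] is determined by the increments after [k].
    Independently, [S k - S 0] is nonnegative with probability at least 1/2, and adding it only
    enlarges the increment. *)
Lemma rise_le u : pr (rise u) <= 2 * pr [set w | u < S n w - S 0%N w].
Proof.
rewrite rise_last.
pose G k := [set w | 0 <= S k w - S 0%N w].
have GE k : G k = ~` [set w | 0 < S 0%N w - S k w].
  exact: ge0B_setC.
apply: (half_decomp_ge (G := G)) => //.
- by move=> k; rewrite GE; apply: measurableC; exact: measurable_gtB.
- move=> k kn; rewrite setIC muleC; apply: (indep (k := k)).
    by rewrite GE; apply: measurableC; exact: past_gtB.
  exact: last_future.
- exact: measurable_gtB.
- by move=> k _; exact: (gs_half_ge gH).
- by move=> k _ w [[h1 _] h2]; move: h1 h2; rewrite /G /=; lra.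
Qed.

(** With steps of at most [e], the rise from the last index [k] is at most [v0 + e], because the
    rise from [k.+1] is at most [v0]. A total increment above [v0 + e] thus forces [S k > S 0], an
    independent event of probability at most 1/2. *)
Lemma rise_ge v0 e : 0 <= v0 -> 0 <= e ->
  2 * (pr [set w | v0 + e < S n w - S 0%N w] - pr (big_step e)) <= pr (rise v0).
Proof.
move=> v00 e0.
pose G k := [set w | 0 < S k w - S 0%N w].
have mG k : measurable (G k) by exact: measurable_gtB.
have EG k : (k < n.+1)%N -> P (last v0 k `&` G k) = (P (last v0 k) * P (G k))%E.
  move=> kn; rewrite setIC muleC; apply: (indep (k := k)); first exact: past_gtB.
  exact: last_future.
have := decomp_le (last_measurable v0) mG (last_triv (u := v0)) EG
  (c := 2^-1) (fun k _ => gs_half_gt gH (HSB 0 k)).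
rewrite -rise_last => h.
have mU : measurable (\bigcup_(k < n.+1) (last v0 k `&` G k)).
  by apply: bigcup_measurable => k _; exact: measurableI.
suff : pr [set w | v0 + e < S n w - S 0%N w] <=
    pr (\bigcup_(k < n.+1) (last v0 k `&` G k)) + pr (big_step e) by move: h; lra.
rewrite (le_trans _ (prU _ mU (measurable_big_step e))) //; apply: pr_le.
- exact: measurable_gtB.
- by apply: measurableU => //; exact: measurable_big_step.
move=> w /= hw; have [bs|nbs] := pselect (big_step e w); [by right|left].
have small j : (j < n)%N -> `|S j.+1 w - S j w| <= e.
  by move=> jn; rewrite leNgt; apply/negP => h'; apply: nbs; exists j.
have : rise v0 w by exists 0%N => //; lra.
rewrite rise_last => -[k kn lk]; exists k => //; split => //.
case: lk => h1 h2; rewrite /G /=.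
have kltn : (k < n)%N.
  rewrite ltn_neqAle -ltnS kn andbT; apply/eqP => kE.
  by move: h1; rewrite /= kE subrr; lra.
have := h2 k.+1; rewrite ltnSn kltn => /(_ isT).
by have := small k kltn; rewrite ler_norml => /andP[]; lra.
Qed.

Let first_up u k := [set w | exists2 i, (i <= k)%N & u < S k w - S i w] `&`
  [set w | forall j, (j < k)%N -> forall i, (i <= j)%N -> S j w - S i w <= u].

(** Dual to [rise_le]: the first index at which a rise above [u] is completed is determined by the
    past, and the walk ends at or above that point with probability at least 1/2. *)
Lemma drawup_le u : pr (drawup u) <= 2 * pr (rise u).
Proof.
have mF k : measurable (first_up u k).
  apply: measurableI; first by apply: measurable_exists => i _; exact: measurable_gtB.
  by apply: measurable_forall => j _; apply: measurable_forall => i _; exact: measurable_leB.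
have -> : drawup u = \bigcup_(k < n.+1) first_up u k.
  apply/seteqP; split => [w [j jn [i ij uij]]|w [k kn [[i ik h] _]]]; last first.
    by exists k => //; exists i.
  have ex : exists j, `[< (j <= n)%N /\ exists2 i, (i <= j)%N & u < S j w - S i w >].
    by exists j; apply/asboolP; split => //; exists i.
  case: (ex_minnP ex) => k /asboolP[kn h] kmin; exists k => //; split => // j' j'k i' i'j'.
  rewrite leNgt; apply/negP => h'.
  have : (k <= j')%N.
    by apply: kmin; apply/asboolP; split; [exact: leq_trans (ltnW j'k) kn|exists i'].
  by rewrite leqNgt j'k.
pose G k := [set w | 0 <= S n w - S k w].
have GE k : G k = ~` [set w | 0 < S k w - S n w].
  exact: ge0B_setC.
apply: (half_decomp_ge (G := G)) => //.
- by move=> k; rewrite GE; apply: measurableC; exact: measurable_gtB.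
- apply/trivIsetP => i j /= iN jN ij; apply/seteqP; split => // w [[[i1 hi1 hi1'] hi2] [[j1 hj1 hj1'] hj2]].
  move: ij; rewrite neq_ltn => /orP[ij|ji].
    by have := hj2 i ij i1 hi1; rewrite leNgt hi1'.
  by have := hi2 j ji j1 hj1; rewrite leNgt hj1'.
- move=> k kn; apply: (indep (k := k)).
    apply: measurableI.
      by apply: measurable_exists => i ik; exact: past_gtB.
    apply: measurable_forall => j jk; apply: measurable_forall => i ij.
    by apply: past_leB; [exact: leq_trans ij (ltnW jk)|exact: ltnW].
  by rewrite GE; apply: measurableC; apply: future_gtB.
- exact: measurable_rise.
- by move=> k _; exact: (gs_half_ge gH).
- move=> k kn w [[[i ik h1] _] h2]; exists i; first exact: leq_trans ik _.
  by move: h1 h2; rewrite /G /=; lra.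
Qed.

Definition fall u := [set w | exists2 j, (j <= n)%N & u < S j w - S n w].

Lemma measurable_fall u : measurable (fall u).
Proof. by apply: measurable_exists => j _; exact: measurable_gtB. Qed.

Let before u k := [set w | forall j, (j < k)%N -> forall i, (i < k)%N -> S j w - S i w <= u].
Let first_max u k := [set w | exists2 i, (i <= k)%N & u < S k w - S i w] `&` before u k.
Let first_min u k := [set w | exists2 i, (i <= k)%N & u < S i w - S k w] `&` before u k.

(** At different indices the later one would have a range above [u] strictly before it. At the same
    index, a point more than [u] above one earlier point and more than [u] below another puts these
    two more than 2 u apart. *)
Let first_disj u k l w : 0 <= u -> first_max u k w -> first_min u l w -> False.
Proof.
move=> u0 [[i ik hi] bk] [[j jl hj] bl].
have [kl|lk|kl] := ltngtP k l.
- by have := bl k kl i (leq_ltn_trans ik kl); rewrite leNgt hi.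
- by have := bk j (leq_ltn_trans jl lk) l lk; rewrite leNgt hj.
subst l; move: ik; rewrite leq_eqVlt => /orP[/eqP ik|ik]; first by move: hi; rewrite ik subrr; lra.
move: jl; rewrite leq_eqVlt => /orP[/eqP jk|jk]; first by move: hj; rewrite jk subrr; lra.
by have := bk j jk i ik; move: hi hj; rewrite /=; lra.
Qed.

Let first_max_triv u : trivIset `I_n.+1 (first_max u).
Proof.
apply/trivIsetP => k l /= _ _ kl; apply/seteqP; split => // w [[[i ik hi] bk] [[j jl hj] bl]].
move: kl; rewrite neq_ltn => /orP[kl|lk].
  by have := bl k kl i (leq_ltn_trans ik kl); rewrite leNgt hi.
by have := bk l lk j (leq_ltn_trans jl lk); rewrite leNgt hj.
Qed.

Let first_min_triv u : trivIset `I_n.+1 (first_min u).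
Proof.
apply/trivIsetP => k l /= _ _ kl; apply/seteqP; split => // w [[[i ik hi] bk] [[j jl hj] bl]].
move: kl; rewrite neq_ltn => /orP[kl|lk].
  by have := bl i (leq_ltn_trans ik kl) k kl; rewrite leNgt hi.
by have := bk j (leq_ltn_trans jl lk) l lk; rewrite leNgt hj.
Qed.

Let before_past u k : @measurable _ (pastT k) (before u k).
Proof.
apply: measurable_forall => j jk; apply: measurable_forall => i ik.
by apply: past_leB; exact: ltnW.
Qed.

Let first_max_past u k : @measurable _ (pastT k) (first_max u k).
Proof.
apply: measurableI; last exact: before_past.
by apply: measurable_exists => i ik; exact: past_gtB.
Qed.

Let first_min_past u k : @measurable _ (pastT k) (first_min u k).
Proof.
apply: measurableI; last exact: before_past.
by apply: measurable_exists => i ik; exact: past_gtB.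
Qed.

Let before_measurable u k : measurable (before u k).
Proof.
by apply: measurable_forall => j _; apply: measurable_forall => i _; exact: measurable_leB.
Qed.

Let first_max_measurable u k : measurable (first_max u k).
Proof.
apply: measurableI => //.
by apply: measurable_exists => i _; exact: measurable_gtB.
Qed.

Let first_min_measurable u k : measurable (first_min u k).
Proof.
apply: measurableI => //.
by apply: measurable_exists => i _; exact: measurable_gtB.
Qed.

Let first_max_range u k : (k < n.+1)%N -> first_max u k `<=` grid_range u.
Proof. by move=> kn w [[i ik hi] _]; exists k => //; exists i => //; exact: leq_trans ik _. Qed.

Let first_min_range u k : (k < n.+1)%N -> first_min u k `<=` grid_range u.
Proof. by move=> kn w [[i ik hi] _]; exists i; [exact: leq_trans ik _|exists k]. Qed.

(** For the least [k] whose initial segment has range above [u], one of the two witnesses must be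
    [k] itself. *)
Let range_first u w : grid_range u w ->
  exists2 k, (k < n.+1)%N & first_max u k w \/ first_min u k w.
Proof.
move=> [j jn [i iN uij]].
have ex : exists k, `[< exists2 j, (j <= k)%N & exists2 i, (i <= k)%N & u < S j w - S i w >].
  by exists n; apply/asboolP; exists j => //; exists i.
case: (ex_minnP ex) => k /asboolP[j1 j1k [i1 i1k u1]] kmin.
have kn : (k < n.+1)%N by rewrite ltnS; apply: kmin; apply/asboolP; exists j => //; exists i.
have bk : before u k w.
  move=> j2 j2k i2 i2k; rewrite leNgt; apply/negP => u2.
  have : (k <= maxn j2 i2)%N.
    apply: kmin; apply/asboolP; exists j2; first exact: leq_maxl.
    by exists i2 => //; exact: leq_maxr.
  by rewrite leqNgt gtn_max j2k i2k.
exists k => //; have [j1k'|j1k'] := eqVneq j1 k.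
  by left; split => //; exists i1 => //; rewrite -j1k'.
have [i1k'|i1k'] := eqVneq i1 k.
  by right; split => //; exists j1 => //; rewrite -i1k'.
have := bk j1 _ i1 _; rewrite !ltn_neqAle j1k' i1k' j1k i1k => /(_ isT isT).
by rewrite leNgt u1.
Qed.

(** Rises and falls towards the end alike, restricted to starting points from [k] on so as to depend
    on the increments after [k] only. *)
Let tail_rise u k := [set w | exists2 i, (k <= i <= n)%N & u < S n w - S i w] `|`
  [set w | exists2 i, (k <= i <= n)%N & u < S i w - S n w].

Let tail_rise_future u k : (k <= n)%N -> @measurable _ (futureT k) (tail_rise u k).
Proof.
by move=> kn; apply: measurableU; apply: measurable_exists => i /andP[ki _]; exact: future_gtB.
Qed.

Let tail_rise_measurable u k : measurable (tail_rise u k).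
Proof.
by apply: measurableU; apply: measurable_exists => i _; exact: measurable_gtB.
Qed.

(* At the first time [k] when the range exceeds [u], [S k] is an extremum. For the
   walk to end with a rise or a fall above [u + e], its increments after [k] must
   then turn back or oscillate by more than [u]. *)
Lemma grid_range_lower u e : 0 <= u -> 0 <= e ->
  pr (rise (u + e) `|` fall (u + e)) <=
  (2^-1 + pr (rise u) + pr (fall u)) * pr (grid_range u) + pr (big_step e).
Proof.
move=> u0 e0; set c := 2^-1 + _ + _.
pose Gu k := [set w | 0 < S n w - S k w] `|` tail_rise (u + e) k.
pose Gd k := [set w | 0 < S k w - S n w] `|` tail_rise (u + e) k.
have mGu k : measurable (Gu k).
  by apply: measurableU => //; exact: measurable_gtB.
have mGd k : measurable (Gd k).
  by apply: measurableU => //; exact: measurable_gtB.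
have tailc k : pr (tail_rise (u + e) k) <= pr (rise u) + pr (fall u).
  rewrite (le_trans _ (prU _ (measurable_rise u) (measurable_fall u))) //.
  apply: pr_le => //; first by apply: measurableU; [exact: measurable_rise|exact: measurable_fall].
  by move=> w [[i /andP[_ iN] h]|[i /andP[_ iN] h]]; [left|right]; exists i => //; lra.
have Guc k : pr (Gu k) <= c.
  rewrite (le_trans (prU _ _ _)) //; first exact: measurable_gtB.
  by rewrite /c -addrA lerD //; exact: (gs_half_gt gH).
have Gdc k : pr (Gd k) <= c.
  rewrite (le_trans (prU _ _ _)) //; first exact: measurable_gtB.
  by rewrite /c -addrA lerD //; exact: (gs_half_gt gH).
have iu k : (k < n.+1)%N -> P (first_max u k `&` Gu k) = (P (first_max u k) * P (Gu k))%E.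
  move=> kn; apply: (indep (k := k)) => //.
  by apply: measurableU; [exact: future_gtB|exact: tail_rise_future].
have id k : (k < n.+1)%N -> P (first_min u k `&` Gd k) = (P (first_min u k) * P (Gd k))%E.
  move=> kn; apply: (indep (k := k)) => //.
  by apply: measurableU; [exact: future_gtB|exact: tail_rise_future].
have hu := decomp_le (first_max_measurable u) mGu (first_max_triv (u := u)) iu (fun k _ => Guc k).
have hd := decomp_le (first_min_measurable u) mGd (first_min_triv (u := u)) id (fun k _ => Gdc k).
have mUu : measurable (\bigcup_(k < n.+1) (first_max u k `&` Gu k)).
  by apply: bigcup_measurable => k _; exact: measurableI.
have mUd : measurable (\bigcup_(k < n.+1) (first_min u k `&` Gd k)).
  by apply: bigcup_measurable => k _; exact: measurableI.
have mu' : measurable (\bigcup_(k < n.+1) first_max u k).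
  by apply: bigcup_measurable => k _.
have md' : measurable (\bigcup_(k < n.+1) first_min u k).
  by apply: bigcup_measurable => k _.
have sum_le : pr (\bigcup_(k < n.+1) first_max u k) + pr (\bigcup_(k < n.+1) first_min u k)
    <= pr (grid_range u).
  have := prUI P mu' md'.
  rewrite (_ : _ `&` _ = set0) ?measure0 /=; last first.
    by apply/seteqP; split => // w [[k _ hk] [l _ hl]]; exact: first_disj u0 hk hl.
  rewrite subr0 => <-; apply: pr_le; [exact: measurableU|exact: measurable_grid_range|].
  by move=> w [[k kn hk]|[k kn hk]]; [exact: first_max_range hk|exact: first_min_range hk].
have c0 : 0 <= c by rewrite /c !addr_ge0 ?pr_ge0.
have main : pr (rise (u + e) `|` fall (u + e)) <=
    pr (\bigcup_(k < n.+1) (first_max u k `&` Gu k)) +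
    pr (\bigcup_(k < n.+1) (first_min u k `&` Gd k)) + pr (big_step e).
  have mb := measurable_big_step e.
  have m1 := measurableU _ _ mUu mUd; have m2 := measurableU _ _ m1 mb.
  rewrite (le_trans _ (lerD (prU P mUu mUd) (lexx _))) //.
  rewrite (le_trans _ (prU P m1 mb)) //; apply: pr_le => //.
    by apply: measurableU; [exact: measurable_rise|exact: measurable_fall].
  move=> w Zw; have [bs|nbs] := pselect (big_step e w); [by right|left].
  have small j : (j < n)%N -> `|S j.+1 w - S j w| <= e.
    by move=> jn; rewrite leNgt; apply/negP => h'; apply: nbs; exists j.
  have gr : grid_range u w.
    by case: Zw => -[j jn h]; [exists n|exists j] => //; [exists j|exists n] => //; lra.
  have [k kn hk] := range_first gr.
  (* The points before [k] lie within [u] of each other, in particular of the point just before [k],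
     and the step to [k] adds at most [e]. *)
  have step j0 : (j0 < k)%N -> before u k w ->
      S k w - S j0 w <= u + e /\ S j0 w - S k w <= u + e.
    case: k kn {hk} => [//|k] kn j0k bk.
    have := small k kn; rewrite ler_norml => /andP[h1 h2].
    by have := bk k (ltnSn k) j0 j0k; have := bk j0 j0k k (ltnSn k); lra.
  case: hk => hk; [left|right]; exists k => //; split => //; case: hk => -[i ik hi] bk.
  - have ltS j0 : (j0 < k)%N -> S j0 w < S k w.
      move=> j0k; move: ik; rewrite leq_eqVlt => /orP[/eqP ik|ik].
        by move: hi; rewrite ik subrr; lra.
      by have := bk j0 j0k i ik; lra.
    (* A rise from before [k] exceeds what [step] allows up to [S k], so the walk ends above [S k];
       a fall from before [k] is a larger fall from the maximum [S k]. Starting points from [k] on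
       are in [tail_rise]. *)
    case: Zw => -[j0 j0n h0]; have [j0k|kj0] := ltnP j0 k.
    + by left; rewrite /=; have [] := step j0 j0k bk; lra.
    + by right; left; exists j0 => //; rewrite kj0.
    + by right; right; exists k; [rewrite leqnn|have := ltS j0 j0k; lra].
    + by right; right; exists j0 => //; rewrite kj0.
  - have gtS j0 : (j0 < k)%N -> S k w < S j0 w.
      move=> j0k; move: ik; rewrite leq_eqVlt => /orP[/eqP ik|ik].
        by move: hi; rewrite ik subrr; lra.
      by have := bk i ik j0 j0k; lra.
    case: Zw => -[j0 j0n h0]; have [j0k|kj0] := ltnP j0 k.
    + by right; left; exists k; [rewrite leqnn|have := gtS j0 j0k; lra].
    + by right; left; exists j0 => //; rewrite kj0.
    + by left; rewrite /=; have [] := step j0 j0k bk; lra.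
    + by right; right; exists j0 => //; rewrite kj0.
rewrite (le_trans main) // lerD2r (le_trans (lerD hu hd)) // -mulrDr.
by rewrite ler_wpM2l.
Qed.

Lemma grid_range_drawup u : grid_range u `<=` drawup u `|`
  [set w | exists2 j, (j <= n)%N & exists2 i, (i <= j)%N & u < - S j w - - S i w].
Proof.
move=> w [j jn [i iN h]]; have [ij|ji] := leqP i j.
  by left; exists j => //; exists i.
by right; exists i => //; exists j; [exact: ltnW|lra].
Qed.

End discrete_walk.

(** * Ranges of continuous paths seen on grids *)

Section path_ranges.
Variable R : realType.
Implicit Types (f : R -> R) (q u : R).

(** Free of suprema and infima: the strict inequality is stable under small changes of the two
    times, so the event becomes a countable union of grid events. *)
Definition oscillates q u f :=
  exists2 s, 0 <= s <= q & exists2 t, 0 <= t <= q & u < f t - f s.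

Lemma path_range_gt q u f : 0 <= q -> {within `[0, +oo[, continuous f} ->
  u < path_range q f <-> oscillates q u f.
Proof.
move=> q0 cf.
have cfq : {within `[0, q], continuous f}.
  by apply: continuous_subspaceW cf; exact: subset_itvl.
have [M Mi fM] := EVT_max q0 cfq; have [m mi fm] := EVT_min q0 cfq.
pose A := [set f t | t in `[0, q]].
have A0 : A !=set0 by exists (f M), M.
have uA : has_ubound A by exists (f M) => _ [t ti <-]; exact: fM.
have lA : has_lbound A by exists (f m) => _ [t ti <-]; exact: fm.
split=> [|[s si [t ti ust]]].
  rewrite /path_range -/A => h; exists m; first by rewrite in_itv /= in mi.
  exists M; first by rewrite in_itv /= in Mi.
  apply: lt_le_trans h _; apply: lerB.
    by apply: ge_sup => // _ [t ti <-]; exact: fM.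
  by apply: lb_le_inf => // _ [t ti <-]; exact: fm.
apply: lt_le_trans ust _; rewrite /path_range -/A; apply: lerB.
  by apply: ub_le_sup => //; exists t => //; rewrite /= in_itv.
by apply: ge_inf => //; exists s => //; rewrite /= in_itv.
Qed.

(** [N.+1] steps avoid a division by zero; the index [N.+1] is included and reaches [q]. *)
Definition grid q (N k : nat) : R := k%:R * (q / N.+1%:R).

Lemma grid_near q t (e : R) : 0 < q -> 0 <= t <= q -> 0 < e ->
  \forall N \near \oo, exists2 k, (k <= N.+1)%N & `|grid q N k - t| < e.
Proof.
move=> q0 /andP[t0 tq] e0; near=> N.
have h0 : 0 < q / N.+1%:R by rewrite divr_gt0.
pose k := Num.truncn (t / (q / N.+1%:R)).
have t1 : 0 <= t / (q / N.+1%:R) by rewrite divr_ge0 // ltW.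
have /andP[k1 k2] := truncn_itv t1.
exists k.
  rewrite -(ler_nat R) (le_trans k1) // ler_pdivrMr // mulrCA mulfV ?mulr1 //.
rewrite /grid -/k.
have k1' : k%:R * (q / N.+1%:R) <= t by rewrite -ler_pdivlMr.
have k2' : t < k%:R * (q / N.+1%:R) + q / N.+1%:R.
  by move: k2; rewrite -/k ltr_pdivrMr // -natr1 mulrDl mul1r.
have hq : q / N.+1%:R < e.
  rewrite ltr_pdivrMr // -ltr_pdivrMl // -natr1 ltr_wpDr //.
  by near: N; exact: nbhs_infty_gtr.
move: k1' k2' hq; set z := k%:R * _; set g := q / _; move: z g => z g k1' k2' hq.
by rewrite ltr_norml; apply/andP; split; lra.
Unshelve. all: by end_near. Qed.

(** The strict inequality leaves room for an error [e] at each of the two times. The conclusion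
    holds for all large [N], although the grids are not nested; the limit in [sbm_range_ub] relies
    on this. *)
Lemma oscillates_grid q u f : 0 < q -> {within `[0, +oo[, continuous f} ->
  oscillates q u f ->
  \forall N \near \oo, exists2 j, (j <= N.+1)%N &
    exists2 i, (i <= N.+1)%N & u < f (grid q N j) - f (grid q N i).
Proof.
move=> q0 cf [s si [t ti ust]].
pose e := (f t - f s - u) / 2; have e0 : 0 < e by rewrite divr_gt0 // subr_gt0.
have near_pt x : 0 <= x <= q -> \forall N \near \oo,
    exists2 k, (k <= N.+1)%N & `|f (grid q N k) - f x| < e.
  move=> xi; have /andP[x0 _] := xi.
  have xI : `[0, +oo[%classic x by rewrite /= in_itv /= x0.
  have cx : f @ within `[0, +oo[%classic (nbhs x) --> f x.
    by rewrite (nbhs_subspace_in xI); exact: cf.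
  have /cvgrPdist_lt/(_ e e0) := cx.
  rewrite /prop_near1 /within /= => /nbhs_ballP[r /= r0 hr].
  have := grid_near q0 xi r0; apply: filterS => N [k kN hk]; exists k => //.
  rewrite distrC; apply: hr; first by rewrite /ball /= distrC.
  by rewrite /= in_itv /= andbT mulr_ge0 // divr_ge0 // ltW.
near=> N.
have [j jN hj] : exists2 k, (k <= N.+1)%N & `|f (grid q N k) - f t| < e by near: N; exact: near_pt.
have [i iN hi] : exists2 k, (k <= N.+1)%N & `|f (grid q N k) - f s| < e by near: N; exact: near_pt.
exists j => //; exists i => //.
by move: hi hj; rewrite !ltr_norml /e => /andP[h1 h2] /andP[h3 h4]; lra.
Unshelve. all: by end_near. Qed.

Lemma grid_oscillates q u f N i j : 0 < q -> (i <= N.+1)%N -> (j <= N.+1)%N ->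
  u < f (grid q N j) - f (grid q N i) -> oscillates q u f.
Proof.
move=> q0 iN jN h.
have gi k : (k <= N.+1)%N -> 0 <= grid q N k <= q.
  move=> kN; rewrite mulr_ge0 ?divr_ge0 ?(ltW q0) //= /grid mulrCA ler_piMr ?(ltW q0) //.
  by rewrite ler_pdivrMr // mul1r ler_nat.
by exists (grid q N i); [exact: gi|exists (grid q N j) => //; exact: gi].
Qed.

Lemma measurable_oscillates d (T : measurableType d) (B : R -> T -> R) q u : 0 < q ->
  (forall t, 0 <= t -> measurable_fun setT (B t)) ->
  (forall w, {within `[0, +oo[, continuous (B ^~ w)}) ->
  measurable [set w | oscillates q u (B ^~ w)].
Proof.
move=> q0 mB cB.
rewrite (_ : [set w | _] = \bigcup_N [set w | exists2 j, (j <= N.+1)%N &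
    exists2 i, (i <= N.+1)%N & u < B (grid q N j) w - B (grid q N i) w]).
  apply: bigcup_measurable => N _; apply: measurable_exists => j _.
  apply: measurable_exists => i _.
  by apply: measurable_gtB; apply: mB; rewrite mulr_ge0 // divr_ge0 // ltW.
apply/seteqP; split => w /=.
  by move=> /(oscillates_grid q0 (cB w))[N _ /(_ N (leqnn N))]; exists N.
by move=> [N _ [j jN [i iN h]]]; exact: grid_oscillates h.
Qed.

End path_ranges.

(** A crude polynomial bound that suffices for fine grids: with [mills_ub] a step exceeds [e] with
    probability of order s^3, and [N.+1] steps of variance s^2 = v q / (N + 1) leave a total of
    order s. *)
Lemma normal_pdf_small (R : realType) (s e : R) : 0 < s -> 0 < e ->
  normal_pdf 0 s e <= 2 * s / e ^+ 2.
Proof.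
move=> s0 e0; have sn : s != 0 by rewrite gt_eqF.
have s2 : 0 < s ^+ 2 by rewrite exprn_gt0.
have e2 : 0 < e ^+ 2 by rewrite exprn_gt0.
rewrite normal_pdfN0 // subr0.
have p1 : normal_peak s <= s^-1.
  rewrite /normal_peak lef_pV2 ?posrE // ?sqrtr_gt0 ?mulrn_wgt0 ?mulr_gt0 ?pi_gt0 //.
  rewrite -[leLHS]ger0_norm ?(ltW s0) // -sqrtr_sqr ler_wsqrtr //.
  by have := pi_ge2 R; rewrite -mulr_natr; nra.
have p2 : expR (- e ^+ 2 / (s ^+ 2 *+ 2)) <= 2 * s ^+ 2 / e ^+ 2.
  have y0 : 0 < e ^+ 2 / (2 * s ^+ 2) by rewrite divr_gt0 // mulr_gt0.
  have := expRN_le_inv y0; rewrite invf_div.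
  by rewrite mulNr mulr_natl.
rewrite (le_trans (ler_pM _ _ p1 p2)) ?normal_peak_ge0 ?expR_ge0 //.
by rewrite le_eqVlt; apply/orP; left; apply/eqP; field; rewrite sn gt_eqF.
Qed.

(** * Tail bounds for the range *)

Section range_tails.
Context d (T : measurableType d) (R : realType) (P : probability T R).
Local Notation pr A := (fine (P A)).
Variable H : set (T -> R).
Hypothesis gH : gaussian_space P H.
Variables (v : R) (q : R).
Hypothesis q0 : 0 < q.

Local Notation osc u B := [set w | oscillates q u (B ^~ w)].

Let grid0 N : grid q N 0 = 0. Proof. by rewrite /grid mul0r. Qed.
Let gridq N : grid q N N.+1 = q. Proof. by rewrite /grid mulrCA mulfV // mulr1. Qed.
Let grid_ge0 N k : 0 <= grid q N k. Proof. by rewrite mulr_ge0 // divr_ge0 // ltW. Qed.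
Let grid_le N i j : (i <= j)%N -> grid q N i <= grid q N j.
Proof. by move=> ij; rewrite ler_wpM2r ?ler_nat // divr_ge0 // ltW. Qed.

Lemma measurable_sbm_osc B u : scaled_BM P H v B -> measurable (osc u B).
Proof.
move=> bB; apply: measurable_oscillates => //.
  exact: (sbm_measurable gH bB).
exact: (sbm_cont bB).
Qed.

Lemma sbm_sym_incr B u s t : scaled_BM P H v B -> 0 <= s -> 0 <= t ->
  pr [set w | u < - B t w - - B s w] = pr [set w | u < B t w - B s w].
Proof.
move=> bB s0 t0; rewrite (gs_sym gH _ (sbm_inB gH bB s0 t0)); congr (pr _).
by apply/seteqP; split => w /=; rewrite opprB opprK addrC.
Qed.

(** 8 = 2 * 2 * 2: the two directions, [drawup_le] and [rise_le]. *)
Lemma grid_range_ub B u N : scaled_BM P H v B ->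
  pr (grid_range B (grid q N) N.+1 u) <= 8 * pr [set w | u < B q w - B 0 w].
Proof.
move=> bB; have bN := sbm_opp gH bB.
have m1 := measurable_drawup gH bB (grid_ge0 N) N.+1 u.
have m2 := measurable_drawup gH bN (grid_ge0 N) N.+1 u.
have h := pr_le P (measurable_grid_range gH bB (grid_ge0 N) N.+1 u)
  (measurableU _ _ m1 m2) (@grid_range_drawup _ T R B (grid q N) N.+1 u).
have := prU P m1 m2.
have := drawup_le gH bB (grid_ge0 N) (@grid_le N) N.+1 u.
have := rise_le gH bB (grid_ge0 N) (@grid_le N) N.+1 u.
have := drawup_le gH bN (grid_ge0 N) (@grid_le N) N.+1 u.
have := rise_le gH bN (grid_ge0 N) (@grid_le N) N.+1 u.
rewrite !gridq !grid0 (sbm_sym_incr _ bB) ?(ltW q0) //.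
by move: h; rewrite /drawup /=; lra.
Qed.

(** Since the grids are not nested, the range event is written as the increasing union of the events
    [F M] that all grids from [M] on see the oscillation. Each [F M] obeys the grid bound, and
    continuity from below concludes. *)
Lemma sbm_range_ub B u : scaled_BM P H v B ->
  pr (osc u B) <= 8 * pr [set w | u < B q w - B 0 w].
Proof.
move=> bB.
have cB w : {within `[0, +oo[, continuous (B ^~ w)} by exact: (sbm_cont bB).
pose G N := grid_range B (grid q N) N.+1 u.
have mG N : measurable (G N) := measurable_grid_range gH bB (grid_ge0 N) N.+1 u.
pose F M := \bigcap_(N in [set N | (M <= N)%N]) G N.
have mF M : measurable (F M) by apply: bigcap_measurableType => N _.
have FE : osc u B = \bigcup_M F M.
  apply/seteqP; split => w /=.
    by move=> /(oscillates_grid q0 (cB w))[M _ hM]; exists M => // N /= MN; exact: hM.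
  by move=> [M _ /(_ M (leqnn M))[j jN [i iN h]]]; exact: grid_oscillates h.
have := @nondecreasing_cvg_mu _ _ _ P F mF (bigcupT_measurable _ mF) _.
rewrite -FE => cF.
have {}cF : P (F M) @[M --> \oo] --> P (osc u B).
  apply: cF => M M' MM'; apply/subsetPset => w h N /= M'N; apply: h.
  exact: leq_trans MM' M'N.
have cF' : (fine \o (P \o F)) M @[M --> \oo] --> pr (osc u B).
  apply: fine_cvg; rewrite fineK; first exact: cF.
  by rewrite fin_num_measure //; exact: measurable_sbm_osc.
rewrite -(cvg_lim _ cF') //; apply: limr_le; first by apply/cvg_ex; eexists; exact: cF'.
near=> M; rewrite (le_trans _ (grid_range_ub u M bB)) //.
apply: pr_le; [exact: mF|exact: mG|].
by move=> w /(_ M (leqnn M)).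
Unshelve. all: by end_near. Qed.

Hypothesis v0 : 0 < v.

Lemma sbm_tail B (u s t : R) : scaled_BM P H v B -> 0 <= s -> s < t ->
  P [set w | u < B t w - B s w] = normal_prob 0 (Num.sqrt (v * (t - s))) `]u, +oo[.
Proof.
move=> bB s0 st; have [_ _ l] := sbm_incr_law gH bB s0 (ltW st).
rewrite (_ : [set w | _] = (fun w => B t w - B s w) @^-1` `]u, +oo[).
  rewrite l ?/gaussian_law; last exact: measurable_itv.
  by rewrite gt_eqF // sqrtr_gt0 mulr_gt0 // subr_gt0.
by apply/seteqP; split => w /=; rewrite in_itv /= andbT.
Qed.

Lemma big_step_le B (e : R) N : scaled_BM P H v B -> 0 < e ->
  pr (big_step B (grid q N) N.+1 e) <= 4 * (v * q) * Num.sqrt (v * (q / N.+1%:R)) / e ^+ 3.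
Proof.
move=> bB e0; pose s := Num.sqrt (v * (q / N.+1%:R)).
have vq : 0 < v * (q / N.+1%:R) by rewrite mulr_gt0 // divr_gt0.
have s0 : 0 < s by rewrite sqrtr_gt0.
have s2 : s ^+ 2 = v * (q / N.+1%:R) by rewrite sqr_sqrtr // ltW.
have gS k : grid q N k.+1 - grid q N k = q / N.+1%:R.
  by rewrite /grid -natr1 mulrDl mul1r addrC addKr.
have glt k : grid q N k < grid q N k.+1 by rewrite -subr_gt0 gS divr_gt0.
have one k : pr [set w | e < B (grid q N k.+1) w - B (grid q N k) w] <= 2 * s ^+ 3 / e ^+ 3.
  rewrite (sbm_tail _ bB) // gS -/s -lee_fin fineK ?fin_num_measure //.
  rewrite (le_trans (mills_ub s0 e0)) // lee_fin.
  rewrite -mulrA (le_trans (ler_wpM2l (sqr_ge0 _) (ler_wpM2r _ (normal_pdf_small s0 e0)))) //.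
    by rewrite invr_ge0 ltW.
  by rewrite le_eqVlt; apply/orP; left; apply/eqP; field; rewrite gt_eqF.
have mS k := sbm_measurable gH bB (grid_ge0 N k).
rewrite (_ : big_step _ _ _ _ = \bigcup_(k < N.+1)
   ([set w | e < B (grid q N k.+1) w - B (grid q N k) w] `|`
    [set w | e < - B (grid q N k.+1) w - - B (grid q N k) w])); last first.
  apply/seteqP; split => w [k kN /=].
    rewrite ltr_normr => /orP[h|h]; exists k => //; [by left|right].
    by move: h => /=; lra.
  by move=> [h|h]; exists k => //; rewrite ltr_normr; apply/orP; [left|right; move: h => /=; lra].
have mN k : measurable_fun setT (fun w => - B (grid q N k) w).
  exact: (sbm_measurable gH (sbm_opp gH bB)).
rewrite (le_trans (pr_bigcup_le (c := 4 * s ^+ 3 / e ^+ 3) _ _)) //.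
- by move=> k; apply: measurableU; exact: measurable_gtB.
- move=> k _; rewrite (le_trans (prU _ _ _)) //; try exact: measurable_gtB.
  by rewrite (sbm_sym_incr _ bB) //; have := one k; lra.
rewrite -/s exprS s2 le_eqVlt; apply/orP; left; apply/eqP; field.
by rewrite gt_eqF //= pnatr_eq0.
Qed.

Lemma sbm_range_lb B (u e : R) : scaled_BM P H v B -> 0 <= u -> 0 < e ->
  4 * pr [set w | u + e < B q w - B 0 w] - 8 * pr [set w | 2 * u < B q w - B 0 w] <=
  (2^-1 + 4 * pr [set w | u < B q w - B 0 w]) * pr (osc u B).
Proof.
move=> bB u0 e0; have bN := sbm_opp gH bB.
set Q := fun u => pr [set w | u < B q w - B 0 w].
rewrite -/(Q u) -/(Q (u + e)) -/(Q (2 * u)).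
pose h := e / 2; have h0 : 0 < h by rewrite divr_gt0.
rewrite -subr_le0; set X := _ - _.
(* The 5 counts step errors: two from each use of [rise_ge], for the walk and its opposite, and one
   from [grid_range_lower]. Each of these two lemmas takes an overshoot [h], half of [e]. *)
have key N : X <= 5 * (4 * (v * q) * Num.sqrt (v * (q / N.+1%:R)) / h ^+ 3).
  have hd := big_step_le N bB h0; set D := (X in pr _ <= X) in hd.
  have g0 := grid_ge0 N; have gl := @grid_le N.
  have hl := grid_range_lower gH bB g0 gl N.+1 u0 (ltW h0).
  have r1 := rise_le gH bB g0 gl N.+1 u.
  have r2 := rise_le gH bN g0 gl N.+1 u.
  have uh : 0 <= u + h by rewrite addr_ge0 // ltW.
  have r3 := rise_ge gH bB g0 gl N.+1 uh (ltW h0).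
  have r4 := rise_ge gH bN g0 gl N.+1 uh (ltW h0).
  have fN x : rise (fun t w => - B t w) (grid q N) N.+1 x = fall B (grid q N) N.+1 x.
    by apply/seteqP; split => w [j jN hj]; exists j => //; move: hj; rewrite opprK addrC.
  have bigN : big_step (fun t w => - B t w) (grid q N) N.+1 h = big_step B (grid q N) N.+1 h.
    by apply/seteqP; split => w [j jN hj]; exists j => //; move: hj; rewrite -opprD normrN.
  move: r2 r4; rewrite !fN bigN !gridq !grid0 !(sbm_sym_incr _ bB) ?(ltW q0) // => r2 r4.
  move: r1 r3; rewrite !gridq !grid0 => r1 r3.
  have uhh : u + h + h = u + e by rewrite /h; lra.
  rewrite uhh -/(Q (u + e)) in r3 r4; rewrite -/(Q u) in r1 r2.
  have mr := measurable_rise gH bB g0 N.+1 (u + h).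
  have mf := measurable_fall gH bB g0 N.+1 (u + h).
  have hU := prUI P mr mf.
  (* A rise and a fall towards the same end point have starting points more than 2 u apart. *)
  have hI : pr (rise B (grid q N) N.+1 (u + h) `&` fall B (grid q N) N.+1 (u + h)) <= 8 * Q (2 * u).
    rewrite (le_trans _ (grid_range_ub (2 * u) N bB)) // pr_le //.
    - exact: measurableI.
    - exact: (measurable_grid_range gH bB g0).
    - move=> w [[j jN hj] [i iN hi]]; exists i => //; exists j => //.
      by move: hi hj; rewrite /=; lra.
  have hG : pr (grid_range B (grid q N) N.+1 u) <= pr (osc u B).
    apply: pr_le; [exact: (measurable_grid_range gH bB g0)|exact: measurable_sbm_osc|].
    by move=> w [j jN [i iN hij]]; exact: grid_oscillates hij.
  set c := 2^-1 + _ + _ in hl.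
  have hc : c <= 2^-1 + 4 * Q u by rewrite /c; lra.
  have c0 : 0 <= c by rewrite /c !addr_ge0 ?pr_ge0.
  have hm : c * pr (grid_range B (grid q N) N.+1 u) <= (2^-1 + 4 * Q u) * pr (osc u B).
    by apply: ler_pM => //; exact: pr_ge0.
  rewrite -/D /X; move: hl hU hI r3 r4 hm hd.
  set Y := _ * pr (osc u B); set Z := c * _.
  move: Y Z D; clear; move=> Y Z D; set x1 := pr (_ `|` _); set x2 := pr (_ `&` _).
  set x3 := pr (rise _ _ _ _); set x4 := pr (fall _ _ _ _); set x5 := pr (big_step _ _ _ _).
  by move: x1 x2 x3 x4 x5 (Q _) (Q _) => x1 x2 x3 x4 x5 y1 y2; lra.
rewrite leNgt; apply/negP => X0.
pose K := 20 * (v * q) / h ^+ 3.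
have K0 : 0 < K by rewrite divr_gt0 ?mulr_gt0 ?exprn_gt0.
(* Chosen so that a square root of at most [eta] makes the error in [key] at most X / 2, a
   contradiction with X > 0. *)
pose eta := X / (2 * K); have eta0 : 0 < eta by rewrite divr_gt0 // mulr_gt0.
have [N hN] : exists N : nat, v * (q / N.+1%:R) <= eta ^+ 2.
  exists (Num.bound (v * q / eta ^+ 2)).
  have := archi_boundP (ltW (divr_gt0 (mulr_gt0 v0 q0) (exprn_gt0 2 eta0))).
  set M := Num.bound _ => hM.
  rewrite mulrA ler_pdivrMr // -ler_pdivrMl ?exprn_gt0 // [leLHS]mulrC.
  by rewrite (le_trans (ltW hM)) // ler_nat.
have := key N.
have : Num.sqrt (v * (q / N.+1%:R)) <= eta.
  by rewrite -[leRHS]ger0_norm ?(ltW eta0) // -sqrtr_sqr ler_wsqrtr.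
set sN := Num.sqrt _ => hs.
have -> : 5 * (4 * (v * q) * sN / h ^+ 3) = K * sN.
  by rewrite /K; field; rewrite gt_eqF.
apply/negP; rewrite -ltNge (le_lt_trans (ler_wpM2l (ltW K0) hs)) //.
have -> : K * eta = X / 2 by rewrite /eta; field; rewrite gt_eqF.
lra.
Qed.

End range_tails.

(** * Joint exceedances of correlated ranges *)

Section process_space.
Context d (T : measurableType d) (R : realType) (P : probability T R).
Local Notation pr A := (fine (P A)).
Variables (n : nat) (S : 'M[R]_n) (W : 'I_n -> R -> T -> R).
Hypothesis hW : is_correlated_BM P S W.

(** One Gaussian space containing all components and all residuals. The shape of its elements is
    that of [is_gaussian_process], which makes each of them Gaussian by hypothesis. *)
Definition process_space : set (T -> R) := [set f | exists m (c : 'I_m -> R)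
  (i : 'I_m -> 'I_n) (t : 'I_m -> R), (forall k, 0 <= t k) /\
  f = fun w => \sum_(k < m) c k * W (i k) (t k) w].

Lemma process_space_W i t : 0 <= t -> process_space (W i t).
Proof.
move=> t0; exists 1%N, (fun=> 1), (fun=> i), (fun=> t); split=> //.
by apply/funext => w; rewrite big_ord1 mul1r.
Qed.

Let W_law i t : 0 <= t -> exists s, has_gaussian_law P s (W i t).
Proof.
move=> t0; apply: is_gaussian_centered; last exact: (CBM_centered hW).
have gW : is_gaussian_process P W := CBM_gaussian hW.
have := gW 1%N (fun=> 1) (fun=> i) (fun=> t) (fun=> t0).
by congr is_gaussian; apply/funext => w; rewrite big_ord1 mul1r.
Qed.

Let W_integrable i t : 0 <= t -> P.-integrable setT (EFin \o W i t).
Proof.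
move=> t0; have [s gs] := W_law i t0; have [i2 _] := gaussian_sqr gs.
have [mX _ _] := gs.
have i1 := finite_measure_integrable_cst P (1 : R) (@measurableT _ T).
apply: (le_integrable measurableT _ _ (integrableD measurableT i1 i2)).
  exact/measurable_EFinP.
move=> w _; rewrite /= lee_fin [leRHS]ger0_norm ?addr_ge0 ?sqr_ge0 //.
rewrite -(@real_normK _ (W i t w)) ?num_real //.
by have := sqr_ge0 (`|W i t w| - 1); have := normr_ge0 (W i t w); nra.
Qed.

Let W_mean i t : 0 <= t -> \int[P]_w W i t w = 0.
Proof.
by move=> t0; have := CBM_centered hW i t0; rewrite unlock /Rintegral => ->.
Qed.

Let sum_mean (I : Type) (s : seq I) (f : I -> T -> R) :
  (forall k, P.-integrable setT (EFin \o f k)) -> (forall k, \int[P]_w f k w = 0) ->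
  P.-integrable setT (EFin \o (fun w => \sum_(k <- s) f k w)) /\
  \int[P]_w (\sum_(k <- s) f k w) = 0.
Proof.
move=> fi f0; elim: s => [|k s [IH1 IH2]].
  rewrite (_ : (fun w => \sum_(k <- [::]) f k w) = cst 0); last first.
    by apply/funext => w; rewrite big_nil.
  split; first exact: finite_measure_integrable_cst.
  by rewrite Rintegral_cst // mul0r.
rewrite (_ : (fun w => \sum_(j <- k :: s) f j w) = (fun w => f k w + \sum_(j <- s) f j w)); last first.
  by apply/funext => w; rewrite big_cons.
split; first exact: (integrableD measurableT (fi k) IH1).
by rewrite RintegralD // f0 IH2 addr0.
Qed.

Lemma process_space_gaussian : gaussian_space P process_space.
Proof.
split.
- have i0 : 'I_0 -> 'I_n by case.
  exists 0%N, (fun=> 0), i0, (fun=> 0).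
  by split => //; apply/funext => w; rewrite big_ord0.
- move=> a X Y [m1 [c1 [i1 [t1 [h1 ->]]]]] [m2 [c2 [i2 [t2 [h2 ->]]]]].
  exists (m1 + m2)%N,
    (fun k => match fintype.split k with inl k1 => a * c1 k1 | inr k2 => c2 k2 end),
    (fun k => match fintype.split k with inl k1 => i1 k1 | inr k2 => i2 k2 end),
    (fun k => match fintype.split k with inl k1 => t1 k1 | inr k2 => t2 k2 end).
  split; first by move=> k; case: (fintype.split k).
  apply/funext => w; rewrite big_split_ord /= mulr_sumr; congr (_ + _).
    by apply: eq_bigr => k _; rewrite (unsplitK (inl k)) mulrA.
  by apply: eq_bigr => k _; rewrite (unsplitK (inr k)).
- move=> X [m [c [i [t [t0 ->]]]]]; apply: is_gaussian_centered.
    exact: (CBM_gaussian hW).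
  pose f k w := c k * W (i k) (t k) w.
  have fi k : P.-integrable setT (EFin \o f k).
    rewrite (_ : EFin \o f k = fun w => ((c k)%:E * (W (i k) (t k) w)%:E)%E) //.
    by apply: integrableZl => //; exact: W_integrable.
  have f0 k : \int[P]_w f k w = 0.
    by rewrite RintegralZl ?W_mean ?mulr0 //; exact: W_integrable.
  have [si s0] := sum_mean (index_enum _) fi f0.
  rewrite unlock -[LHS]fineK ?(integrable_fin_num _ si) //.
  by rewrite -[X in X%:E]/(Rintegral P setT _) s0.
Qed.

Let gH := process_space_gaussian.

Lemma process_cov i j s t : 0 <= s -> 0 <= t ->
  \int[P]_w (W i s w * W j t w) = Num.min s t * S i j.
Proof.
move=> s0 t0; have := CBM_covariance hW i j s0 t0; rewrite unlock.
rewrite (CBM_centered hW i s0) (CBM_centered hW j t0) unlock /Rintegral => h.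
rewrite -[RHS]/(fine (Num.min s t * S i j)%:E) -h; congr fine.
apply: eq_integral => w _; congr EFin.
by change (W i s w * W j t w = (W i s w - 0) * (W j t w - 0)); rewrite !subr0.
Qed.

Lemma process_sbm i : scaled_BM P process_space 1 (W i).
Proof.
have [_ _ S1] := CBM_correlation hW.
split; first by move=> t; exact: process_space_W.
- by move=> s t s0 t0; rewrite process_cov // S1 mulr1 mul1r.
- by move=> w; exact: (CBM_continuous hW).
Qed.

Lemma correlation_sym i j : S i j = S j i.
Proof. by have [hS _ _] := CBM_correlation hW; rewrite -{1}hS mxE. Qed.

Definition residual i j (t : R) w := W j t w - S i j * W i t w.

Lemma residual_sbm i j : scaled_BM P process_space (1 - S i j ^+ 2) (residual i j).
Proof.
have [_ _ S1] := CBM_correlation hW.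
have inW k t (t0 : 0 <= t) := process_space_W k t0.
split.
- move=> t t0; apply: (gsB gH); first exact: inW.
  by apply: (gsZ gH); exact: inW.
- move=> s t s0 t0; rewrite /residual.
  have hsi := inW i s s0; have hti := inW i t t0; have hsj := inW j s s0; have htj := inW j t t0.
  have hsi' := gsZ gH (S i j) hsi; have hti' := gsZ gH (S i j) hti.
  rewrite (gs_covBl gH) //; last exact: (gsB gH).
  rewrite !(gs_covBr gH) //.
  have Z (X Y : T -> R) a b : process_space X -> process_space Y ->
      \int[P]_w (a * X w * (b * Y w)) = a * b * \int[P]_w (X w * Y w).
    move=> hX hY; rewrite -RintegralZl //; last exact: (gs_integrableM gH).
    by apply: eq_Rintegral => w _; ring.
  have -> : \int[P]_w (W j s w * (S i j * W i t w)) = S i j * \int[P]_w (W j s w * W i t w).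
    rewrite -[S i j in RHS]mul1r -Z //.
    by apply: eq_Rintegral => w _; rewrite mul1r.
  have -> : \int[P]_w (S i j * W i s w * W j t w) = S i j * \int[P]_w (W i s w * W j t w).
    rewrite -[S i j in RHS]mulr1 -Z //.
    by apply: eq_Rintegral => w _; rewrite mul1r.
  rewrite Z // !process_cov // !S1 (correlation_sym j i); ring.
- move=> w x; apply: cvgB; first exact: (CBM_continuous hW).
  by apply: cvgMl_tmp; exact: (CBM_continuous hW).
Qed.

Variable q : R.
Hypothesis q0 : 0 < q.
Local Notation osc u B := [set w | oscillates q u (B ^~ w)].

(** Carries independence from covariances to range events: the grid representation only involves
    countably many values of [B]. *)
Lemma osc_sigma (U : set (T -> R)) (B : R -> T -> R) u :
  (forall t, 0 <= t -> U (B t)) -> (forall w, {within `[0, +oo[, continuous (B ^~ w)}) ->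
  <<s cylinder U >> (osc u B).
Proof.
move=> UB cB.
apply: (@measurable_oscillates R _ (g_sigma_algebraType (cylinder U)) B q u q0) => //.
by move=> t t0; apply: cylinder_measurable_fun; exact: UB.
Qed.

Lemma osc_residual_indep i j u u' :
  P (osc u (W i) `&` osc u' (residual i j)) = (P (osc u (W i)) * P (osc u' (residual i j)))%E.
Proof.
have [_ _ S1] := CBM_correlation hW.
have bV := residual_sbm i j; have bW := process_sbm i.
apply: (gaussian_space_indep gH
  (U := [set X | exists2 t, 0 <= t & X = W i t])
  (V := [set X | exists2 t, 0 <= t & X = residual i j t])).
- by move=> X [t t0 ->]; exact: (sbm_in bW).
- by move=> X [t t0 ->]; exact: (sbm_in bV).
- move=> X Y [s s0 ->] [t t0 ->]; rewrite /residual.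
  have hsi := process_space_W i s0; have hti := process_space_W i t0.
  have htj := process_space_W j t0.
  rewrite (gs_covBr gH) //; last exact: (gsZ gH).
  transitivity (\int[P]_w (W i s w * W j t w) - S i j * \int[P]_w (W i s w * W i t w)).
    congr (_ - _); rewrite -RintegralZl //; last exact: (gs_integrableM gH).
    by apply: eq_Rintegral => w _; ring.
  by rewrite !process_cov // S1 mulr1 mulrC subrr.
- by apply: osc_sigma; [move=> t t0; exists t|exact: (sbm_cont bW)].
- by apply: osc_sigma; [move=> t t0; exists t|exact: (sbm_cont bV)].
Qed.

(** If all increments of [f] are at most [c * u], those of x f are at most |x| c u in absolute
    value, and the rest of the increment of [g] falls to [g - x f]. *)
Lemma oscillates_sub (f g : R -> R) (x c u : R) : 0 <= c ->
  oscillates q u g -> oscillates q (c * u) f \/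
  oscillates q (u - `|x| * (c * u)) (fun t => g t - x * f t).
Proof.
move=> c0 [s si [t ti h]].
have [yes|no] := pselect (oscillates q (c * u) f); [by left|right].
exists s => //; exists t => //.
have h1 : f t - f s <= c * u.
  by rewrite leNgt; apply/negP => h'; apply: no; exists s => //; exists t.
have h2 : f s - f t <= c * u.
  by rewrite leNgt; apply/negP => h'; apply: no; exists t => //; exists s.
have h3 : x * (f t - f s) <= `|x| * (c * u).
  rewrite (le_trans (ler_norm _)) // normrM ler_wpM2l // ler_norml; apply/andP; split; lra.
have -> : g t - x * f t - (g s - x * f s) = (g t - g s) - x * (f t - f s) by ring.
lra.
Qed.

(* [W j] is [S i j] times [W i] plus [residual i j], which is independent of [W i]. *)
Lemma pair_range_le i j (c u : R) : 0 <= c ->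
  pr (osc u (W i) `&` osc u (W j)) <= pr (osc (c * u) (W i)) +
    pr (osc u (W i)) * pr (osc (u - `|S i j| * (c * u)) (residual i j)).
Proof.
move=> c0; have bV := residual_sbm i j; have bW k := process_sbm k.
have mW k u' := measurable_sbm_osc gH q0 u' (bW k).
have mV u' := measurable_sbm_osc gH q0 u' bV.
rewrite -(pr_indep (mW i u) (mV _) (osc_residual_indep i j u _)).
have mI := measurableI _ _ (mW i u) (mV (u - `|S i j| * (c * u))).
rewrite (le_trans _ (prU _ (mW i (c * u)) mI)) //; apply: pr_le.
- exact: measurableI.
- exact: measurableU.
move=> w [oi oj]; have [h|h] := oscillates_sub (W i ^~ w) (S i j) c0 oj; [by left|right].
by split.
Qed.

(** Within a Gaussian space, zero covariance with each component of the block gives independence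
    from the whole block, whatever the correlations inside it. The block is indexed by naturals with
    bound proofs to fit the recursion over naturals that uses it. *)
Lemma block_indep (m k : nat) u (hm : (m < n)%N) :
  (forall h (hh : (h < n)%N), (h < k)%N -> S (Ordinal hm) (Ordinal hh) = 0) ->
  P (osc u (W (Ordinal hm)) `&`
     [set w | forall h (hh : (h < n)%N), (h < k)%N -> ~ oscillates q u (W (Ordinal hh) ^~ w)]) =
  (P (osc u (W (Ordinal hm))) *
   P [set w | forall h (hh : (h < n)%N), (h < k)%N -> ~ oscillates q u (W (Ordinal hh) ^~ w)])%E.
Proof.
move=> S0; pose i := Ordinal hm.
pose V : set (T -> R) := [set X | exists j : 'I_n, (j < k)%N /\ exists2 t, 0 <= t & X = W j t].
apply: (gaussian_space_indep gH (U := [set X | exists2 t, 0 <= t & X = W i t]) (V := V)).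
- by move=> X [t t0 ->]; exact: process_space_W.
- by move=> X [j [_ [t t0 ->]]]; exact: process_space_W.
- move=> X Y [s s0 ->] [[j jn] [/= jk [t t0 ->]]].
  by rewrite process_cov // S0 // mulr0.
- by apply: osc_sigma; [move=> t t0; exists t|exact: (sbm_cont (process_sbm i))].
- pose TV := g_sigma_algebraType (cylinder V).
  rewrite (_ : [set w | _] = [set w : TV | forall h, (h < k)%N ->
      (~` [set w | exists hh : (h < n)%N, oscillates q u (W (Ordinal hh) ^~ w)]) w]).
    apply: (@measurable_forall _ TV) => h hk; apply: measurableC.
    have [hn|hn] := pselect (h < n)%N; last first.
      rewrite (_ : [set w | _] = set0) //.
      by apply/seteqP; split => // w [hh]; case: (hn hh).
    rewrite (_ : [set w | _] = osc u (W (Ordinal hn))).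
      apply: osc_sigma; last exact: (sbm_cont (process_sbm _)).
      by move=> t t0; exists (Ordinal hn); split => //; exists t.
    apply/seteqP; split => w /=; last by exists hn.
    by move=> [hh]; rewrite (bool_irrelevance hh hn).
  apply/seteqP; split => w /= h.
    by move=> k' k'k [hh]; exact: h.
  by move=> k' hh k'k o; apply: (h k' k'k); exists hh.
Qed.

End process_space.

(** * The exponent kappa *)

Section exponent.
Variable R : realType.
Implicit Types rho k c x : R.

(** The equation (1 - rho^2)(1 + k^2) = 2 k is quadratic in k with product of roots 1 and reduced
    discriminant rho^2 (2 - rho^2); this is its root in (0, 1]. *)
Definition kappa rho := (1 - rho * Num.sqrt (2 - rho ^+ 2)) / (1 - rho ^+ 2).

(* With [z := rho * sqrt (2 - rho ^+ 2)] one has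
   [1 - z ^+ 2 = (1 - rho ^+ 2) ^+ 2]. *)
Lemma kappaP rho : 0 <= rho < 1 ->
  0 < kappa rho <= 1 /\ (1 - rho ^+ 2) * (1 + kappa rho ^+ 2) = 2 * kappa rho.
Proof.
move=> /andP[r0 r1]; rewrite /kappa.
have d0 : 0 < 1 - rho ^+ 2 by nra.
have s0 : 0 <= 2 - rho ^+ 2 by nra.
pose z := rho * Num.sqrt (2 - rho ^+ 2); rewrite -/z.
have z0 : 0 <= z by rewrite mulr_ge0 // sqrtr_ge0.
have z2 : z ^+ 2 = rho ^+ 2 * (2 - rho ^+ 2) by rewrite exprMn sqr_sqrtr.
move: z0 z2; move: z => z z0 z2.
have z1 : z < 1.
  rewrite -(@ltr_pXn2r _ 2) ?nnegrE // expr1n z2.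
  by rewrite -subr_gt0 (_ : 1 - _ = (1 - rho ^+ 2) ^+ 2); [rewrite exprn_gt0|ring].
split; last first.
  have dn : 1 - rho ^+ 2 != 0 by rewrite gt_eqF.
  apply: (mulIf dn).
  rewrite expr_div_n mulrAC mulrDr mulr1 mulrCA [in RHS]mulrA mulfVK // -mulrA.
  rewrite -expr2 mulrA [X in _ + X](_ : _ = (1 - z) ^+ 2); last by field.
  have -> : (1 - rho ^+ 2) ^+ 2 = 1 - z ^+ 2 by rewrite z2; ring.
  by ring.
apply/andP; split; first by apply: divr_gt0 => //; rewrite subr_gt0.
rewrite ler_pdivrMr // mul1r lerD2l lerN2.
rewrite -(@ler_pXn2r _ 2) ?nnegrE ?sqr_ge0 // z2 expr2 ler_wpM2l ?sqr_ge0 //.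
by lra.
Qed.

(** Bounds below by k^2 the exponent (1 - x c)^2 / (1 - x^2) of a residual range above (1 - x c) u,
    uniformly in x <= rho. The difference of the two sides is quadratic in x and, since rho (c^2 +
    k^2) <= c, decreasing on [0, rho], so x = rho is the worst case. *)
Lemma kappa_pair rho k c x : 0 <= rho < 1 -> 0 < k <= 1 ->
  (1 - rho ^+ 2) * (1 + k ^+ 2) = 2 * k -> 0 <= c -> c ^+ 2 = 1 + k ^+ 2 ->
  0 <= x <= rho -> 0 < 1 - x * c /\ k ^+ 2 * (1 - x ^+ 2) <= (1 - x * c) ^+ 2.
Proof.
move=> /andP[rho0 rho1] /andP[k0 k1] kE c0 c2 /andP[x0 xrho].
pose r := Num.sqrt (1 - rho ^+ 2).
have d0 : 0 < 1 - rho ^+ 2 by nra.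
have r0 : 0 < r by rewrite sqrtr_gt0.
have r2 : r ^+ 2 = 1 - rho ^+ 2 by rewrite sqr_sqrtr // ltW.
have r1 : r <= 1 by rewrite -(@ler_pXn2r _ 2) ?nnegrE ?(ltW r0) // expr1n r2; nra.
move: r0 r2 r1; move: r => r r0 r2 r1; rewrite -r2 in kE.
have kr : k <= r.
  rewrite -(@ler_pXn2r _ 2) ?nnegrE ?(ltW r0) ?(ltW k0) //.
  have : k * (1 + k ^+ 2) <= r ^+ 2 * (1 + k ^+ 2) by rewrite kE; nra.
  rewrite ler_pM2r; last by nra.
  by nra.
have krlt : 0 <= 1 - k * r by nra.
(* [(1 - k r)^2 - (rho c)^2 = r^2 (1 + 2 k^2) - k^2 - 2 k r], and [2 r <= 1 + r^2]
   bounds this from below by a positive multiple of [(1 - k)^3]. *)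
have key : rho * c <= 1 - k * r.
  rewrite -(@ler_pXn2r _ 2) ?nnegrE ?mulr_ge0 // exprMn c2.
  have h : k + k ^+ 2 <= r ^+ 2 * (1 + 2 * k ^+ 2 - k).
    have p : 0 < 1 + k ^+ 2 by nra.
    rewrite -(ler_pM2r p) mulrAC kE.
    have : 0 <= (1 - k) ^+ 3 * k by rewrite mulr_ge0 ?exprn_ge0 ?subr_ge0 ?(ltW k0).
    rewrite -[in X in _ -> X]subr_ge0; congr (0 <= _); ring.
  have -> : rho ^+ 2 = 1 - r ^+ 2 by rewrite r2; ring.
  have := sqr_ge0 (1 - r); nra.
have kr0 : 0 < k * r by rewrite mulr_gt0.
have c1 : 1 <= c by rewrite -(@ler_pXn2r _ 2) ?nnegrE // expr1n c2; nra.
have xc : x * c <= rho * c by rewrite ler_wpM2r.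
split; first by lra.
have fr : k ^+ 2 * r ^+ 2 <= (1 - rho * c) ^+ 2.
  by rewrite -exprMn ler_pXn2r ?nnegrE ?mulr_ge0 ?(ltW k0) ?(ltW r0) //; lra.
have cc : rho * (c ^+ 2 + k ^+ 2) <= c.
  have : rho * c * c <= (1 - k * r) * c by rewrite ler_wpM2r.
  have : rho * k <= c * r by rewrite ler_pM ?(ltW k0) //; lra.
  move=> h1 h2; have : rho * k * k <= c * r * k by rewrite ler_wpM2r // ltW.
  by rewrite mulrDr; lra.
have : 0 <= (rho - x) * (2 * c - (c ^+ 2 + k ^+ 2) * (x + rho)).
  rewrite mulr_ge0 ?subr_ge0 //.
  have : (c ^+ 2 + k ^+ 2) * (x + rho) <= (c ^+ 2 + k ^+ 2) * (rho + rho).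
    by rewrite ler_wpM2l ?addr_ge0 ?sqr_ge0 // lerD2r.
  by move: cc; rewrite (mulrC rho); nra.
have -> : (rho - x) * (2 * c - (c ^+ 2 + k ^+ 2) * (x + rho)) =
  ((1 - x * c) ^+ 2 - k ^+ 2 * (1 - x ^+ 2)) - ((1 - rho * c) ^+ 2 - k ^+ 2 * (1 - rho ^+ 2)).
  by ring.
by rewrite -r2; lra.
Qed.

(** The peak of the density is at most 1 / s, so the prefactor in Mills' bound is at most s / y,
    hence at most 1 beyond one standard deviation. *)
Lemma normal_tail_exp (s y : R) : 0 < s -> s <= y ->
  fine (normal_prob 0 s `]y, +oo[) <= expR (- (y ^+ 2 / (2 * s ^+ 2))).
Proof.
move=> s0 sy; have sn : s != 0 by rewrite gt_eqF.
have y0 : 0 < y by exact: lt_le_trans sy.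
rewrite -lee_fin fineK ?fin_num_measure // (le_trans (mills_ub s0 y0)) // lee_fin.
rewrite normal_pdfN0 // subr0 mulNr -mulr_natl; set e := expR _.
have p1 : normal_peak s <= s^-1.
  rewrite /normal_peak lef_pV2 ?posrE // ?sqrtr_gt0 ?mulrn_wgt0 ?mulr_gt0 ?pi_gt0 ?exprn_gt0 //.
  rewrite -[leLHS]ger0_norm ?(ltW s0) // -sqrtr_sqr ler_wsqrtr //.
  by have := pi_ge2 R; have := exprn_gt0 2 s0; rewrite -mulr_natr; nra.
rewrite ler_pdivrMr // mulrA mulrC ler_wpM2l ?expR_ge0 //.
apply: le_trans sy; rewrite (le_trans (ler_wpM2l (sqr_ge0 s) p1)) //.
by rewrite expr2 mulfK.
Qed.

End exponent.

Section range_bounds.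
Context d (T : measurableType d) (R : realType) (P : probability T R).
Local Notation pr A := (fine (P A)).
Variable q : R.
Hypothesis q0 : 0 < q.
Local Notation osc u B := [set w | oscillates q u (B ^~ w)].

Lemma sbm_range_exp (H : set (T -> R)) v B y : gaussian_space P H -> 0 < v ->
  scaled_BM P H v B -> Num.sqrt (v * q) <= y ->
  pr (osc y B) <= 8 * expR (- (y ^+ 2 / (2 * (v * q)))).
Proof.
move=> gH v0 bB hy; have vq : 0 < v * q by rewrite mulr_gt0.
rewrite (le_trans (sbm_range_ub gH q0 y bB)) // ler_wpM2l //.
rewrite (sbm_tail gH v0 y bB) // subr0.
have s0 : 0 < Num.sqrt (v * q) by rewrite sqrtr_gt0.
by rewrite (le_trans (normal_tail_exp s0 hy)) // sqr_sqrtr // ltW.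
Qed.

(** The lower bound on [u] puts the three thresholds u, c u and (1 - x c) u beyond one standard
    deviation of their processes, the last one by [kappa_pair]. The constant is 72 = 8 + 8 * 8: one
    range bound plus a product of two. *)
Lemma pair_range_exp (n : nat) (S : 'M[R]_n) (W : 'I_n -> R -> T -> R) (rho u : R) i j :
  is_correlated_BM P S W -> 0 <= rho < 1 -> `|S i j| <= rho ->
  Num.sqrt q <= kappa rho * u ->
  pr (osc u (W i) `&` osc u (W j)) <=
    72 * expR (- ((1 + kappa rho ^+ 2) * (u ^+ 2 / (2 * q)))).
Proof.
move=> hW hrho hS hu.
have [k01 kE] := kappaP hrho; set k := kappa rho in hu k01 kE *.
have /andP[k0 k1] := k01.
pose c := Num.sqrt (1 + k ^+ 2).
have k2 : 0 <= 1 + k ^+ 2 by rewrite addr_ge0 ?sqr_ge0.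
have c0 : 0 <= c by rewrite sqrtr_ge0.
have c2 : c ^+ 2 = 1 + k ^+ 2 by rewrite sqr_sqrtr.
have c1 : 1 <= c by rewrite -(@ler_pXn2r _ 2) ?nnegrE // expr1n c2 lerDl sqr_ge0.
set x := `|S i j| in hS *.
have x0 : 0 <= x by exact: normr_ge0.
have xr : 0 <= x <= rho by rewrite x0.
have [xc hx] := kappa_pair hrho k01 kE c0 c2 xr.
have /andP[rho0 rho1] := hrho.
have v0 : 0 < 1 - S i j ^+ 2 by rewrite -(@real_normK _ (S i j)) ?num_real // -/x; nra.
have xE : S i j ^+ 2 = x ^+ 2 by rewrite real_normK // num_real.
have sq0 : 0 < Num.sqrt q by rewrite sqrtr_gt0.
have u0 : 0 < u by have := lt_le_trans sq0 hu; rewrite pmulr_rgt0.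
have gH := process_space_gaussian hW.
have su : Num.sqrt (1 * q) <= u.
  by rewrite mul1r (le_trans hu) // ler_piMl // ltW.
have scu : Num.sqrt (1 * q) <= c * u by rewrite (le_trans su) // ler_peMl // ltW.
have sv : Num.sqrt ((1 - S i j ^+ 2) * q) <= u - x * (c * u).
  have -> : u - x * (c * u) = (1 - x * c) * u by ring.
  have p0 : 0 <= (1 - x * c) * u by rewrite mulr_ge0 // ltW.
  rewrite -[leRHS]ger0_norm // -sqrtr_sqr ler_wsqrtr //.
  rewrite exprMn xE.
  have h1 : q <= k ^+ 2 * u ^+ 2.
    rewrite -exprMn -[leLHS]sqr_sqrtr ?(ltW q0) // ler_pXn2r ?nnegrE ?(ltW sq0) //.
    by rewrite mulr_ge0 // ltW.
  have h2 : k ^+ 2 * (1 - x ^+ 2) * u ^+ 2 <= (1 - x * c) ^+ 2 * u ^+ 2.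
    by rewrite ler_wpM2r ?sqr_ge0.
  rewrite (le_trans _ h2) // mulrAC mulrC ler_wpM2r //.
  by rewrite -xE ltW.
have b1 := sbm_range_exp gH ltr01 (process_sbm hW i) scu.
have b2 := sbm_range_exp gH ltr01 (process_sbm hW i) su.
have b3 := sbm_range_exp gH v0 (residual_sbm hW i j) sv.
rewrite (le_trans (pair_range_le hW q0 i j u c0)) // -/x.
set y := u ^+ 2 / (2 * q).
have e1 : expR (- ((c * u) ^+ 2 / (2 * (1 * q)))) = expR (- ((1 + k ^+ 2) * y)).
  by congr (expR (- _)); rewrite exprMn c2 (mul1r q) /y -mulrA.
have e3 : expR (- ((u - x * (c * u)) ^+ 2 / (2 * ((1 - S i j ^+ 2) * q)))) <=
    expR (- (k ^+ 2 * y)).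
  rewrite ler_expR lerN2 /y xE.
  have -> : u - x * (c * u) = (1 - x * c) * u by ring.
  have vx : 0 < 1 - x ^+ 2 by rewrite -xE.
  have -> : ((1 - x * c) * u) ^+ 2 / (2 * ((1 - x ^+ 2) * q)) =
      (1 - x * c) ^+ 2 / (1 - x ^+ 2) * (u ^+ 2 / (2 * q)).
    by field; rewrite !gt_eqF.
  rewrite ler_wpM2r //; first by rewrite divr_ge0 ?sqr_ge0 // mulr_ge0 // ltW.
  by rewrite ler_pdivlMr.
rewrite e1 in b1; rewrite (mul1r q) -/y in b2.
have := pr_ge0 P (osc u (W i)); have := pr_ge0 P (osc (u - x * (c * u)) (residual S W i j)).
move=> p2 p1.
have b3' := le_trans b3 (ler_wpM2l (ltW (ltr0Sn R 7)) e3).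
rewrite (le_trans (lerD b1 (ler_pM p1 p2 b2 b3'))) //.
rewrite mulrACA -expRD (_ : - y + - (k ^+ 2 * y) = - ((1 + k ^+ 2) * y)); last by ring.
by rewrite -mulrDl; rewrite ler_wpM2r ?expR_ge0 //; lra.
Qed.

End range_bounds.

(** * From single and joint exceedances to the absence of any *)

Section no_exceedance.
Context d (T : measurableType d) (R : realType) (P : probability T R).
Local Notation pr A := (fine (P A)).
Variables (A : nat -> set T) (n l : nat) (pl pu p2 : R).
Hypothesis mA : forall h, measurable (A h).
Let none k := [set w | forall h, (h < k)%N -> ~ A h w].
Hypothesis pA : forall h, (h < n)%N -> pl <= pr (A h) <= pu.
Hypothesis pAA : forall h m, (h < m < n)%N -> pr (A m `&` A h) <= p2.
Hypothesis indepA : forall m, (m < n)%N ->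
  P (A m `&` none (m - l)) = (P (A m) * P (none (m - l)))%E.
Hypotheses (pl0 : 0 <= pl) (pu1 : pu <= 1) (p20 : 0 <= p2).

Let mnone k : measurable (none k).
Proof.
rewrite (_ : none k = [set w | forall h, (h < k)%N -> (~` A h) w]) //.
by apply: measurable_forall => h _; exact: measurableC.
Qed.

Let noneS k : none k.+1 = none k `\` A k.
Proof.
apply/seteqP; split => w /=.
  by move=> h; split; [move=> i ik; apply: h; exact: ltnW|exact: h].
move=> [h Ak] i; rewrite ltnS leq_eqVlt => /orP[/eqP -> //|]; exact: h.
Qed.

(** Each of the last [l] constraints costs at most [c] when dropped. If [l] exceeds [m], truncated
    subtraction drops all [m] of them, which costs even less. *)
Let none_window m (D : set T) (c : R) : measurable D -> 0 <= c ->
  (forall h, (h < m)%N -> pr (D `&` A h) <= c) ->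
  pr (D `&` none (m - l)) <= pr (D `&` none m) + l%:R * c.
Proof.
move=> mD c0 hc.
have mI k := measurableI _ _ mD (mnone k).
have step k : (k < m)%N -> pr (D `&` none k) <= pr (D `&` none k.+1) + c.
  move=> km.
  have mDA := measurableI _ _ mD (mA k).
  rewrite (le_trans _ (lerD (lexx _) (hc k km))) //.
  rewrite (le_trans _ (prU P (mI k.+1) mDA)) //; apply: pr_le => //; first exact: measurableU.
  move=> w [Dw nw]; have [Ak|nAk] := pselect (A k w); [by right|left].
  by split => //; rewrite noneS.
have iter_step j : (j <= m)%N -> pr (D `&` none (m - j)) <= pr (D `&` none m) + j%:R * c.
  elim: j => [|j IH] jm; first by rewrite subn0 mul0r addr0.
  have lt : (m - j.+1 < m)%N by rewrite ltn_subrL /= (leq_ltn_trans _ jm).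
  rewrite (le_trans (step _ lt)) // subnSK // -natr1 mulrDl mul1r addrA lerD2r.
  by apply: IH; exact: ltnW.
have [lm|ml] := leqP l m; first exact: iter_step.
have -> : (m - l = m - m)%N by rewrite subnn; apply/eqP; rewrite subn_eq0 ltnW.
rewrite (le_trans (iter_step m (leqnn m))) // lerD2l.
by rewrite ler_wpM2r ?ler_nat // ltnW.
Qed.

Let eps := l%:R * (p2 + pu ^+ 2).

(** [none_window] enters with [D = A m], at the price l p2, and with [D = setT], at the price l pu,
    to which the independent [A m] contributes a second factor [pu]. *)
Let none_step m : (m < n)%N ->
  (1 - pu) * pr (none m) - eps <= pr (none m.+1) <= (1 - pl) * pr (none m) + eps.
Proof.
move=> mn; have /andP[plm pum] := pA mn.
have mI k := measurableI _ _ (mA m) (mnone k).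
have pu0 : 0 <= pu by rewrite (le_trans pl0) // (le_trans plm).
have F0 := pr_ge0 P (none m).
have Fm : pr (none m.+1) = pr (none m) - pr (A m `&` none m).
  by rewrite noneS measureD // ?ltey_eq ?fin_num_measure // setIC fineB ?fin_num_measure //.
have w1 : pr (A m `&` none (m - l)) <= pr (A m `&` none m) + l%:R * p2.
  by apply: none_window => // h hm; apply: pAA; rewrite hm.
have w2 : pr (none (m - l)) <= pr (none m) + l%:R * pu.
  have := @none_window m setT pu measurableT pu0; rewrite !setTI; apply.
  by move=> h hm; rewrite setTI; have /andP[] := pA (ltn_trans hm mn).
have sub : none m `<=` none (m - l).
  by move=> w h k hk; apply: h; rewrite (leq_trans hk) // leq_subr.
have w3 : pr (none m) <= pr (none (m - l)) by exact: pr_le.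
have w4 : pr (A m `&` none m) <= pr (A m `&` none (m - l)) by apply: pr_le => //; exact: setIS.
have ind : pr (A m `&` none (m - l)) = pr (A m) * pr (none (m - l)).
  by apply: pr_indep => //; exact: indepA.
have l0 : (0 : R) <= l%:R by exact: ler0n.
rewrite Fm /eps; rewrite ind in w1 w4.
have v1 : pr (A m) * pr (none m) <= pr (A m) * pr (none (m - l)) by rewrite ler_wpM2l ?pr_ge0.
have v2 : pr (A m) * pr (none (m - l)) <= pr (A m) * pr (none m) + l%:R * pu ^+ 2.
  rewrite (le_trans (ler_wpM2l (pr_ge0 _ _) w2)) // mulrDr lerD2l mulrCA expr2.
  by rewrite ler_wpM2l // ler_wpM2r.
have v3 : pl * pr (none m) <= pr (A m) * pr (none m) by rewrite ler_wpM2r.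
have v4 : pr (A m) * pr (none m) <= pu * pr (none m) by rewrite ler_wpM2r.
have e1 : 0 <= l%:R * p2 by rewrite mulr_ge0.
have e2 : 0 <= l%:R * pu ^+ 2 by rewrite mulr_ge0 ?sqr_ge0.
move: w1 w4 v1 v2 v3 v4 e1 e2; rewrite !mulrDr !mulrBl !mul1r.
set a1 := pr (A m `&` _); set a2 := pr (A m) * _; set a3 := pr (A m) * _.
set a4 := l%:R * p2; set a5 := l%:R * _; set a6 := pl * _; set a7 := pu * _; set a8 := pr _.
move: a1 a2 a3 a4 a5 a6 a7 a8 => /=.
by move=> a1 a2 a3 a4 a5 a6 a7 a8 *; apply/andP; split; lra.
Qed.

(** The factors 1 - pl and 1 - pu of the recursion lie in [0, 1], so its errors add up without
    amplification. *)
Lemma no_exceedance_bounds m : (m <= n)%N ->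
  (1 - pu) ^+ m - m%:R * eps <=
    pr [set w | forall h, (h < m)%N -> ~ A h w] <= (1 - pl) ^+ m + m%:R * eps.
Proof.
have e0 : 0 <= eps by rewrite mulr_ge0 // addr_ge0 // sqr_ge0.
elim: m => [|m IH] mn.
  have -> : [set w | forall h, (h < 0)%N -> ~ A h w] = setT by apply/seteqP; split.
  by rewrite probability_setT /= !mul0r !expr0 subr0 addr0 lexx.
have /andP[plm pum] := pA mn.
have /andP[h1 h2] := IH (ltnW mn); have /andP[g1 g2] := none_step mn.
have q1 : 0 <= 1 - pu by rewrite subr_ge0.
have pp := le_trans plm pum.
have q2 : 0 <= 1 - pl by rewrite subr_ge0 (le_trans pp).
have pu0 : 0 <= pu by exact: le_trans pp.
have m0 : 0 <= m%:R * eps by rewrite mulr_ge0.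
rewrite -!natr1 !mulrDl !mul1r !exprS; apply/andP; split.
- apply: le_trans g1; rewrite opprD addrA lerD2r.
  rewrite (le_trans _ (ler_wpM2l q1 h1)) // mulrBr lerD2l lerN2.
  by rewrite ler_piMl // gerBl.
- apply: (le_trans g2); rewrite addrA lerD2r.
  rewrite (le_trans (ler_wpM2l q2 h2)) // mulrDr lerD2l.
  by rewrite ler_piMl // gerBl.
Qed.

End no_exceedance.

(** * Asymptotics of the level *)

Section normal_tail.
Variable R : realType.
Implicit Types (s u y c : R).

Definition normal_tail s u := fine (normal_prob 0 s `]u, +oo[).

Lemma normal_tail_ge0 s u : 0 <= normal_tail s u.
Proof. by rewrite fine_ge0. Qed.

(** Right continuity of the tail, from continuity of measures along increasing rays. It removes the
    slack [e] that [sbm_range_lb] retains. *)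
Lemma normal_tail_le_right s u c :
  (forall e, 0 < e -> normal_tail s (u + e) <= c) -> normal_tail s u <= c.
Proof.
move=> h; pose F n := `](u + n.+1%:R^-1), +oo[%classic : set R.
have mF n : measurable (F n) by exact: measurable_itv.
have FE : \bigcup_n F n = `]u, +oo[%classic.
  apply/seteqP; split => x /=.
    by move=> [n _]; rewrite /F /= !in_itv /= !andbT; apply: le_lt_trans; rewrite lerDl invr_ge0.
  rewrite in_itv /= andbT => ux; exists (Num.truncn (x - u)^-1) => //.
  rewrite /F /= in_itv /= andbT -ltrBrDl.
  by rewrite invf_plt ?posrE ?subr_gt0 // truncnS_gt.
have := @nondecreasing_cvg_mu _ _ _ (normal_prob 0 s) F mF (bigcupT_measurable _ mF) _.
rewrite FE => cF.
have {}cF : normal_prob 0 s (F n) @[n --> \oo] --> normal_prob 0 s `]u, +oo[.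
  apply: cF => m n mn; apply/subsetPset => x; rewrite /F /= !in_itv /= !andbT.
  by apply: le_lt_trans; rewrite lerD2l lef_pV2 ?posrE // ler_nat.
have cF' : (fine \o (normal_prob 0 s \o F)) n @[n --> \oo] --> normal_tail s u.
  by apply: fine_cvg; rewrite fineK; [exact: cF|rewrite fin_num_measure].
rewrite -(cvg_lim _ cF') //; apply: limr_le; first by apply/cvg_ex; eexists; exact: cF'.
by near=> n; apply: h; rewrite invr_gt0.
Unshelve. all: by end_near. Qed.

(** The leading term of the normal tail, with the threshold in units of the standard deviation and
    hence free of [s]. *)
Definition mills y := expR (- (y ^+ 2 / 2)) / (y * Num.sqrt (2 * pi)).

Lemma normal_tail_mills s y : 0 < s -> 0 < y ->
  mills y / (1 + y ^- 2) <= normal_tail s (s * y) <= mills y.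
Proof.
move=> s0 y0; have sn : s != 0 by rewrite gt_eqF.
have sy0 : 0 < s * y by rewrite mulr_gt0.
have yn : y != 0 by rewrite gt_eqF.
have pk : s * normal_peak s = (Num.sqrt (2 * pi))^-1.
  rewrite /normal_peak -mulrnAr sqrtrM ?sqr_ge0 // sqrtr_sqr ger0_norm ?(ltW s0) //.
  by rewrite invfM mulrA mulfV // mul1r mulr_natl.
have mE : s ^+ 2 * normal_pdf 0 s (s * y) / (s * y) = mills y.
  rewrite normal_pdfN0 // subr0 /mills (invfM y) -pk.
  have -> : - (s * y) ^+ 2 / (s ^+ 2 *+ 2) = - (y ^+ 2 / 2) by field; rewrite sn.
  move: (expR _) (normal_peak _) => e p.
  by field; rewrite sn yn.
rewrite /normal_tail; apply/andP; split; rewrite -lee_fin fineK ?fin_num_measure //.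
  apply: le_trans (mills_lb s0 sy0); rewrite lee_fin -mE.
  by rewrite exprMn (invfM (s ^+ 2)) (mulrA (s ^+ 2)) mulfV ?expf_neq0 // mul1r.
by rewrite -mE mills_ub.
Qed.

End normal_tail.

Section range_tail.
Context d (T : measurableType d) (R : realType) (P : probability T R).

Variable q : R.
Local Notation Q := (normal_tail (Num.sqrt q)).

Lemma sbm_range_tail (H : set (T -> R)) B (u : R) : gaussian_space P H -> 0 < q ->
  scaled_BM P H 1 B -> 0 <= u ->
  (4 * Q u - 8 * Q (2 * u)) / (2^-1 + 4 * Q u) <=
    fine (P [set w | oscillates q u (B ^~ w)]) <= 8 * Q u.
Proof.
move=> gH q0 bB u0.
have QE (v : R) : fine (P [set w | v < B q w - B 0 w]) = Q v.
  by rewrite (sbm_tail gH ltr01 v bB (lexx 0) q0) subr0 mul1r /normal_tail.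
have Q0 : 0 <= Q u := normal_tail_ge0 _ _.
apply/andP; split; last by have := sbm_range_ub gH q0 u bB; rewrite QE.
rewrite ler_pdivrMr; last by rewrite ltr_wpDr // mulr_ge0.
set p := fine _.
suff : Q u <= ((2^-1 + 4 * Q u) * p + 8 * Q (2 * u)) / 4.
  by rewrite ler_pdivlMr // (mulrC p) (mulrC (Q u) 4) lerBlDr.
apply: normal_tail_le_right => e e0; rewrite ler_pdivlMr // mulrC -lerBlDr.
by have := sbm_range_lb gH q0 ltr01 bB u0 e0; rewrite !QE.
Qed.

End range_tail.

(** * Limits of real sequences *)

Section limits.
Variable R : realType.
Implicit Types f g : nat -> R.

Lemma cvg_eq_near f g (a : R) : (\forall n \near \oo, f n = g n) ->
  f @ \oo --> a -> g @ \oo --> a.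
Proof. by move=> fg; apply: cvg_trans; exact: near_eq_cvg. Qed.

Lemma cvgy_sqrt f : f @ \oo --> +oo -> (fun n => Num.sqrt (f n)) @ \oo --> +oo.
Proof.
move=> /cvgryPge fy; apply/cvgryPge => A; near=> n.
rewrite (le_trans (ler_norm A)) // -sqrtr_sqr ler_wsqrtr //.
by near: n; exact: fy.
Unshelve. all: by end_near. Qed.

Lemma cvgy_inv f : f @ \oo --> +oo -> (fun n => (f n)^-1) @ \oo --> (0 : R).
Proof.
by move=> fy; apply/gtr0_cvgV0 => //; move/cvgryPgt : fy => /(_ 0).
Qed.

Lemma cvgy_ln f : f @ \oo --> +oo -> (fun n => ln (f n)) @ \oo --> +oo.
Proof.
move=> /cvgryPge fy; apply/cvgryPge => A; near=> n.
have fn : expR A <= f n by near: n; exact: fy.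
by rewrite -[A]expRK ler_ln ?posrE ?expR_gt0 // (lt_le_trans _ fn) ?expR_gt0.
Unshelve. all: by end_near. Qed.

Lemma cvg_expR f (a : R) : f @ \oo --> a -> (fun n => expR (f n)) @ \oo --> expR a.
Proof. by move=> fa; apply: (cvg_comp _ _ fa); exact: continuous_expR. Qed.

(** With m the fourth root of f, the quotient is 4 ln m / m^2, at most 4 / m. *)
Lemma cvg_ln_div_sqrt f : f @ \oo --> +oo ->
  (fun n => ln (f n) / Num.sqrt (f n)) @ \oo --> (0 : R).
Proof.
move=> fy; have sy := cvgy_sqrt (cvgy_sqrt fy).
have h4 : (fun n => 4 * (Num.sqrt (Num.sqrt (f n)))^-1) @ \oo --> (0 : R).
  by rewrite -(mulr0 4); apply: cvgM; [exact: cvg_cst|exact: cvgy_inv].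
apply: (@squeeze_cvgr _ _ _ _ (fun=> 0) _ _ _ _ (cvg_cst _) h4).
near=> n.
have f1 : 1 <= f n by near: n; move/cvgryPge : fy => /(_ 1).
have f0 : 0 < f n by exact: lt_le_trans f1.
set m := Num.sqrt (Num.sqrt (f n)).
have m0 : 0 < m by rewrite !sqrtr_gt0.
have m2 : Num.sqrt (f n) = m ^+ 2 by rewrite sqr_sqrtr.
have m4 : f n = m ^+ 4 by rewrite -[LHS](@sqr_sqrtr _ (f n)) ?(ltW f0) // m2 -exprM.
apply/andP; split; first by rewrite divr_ge0 ?ln_ge0.
rewrite m2 m4 lnXn // ler_pdivrMr ?exprn_gt0 // expr2 mulrA mulfVK ?gt_eqF //.
by rewrite mulr_natl lerMn2r ltW // ln_sublinear.
Unshelve. all: by end_near. Qed.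

Lemma cvg0_natM f (a : R) : (fun n => n%:R * f n) @ \oo --> a -> f @ \oo --> (0 : R).
Proof.
move=> fa; have h : (fun n => n%:R^-1 * (n%:R * f n)) @ \oo --> (0 : R).
  rewrite [X in _ --> X](_ : 0 = 0 * a); last by rewrite mul0r.
  by apply: cvgM => //; apply: cvgy_inv; exact: cvgr_idn.
apply: cvg_eq_near h; near=> n.
rewrite mulKf // pnatr_eq0 -lt0n; near: n; exact: nbhs_infty_gt.
Unshelve. all: by end_near. Qed.

(* [1 - p] lies between [expR (- p / (1 - p))] and [expR (- p)]. *)
Lemma cvg_pow_1B f (a : R) : (fun n => n%:R * f n) @ \oo --> a ->
  (fun n => (1 - f n) ^+ n) @ \oo --> expR (- a).
Proof.
move=> fa; have f0 := cvg0_natM fa.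
have hu : (fun n => expR (- (n%:R * f n))) @ \oo --> expR (- a).
  by apply: cvg_expR; apply: cvgN.
have hl : (fun n => expR (- (n%:R * f n * (1 - f n)^-1))) @ \oo --> expR (- a).
  apply: cvg_expR; apply: cvgN; rewrite -[X in _ --> X]mulr1; apply: cvgM => //.
  rewrite -[X in _ --> X]invr1; apply: cvgV; first exact: oner_neq0.
  by rewrite -[X in _ --> X]subr0; apply: cvgB => //; exact: cvg_cst.
apply: (squeeze_cvgr _ hl hu); near=> n.
have fn : f n < 1 by near: n; apply: (cvgr_lt (0 : R)).
have p0 : 0 < 1 - f n by rewrite subr_gt0.
rewrite -(mulrA n%:R) -!(mulrN n%:R) !expRM_natl; apply/andP; split.
  rewrite lerXn2r ?nnegrE ?expR_ge0 ?(ltW p0) //.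
  rewrite expRN invf_ple ?posrE ?expR_gt0 //.
  rewrite (le_trans _ (expR_ge1Dx _)) // -[X in X <= _]div1r.
  by rewrite ler_pdivrMr // mulrDl mul1r mulfVK ?gt_eqF // subrK.
by rewrite lerXn2r ?nnegrE ?expR_ge0 ?(ltW p0) // (le_trans _ (expR_ge1Dx _)).
Unshelve. all: by end_near. Qed.

End limits.

Section level_asymptotics.
Variables (R : realType) (x : R).

Local Notation lam n := (ln n%:R : R).

(* The level [b_d + x / a_d] is [Num.sqrt q * level d]. *)
Definition level_shift n := x - (ln (lam n) - ln (16 / pi)) / 2.
Definition level n := Num.sqrt (2 * lam n) + level_shift n / Num.sqrt (2 * lam n).

(** Expanding the square, level^2 / 2 = ln n + shift + r^2 / 4, while level = sqrt (2 ln n) ratio.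
    As r tends to 0 and ratio to 1, Mills' expression at the level reduces to the contribution of
    the shift. *)
Let r n := level_shift n / Num.sqrt (lam n).
Let ratio n := 1 + r n * (Num.sqrt (lam n))^-1 / 2.

Lemma cvgy_lnn : (fun n => lam n) @ \oo --> +oo.
Proof. by apply: cvgy_ln; exact: cvgr_idn. Qed.

Let lam_gt0 : \forall n \near \oo, 0 < lam n.
Proof. by move/cvgryPgt : cvgy_lnn => /(_ 0). Qed.

Let s0_cvg : (fun n => (Num.sqrt (lam n))^-1) @ \oo --> (0 : R).
Proof. by apply: cvgy_inv; apply: cvgy_sqrt; exact: cvgy_lnn. Qed.

Let r_cvg : r @ \oo --> (0 : R).
Proof.
have -> : r = (fun n => (x + ln (16 / pi) / 2) * (Num.sqrt (lam n))^-1 -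
    2^-1 * (ln (lam n) / Num.sqrt (lam n))).
  apply/funext => n; rewrite /r /level_shift.
  by move: (Num.sqrt _)^-1 (ln (lam n)) (ln _) => s a b; field.
rewrite [X in _ --> X](_ : 0 = (x + ln (16 / pi) / 2) * 0 - 2^-1 * 0); last first.
  by rewrite !mulr0 subr0.
apply: cvgB; apply: cvgM; [exact: cvg_cst|exact: s0_cvg|exact: cvg_cst|].
exact/cvg_ln_div_sqrt/cvgy_lnn.
Qed.

Let rs_cvg : (fun n => r n * (Num.sqrt (lam n))^-1) @ \oo --> (0 : R).
Proof. by rewrite [X in _ --> X](_ : 0 = 0 * 0); [apply: cvgM|rewrite mulr0]. Qed.

Let ratio_cvg : ratio @ \oo --> (1 : R).
Proof.
rewrite [X in _ --> X](_ : 1 = 1 + 0 * 2^-1); last by rewrite mul0r addr0.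
by apply: cvgD; [exact: cvg_cst|apply: cvgM; [exact: rs_cvg|exact: cvg_cst]].
Qed.

Let shiftE n : 0 < lam n -> level_shift n = lam n * (r n * (Num.sqrt (lam n))^-1).
Proof.
move=> l0; have s0 : Num.sqrt (lam n) != 0 by rewrite gt_eqF // sqrtr_gt0.
by rewrite -{1}(sqr_sqrtr (ltW l0)) /r; move: (level_shift n) => w; field.
Qed.

Let levelE n : 0 < lam n -> level n = Num.sqrt (2 * lam n) * ratio n.
Proof.
move=> l0; rewrite /level shiftE // /ratio.
have s0 : Num.sqrt (2 * lam n) != 0 by rewrite gt_eqF // sqrtr_gt0 mulr_gt0.
have : lam n = Num.sqrt (2 * lam n) ^+ 2 / 2.
  by rewrite sqr_sqrtr ?mulr_ge0 ?(ltW l0) //; field.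
move: s0; move: (Num.sqrt (2 * _)) (r n * _) => a t a0.
by move: (lam n) => l ->; field.
Qed.

Let ratio_gt : \forall n \near \oo, 2^-1 < ratio n.
Proof. by apply: (cvgr_gt _ ratio_cvg); rewrite invf_lt1 // ltr1n. Qed.

Lemma cvgy_level : level @ \oo --> +oo.
Proof.
apply/cvgryPge => A; near=> n.
have l0 : 0 < lam n by near: n; exact: lam_gt0.
have A0 : 0 <= Num.max 0 A by rewrite le_max lexx.
rewrite levelE // (@le_trans _ _ (Num.max 0 A)) ?le_max ?lexx ?orbT //.
rewrite (@le_trans _ _ (Num.sqrt (2 * lam n) / 2)) //; last first.
  by rewrite ler_wpM2l ?sqrtr_ge0 // ltW //; near: n; exact: ratio_gt.
rewrite ler_pdivlMr // -[leLHS]ger0_norm ?mulr_ge0 // -sqrtr_sqr ler_wsqrtr //.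
rewrite -ler_pdivrMl //.
by near: n; move/cvgryPge : cvgy_lnn; apply.
Unshelve. all: by end_near. Qed.

Let level_sqr n : 0 < lam n -> level n ^+ 2 / 2 = lam n + level_shift n + r n ^+ 2 / 4.
Proof.
move=> l0; have s0 : Num.sqrt (lam n) != 0 by rewrite gt_eqF // sqrtr_gt0.
rewrite levelE // exprMn sqr_sqrtr ?mulr_ge0 ?(ltW l0) // shiftE // /ratio.
have -> : r n ^+ 2 / 4 = lam n * (r n / Num.sqrt (lam n)) ^+ 2 / 4.
  have := sqr_sqrtr (ltW l0); move: s0.
  by move: (Num.sqrt _) (r n) => a t a0 <-; field.
by move: (lam n) (Num.sqrt (lam n))^-1 (r n) => l b a; field.
Qed.

(** Explains the constants of the centering: sqrt (ln n) cancels the growth of the level in the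
    denominator of [mills], and sqrt pi / 4 cancels the remaining 8 / (sqrt 2 sqrt (2 pi)) = 4 /
    sqrt pi. *)
Let expR_shift n : 0 < lam n ->
  expR (- level_shift n) = expR (- x) * (Num.sqrt (lam n) * Num.sqrt pi / 4).
Proof.
move=> l0; have half (a : R) : 0 < a -> expR (ln a / 2) = Num.sqrt a.
  move=> a0; rewrite -[LHS]ger0_norm ?expR_ge0 // -sqrtr_sqr; congr Num.sqrt.
  by rewrite -expRM_natl mulrCA mulfV // mulr1 lnK.
have -> : - level_shift n = - x + (ln (lam n) / 2 - ln (16 / pi) / 2).
  by rewrite /level_shift; field.
rewrite !expRD (expRN (_ / 2)) !half ?divr_gt0 ?pi_gt0 // -mulrA; congr (_ * (_ * _)).
rewrite sqrtrM // sqrtrV ?pi_ge0 // invfM invrK (_ : 16 = 4 ^+ 2).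
  by rewrite sqrtr_sqr ger0_norm // mulrC.
by rewrite -natrX.
Qed.

Let mills_level n : (0 < n)%N -> 0 < lam n -> 0 < level n ->
  n%:R * (8 * mills (level n)) = expR (- x) * (ratio n)^-1 * expR (- (r n ^+ 2 / 4)).
Proof.
move=> n0 l0 z0; rewrite /mills level_sqr // (opprD (_ + _)) (opprD (lam n)) !expRD expR_shift //.
rewrite (expRN (lam n)) lnK ?posrE ?ltr0n //.
rewrite levelE // !(@sqrtrM R 2) // in z0 *.
have s2 : Num.sqrt 2 ^+ 2 = 2 :> R by rewrite sqr_sqrtr.
have : Num.sqrt 2 != 0 :> R by rewrite gt_eqF // sqrtr_gt0.
have : Num.sqrt (lam n) != 0 by rewrite gt_eqF // sqrtr_gt0.
have : Num.sqrt pi != 0 :> R by rewrite gt_eqF // sqrtr_gt0 pi_gt0.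
have : ratio n != 0 by apply: contraTneq z0 => ->; rewrite mulr0 ltxx.
have : n%:R != 0 :> R by rewrite pnatr_eq0 -lt0n.
move: s2; move: (Num.sqrt 2) (Num.sqrt (lam n)) (Num.sqrt pi) (ratio n) (expR _) (expR _).
move: (n%:R : R) => m a b c e f g a2 m0 e0 c0 b0 a0.
rewrite (_ : 8 = a ^+ 2 * 4); last by rewrite a2; ring.
by field; rewrite a0 b0 c0 e0 m0.
Qed.

Let cvg_level_mills : (fun n => n%:R * (8 * mills (level n))) @ \oo --> expR (- x).
Proof.
have h : (fun n => expR (- x) * (ratio n)^-1 * expR (- (r n ^+ 2 / 4))) @ \oo --> expR (- x).
  rewrite [X in _ --> X](_ : _ = expR (- x) * 1^-1 * expR (- (0 * 0 / 4))); last first.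
    by rewrite !mul0r oppr0 expR0 invr1 !mulr1.
  apply: cvgM; first apply: cvgM.
  - exact: cvg_cst.
  - by apply: cvgV; [exact: oner_neq0|exact: ratio_cvg].
  apply: cvg_expR; apply: cvgN; apply: cvgM; last exact: cvg_cst.
  by under eq_cvg do rewrite expr2; apply: cvgM.
apply: cvg_eq_near h; near=> n; rewrite mills_level //.
- by near: n; exact: nbhs_infty_gt.
- by near: n; exact: lam_gt0.
- by near: n; move/cvgryPgt : cvgy_level; exact.
Unshelve. all: by end_near. Qed.

(** As level^2 / 2 is ln n (1 + o(1)), the product is at most n to the power Delta - k + o(1). With
    [c] half the gap k - Delta, it is eventually below n^(-c), hence below 1 / (c ln n). *)
Lemma cvg_band_error (Delta k : R) (l : nat -> R) : 0 <= k -> Delta < k ->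
  (\forall n \near \oo, 0 <= l n <= n%:R `^ Delta) ->
  (fun n => n%:R * (l n * expR (- ((1 + k) * (level n ^+ 2 / 2))))) @ \oo --> (0 : R).
Proof.
move=> k0 Dk hl; pose c := (k - Delta) / 2.
have c0 : 0 < c by rewrite divr_gt0 ?subr_gt0.
have hh : (fun n => c^-1 * (lam n)^-1) @ \oo --> (0 : R).
  rewrite [X in _ --> X](_ : 0 = c^-1 * 0); last by rewrite mulr0.
  by apply: cvgM; [exact: cvg_cst|apply: cvgy_inv; exact: cvgy_lnn].
have gap : (fun n => (k - Delta) + (1 + k) * (r n * (Num.sqrt (lam n))^-1)) @ \oo -->
    k - Delta.
  rewrite [X in _ --> X](_ : _ = k - Delta + (1 + k) * 0); last by rewrite mulr0 addr0.
  by apply: cvgD; [exact: cvg_cst|apply: cvgM; [exact: cvg_cst|exact: rs_cvg]].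
apply: (squeeze_cvgr _ (cvg_cst 0) hh); near=> n.
have n0 : (0 < n)%N by near: n; exact: nbhs_infty_gt.
have l0 : 0 < lam n by near: n; exact: lam_gt0.
have /andP[ln0 lnD] : 0 <= l n <= n%:R `^ Delta by near: n.
have g : c < k - Delta + (1 + k) * (r n * (Num.sqrt (lam n))^-1).
  near: n; apply: (cvgr_gt _ gap); rewrite /c ltr_pdivrMr // ltr_pMr ?ltr1n //.
  by rewrite subr_gt0.
rewrite !mulr_ge0 ?expR_ge0 //= -invfM.
apply: le_trans (expRN_le_inv (mulr_gt0 c0 l0)).
rewrite (le_trans (ler_wpM2l (ler0n _ n) (ler_wpM2r (expR_ge0 _) lnD))) //.
have nn : n%:R != 0 :> R by rewrite pnatr_eq0 -lt0n.
rewrite /powR (negbTE nn) -expRD -[X in X * _](@lnK _ n%:R) ?posrE ?ltr0n // -expRD.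
rewrite ler_expR level_sqr // shiftE //.
have r2 : 0 <= r n ^+ 2 / 4 by rewrite divr_ge0 ?sqr_ge0.
move: g r2 l0 k0 ; set t := r n * _; move: t (r n ^+ 2 / 4) (lam n) => t b e.
move=> g b0 e0 k0; rewrite mulrDr opprD.
have : c * e <= (k - Delta + (1 + k) * t) * e by rewrite ler_wpM2r ?(ltW e0) // ltW.
have : 0 <= (1 + k) * b by rewrite mulr_ge0 // addr_ge0.
by move: ((1 + k) * b) => bb; lra.
Unshelve. all: by end_near. Qed.

Variable s : R.
Hypothesis s0 : 0 < s.
Let Q n := normal_tail s (s * level n).

Lemma cvg_level_tail : (fun n => n%:R * (8 * Q n)) @ \oo --> expR (- x).
Proof.
pose h n := n%:R * (8 * mills (level n)).
have hh : h @ \oo --> expR (- x) by exact: cvg_level_mills.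
have hl : (fun n => h n * (1 + (level n)^-1 * (level n)^-1)^-1) @ \oo --> expR (- x).
  rewrite [X in _ --> X](_ : _ = expR (- x) * 1^-1); last by rewrite invr1 mulr1.
  apply: cvgM => //.
  apply: cvgV; first exact: oner_neq0.
  rewrite [X in _ --> X](_ : 1 = 1 + 0 * 0); last by rewrite mulr0 addr0.
  by apply: cvgD; [exact: cvg_cst|apply: cvgM; apply: cvgy_inv; exact: cvgy_level].
apply: (squeeze_cvgr _ hl hh); near=> n.
have z0 : 0 < level n by near: n; move/cvgryPgt : cvgy_level; exact.
have /andP[m1 m2] := normal_tail_mills s0 z0.
apply/andP; split; last by rewrite !ler_wpM2l.
by rewrite /h -invfM -expr2 -(mulrA n%:R) -(mulrA 8) !ler_wpM2l.
Unshelve. all: by end_near. Qed.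

Lemma cvg_level_tail0 : Q @ \oo --> (0 : R).
Proof.
have h : (fun n => 8^-1 * (8 * Q n)) @ \oo --> (8^-1 * 0 : R).
  by apply: cvgM; [exact: cvg_cst|exact: cvg0_natM cvg_level_tail].
rewrite [X in _ --> X](_ : 0 = 8^-1 * 0); last by rewrite mulr0.
by apply: cvg_eq_near h; near=> n; rewrite mulKf.
Unshelve. all: by end_near. Qed.

Lemma cvg_level_tail_double :
  (fun n => n%:R * (8 * normal_tail s (2 * (s * level n)))) @ \oo --> (0 : R).
Proof.
pose h n := n%:R * (8 * mills (level n)) * (level n)^-1.
have hh : h @ \oo --> (0 : R).
  rewrite [X in _ --> X](_ : 0 = expR (- x) * 0); last by rewrite mulr0.
  apply: cvgM; last by apply: cvgy_inv; exact: cvgy_level.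
  exact: cvg_level_mills.
apply: (squeeze_cvgr _ (cvg_cst 0) hh); near=> n.
have z1 : 1 <= level n by near: n; move/cvgryPge : cvgy_level; exact.
have z0 : 0 < level n by exact: lt_le_trans z1.
rewrite !mulr_ge0 ?normal_tail_ge0 //= /h -(mulrA n%:R) -(mulrA 8) !ler_wpM2l // mulrCA.
have zz : 0 < 2 * level n by rewrite mulr_gt0.
have /andP[_ m2] := normal_tail_mills s0 zz.
rewrite (le_trans m2) // /mills.
have p0 : 0 < Num.sqrt (2 * pi) :> R by rewrite sqrtr_gt0 mulr_gt0 ?pi_gt0.
(* One quarter of the exponent reproduces [mills (level n)]; the other three quarters give the
   vanishing factor [(level n)^-1]. *)
have -> : (2 * level n) ^+ 2 / 2 = level n ^+ 2 / 2 + 3 * level n ^+ 2 / 2 by field.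
have e1 : expR (- (3 * level n ^+ 2 / 2)) <= (level n)^-1.
  by rewrite (le_trans _ (expRN_le_inv z0)) // ler_expR lerN2; nra.
rewrite opprD expRD -!(mulrA (expR _)) ler_wpM2l ?expR_ge0 //.
rewrite mulrC ler_pM ?expR_ge0 ?invr_ge0 ?mulr_ge0 ?(ltW z0) ?(ltW p0) //.
rewrite lef_pV2 ?posrE ?mulr_gt0 // ler_wpM2r ?(ltW p0) //; lra.
Unshelve. all: by end_near. Qed.

(** [Q n] tends to 0, so the denominator tends to 1/2, and 4 / (1/2) = 8 is the constant of the
    upper bound. *)
Lemma cvg_level_tail_lower :
  (fun n => n%:R * ((4 * Q n - 8 * normal_tail s (2 * (s * level n))) / (2^-1 + 4 * Q n)))
    @ \oo --> expR (- x).
Proof.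
have h : (fun n => (2^-1 * (n%:R * (8 * Q n)) -
    n%:R * (8 * normal_tail s (2 * (s * level n)))) * (2^-1 + 4 * Q n)^-1) @ \oo -->
    (2^-1 * expR (- x) - 0) * (2^-1 + 4 * 0)^-1.
  apply: cvgM.
    apply: cvgB; last exact: cvg_level_tail_double.
    by apply: cvgM; [exact: cvg_cst|exact: cvg_level_tail].
  apply: cvgV; first by rewrite mulr0 addr0 invr_neq0.
  apply: cvgD; first exact: cvg_cst.
  by apply: cvgM; [exact: cvg_cst|exact: cvg_level_tail0].
rewrite [X in _ --> X](_ : _ = (2^-1 * expR (- x) - 0) * (2^-1 + 4 * 0)^-1); last first.
  by rewrite mulr0 addr0 subr0 invrK mulrAC mulVf // mul1r.
apply: cvg_eq_near h; near=> n; rewrite [RHS]mulrA; congr (_ * _).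
by field.
Unshelve. all: by end_near.
Qed.

Lemma norm_level q n : 0 < q -> 0 < lam n ->
  norm_b q n + x / norm_a q n = Num.sqrt q * level n.
Proof.
move=> q0 l0; rewrite /norm_a /norm_b /level /level_shift.
have sq : Num.sqrt q != 0 by rewrite gt_eqF // sqrtr_gt0.
have sl : Num.sqrt (2 * lam n) != 0 by rewrite gt_eqF // sqrtr_gt0 mulr_gt0.
have -> : Num.sqrt (2 * lam n / q) = Num.sqrt (2 * lam n) / Num.sqrt q.
  by rewrite sqrtrM ?mulr_ge0 ?(ltW l0) // sqrtrV // ltW.
have -> : Num.sqrt (2 * q * lam n) = Num.sqrt q * Num.sqrt (2 * lam n).
  by rewrite -sqrtrM ?(ltW q0) // mulrA (mulrC q).
move: sq sl (ln (lam n)) (ln (16 / pi)); move: (Num.sqrt q) (Num.sqrt _) => a b a0 b0 c e.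
by field; rewrite a0 b0.
Qed.

End level_asymptotics.

(** * The maximum of the ranges and its limit law *)

Section max_range.
Context d (T : measurableType d) (R : realType) (P : probability T R).
Variables (n : nat) (S : 'M[R]_n) (W : 'I_n -> R -> T -> R).
Hypothesis hW : is_correlated_BM P S W.
Variable q : R.
Hypothesis q0 : 0 < q.

Let range_gt u i w : (u < path_range q (W i ^~ w)) <-> oscillates q u (W i ^~ w).
Proof. apply: path_range_gt; [exact: ltW|exact: (CBM_continuous hW)]. Qed.

Let measurable_osc u i : measurable [set w | oscillates q u (W i ^~ w)].
Proof. exact: (measurable_sbm_osc (process_space_gaussian hW) q0 u (process_sbm hW i)). Qed.

Lemma measurable_max_range : measurable_fun setT (max_range q W).
Proof.
have mr i : measurable_fun setT (fun w => path_range q (W i ^~ w)).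
  move=> _; apply: (measurability _ (RGenOInfty.measurableE R)) => //.
  move=> _ [_ [u ->] <-]; rewrite setTI.
  rewrite (_ : _ @^-1` _ = [set w | oscillates q u (W i ^~ w)]) //.
  by apply/seteqP; split => w /=; rewrite in_itv /= andbT => /range_gt.
suff h (s : seq 'I_n) :
  measurable_fun setT (fun w => \big[Num.max/0]_(i <- s) path_range q (W i ^~ w)) by exact: h.
elim: s => [|i s IH]; first by under eq_fun do rewrite big_nil; exact: measurable_cst.
by under eq_fun do rewrite big_cons; exact: measurable_maxr.
Qed.

(** Indexed by all naturals as in [no_exceedance_bounds], and empty from [n] on. *)
Let A u h := [set w | exists hh : (h < n)%N, oscillates q u (W (Ordinal hh) ^~ w)].

Let AE u h (hh : (h < n)%N) : A u h = [set w | oscillates q u (W (Ordinal hh) ^~ w)].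
Proof.
apply/seteqP; split => w /=; last by exists hh.
by move=> [hh']; rewrite (bool_irrelevance hh' hh).
Qed.

(** The default value 0 of the maximum does not interfere, since [u] is nonnegative. *)
Let max_range_le u : 0 <= u ->
  [set w | max_range q W w <= u] = [set w | forall h, (h < n)%N -> ~ A u h w].
Proof.
move=> u0; apply/seteqP; split => w /=.
  move=> /bigmax_leP[_ hm] h hn; rewrite (AE u hn) /= => /range_gt.
  by rewrite ltNge hm.
move=> hA; apply/bigmax_leP; split => // -[h hn] _; rewrite leNgt; apply/negP.
by move=> /range_gt ho; apply: (hA h hn); exists hn.
Qed.

Local Notation Q := (normal_tail (Num.sqrt q)).

Lemma max_range_bounds (rho : R) (l : nat) (u pl pu p2 : R) :
  0 <= rho < 1 -> (forall i j : 'I_n, i != j -> `|S i j| <= rho) ->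
  (forall i j : 'I_n, (j + l < i)%N -> S i j = 0) ->
  0 <= u -> Num.sqrt q <= kappa rho * u ->
  pl = (4 * Q u - 8 * Q (2 * u)) / (2^-1 + 4 * Q u) -> pu = 8 * Q u ->
  p2 = 72 * expR (- ((1 + kappa rho ^+ 2) * (u ^+ 2 / (2 * q)))) ->
  0 <= pl -> pu <= 1 ->
  (1 - pu) ^+ n - n%:R * (l%:R * (p2 + pu ^+ 2)) <= fine (P [set w | max_range q W w <= u])
    <= (1 - pl) ^+ n + n%:R * (l%:R * (p2 + pu ^+ 2)).
Proof.
move=> hrho hS hband u0 hu plE puE p2E pl0 pu1; rewrite max_range_le //.
apply: (@no_exceedance_bounds _ _ _ _ _ n) => //.
- move=> h; have [hn|hn] := ltnP h n; first by rewrite (AE u hn).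
  by rewrite (_ : A u h = set0) //; apply/seteqP; split => // w [hh _]; have := hh; rewrite ltnNge hn.
- move=> h hn; rewrite (AE u hn) plE puE.
  exact: (sbm_range_tail (process_space_gaussian hW) q0 (process_sbm hW _) u0).
- move=> h m /andP[hm mn]; rewrite (AE u mn) (AE u (ltn_trans hm mn)) p2E.
  apply: (pair_range_exp q0 hW hrho) => //; apply: hS.
  by rewrite -val_eqE /= gtn_eqF.
- move=> m mn.
  have -> : [set w | forall h, (h < m - l)%N -> ~ A u h w] = [set w | forall h (hh : (h < n)%N),
      (h < m - l)%N -> ~ oscillates q u (W (Ordinal hh) ^~ w)].
    apply/seteqP; split => w /= hA h.
      by move=> hh hm ho; apply: (hA h hm); exists hh.
    by move=> hm [hh]; exact: hA.
  rewrite (AE u mn); apply: (block_indep hW q0) => h hh hm.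
  by apply: hband; rewrite /= addnC -ltn_subRL.
- by rewrite p2E mulr_ge0 ?expR_ge0.
Qed.

End max_range.

Theorem theorem3p5 (R : realType) (q : R) (hq : 0 < q <= 1)
    (disp : nat -> measure_display) (T : forall d, measurableType (disp d))
    (P : forall d, probability (T d) R)
    (Sigma : forall d, 'M[R]_d) (W : forall d, 'I_d -> R -> T d -> R)
    (hW : forall d, is_correlated_BM (P d) (Sigma d) (@W d))
    (rho : R) (hrho : 0 <= rho < 1)
    (hSigma : forall d (i j : 'I_d), (i < j)%N -> `|Sigma d i j| <= rho)
    (L : nat -> R)
    (hband : forall d (i j : 'I_d),
       L d < `|i%:R - j%:R| -> Sigma d i j = 0)
    (Delta : R)
    (hDelta : Delta < ((1 - rho * Num.sqrt (2 - rho ^+ 2)) / (1 - rho ^+ 2)) ^+ 2)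
    (hL : L =o_\oo (fun d => d%:R `^ Delta))
    (d' : measure_display) (T' : measurableType d') (P' : probability T' R)
    (G : {RV P' >-> R}) (hG : is_standard_gumbel G) :
  cvg_in_distribution P
    (fun d w => norm_a q d * (max_range q (@W d) w - norm_b q d)) G.
Proof.
have /andP[q0 _] := hq; have [/andP[k0 k1] _] := kappaP hrho.
have s0 : 0 < Num.sqrt q by rewrite sqrtr_gt0.
have mX n : measurable_fun setT
    (fun w => norm_a q n * (max_range q (@W n) w - norm_b q n)).
  apply: measurable_funM => //; apply: measurable_funB => //.
  exact: (measurable_max_range (hW n) q0).
split=> // x _; rewrite hG /gumbel_cdf; apply/fine_cvgP; split.
  apply: nearW => n; rewrite fin_num_measure //.
  have := mX n measurableT _ (measurable_itv `]-oo, x]); rewrite setTI.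
  by congr measurable; apply/seteqP; split => w /=; rewrite in_itv.
pose u n := Num.sqrt q * level x n.
pose Q n := normal_tail (Num.sqrt q) (u n).
(* An integer bandwidth: a natural number above [l n] is at least [(l n).+1], which exceeds |L n|,
   so the band condition applies. *)
pose l n := Num.truncn `|L n|.
pose pl n := (4 * Q n - 8 * normal_tail (Num.sqrt q) (2 * u n)) / (2^-1 + 4 * Q n).
pose p2 n := 72 * expR (- ((1 + kappa rho ^+ 2) * (u n ^+ 2 / (2 * q)))).
pose eps n := n%:R * ((l n)%:R * (p2 n + (8 * Q n) ^+ 2)).
have cQ := @cvg_level_tail R x _ s0.
have cpl := @cvg_level_tail_lower R x _ s0.
have k20 : 0 <= kappa rho ^+ 2 by exact: sqr_ge0.
have u2 n : u n ^+ 2 / (2 * q) = level x n ^+ 2 / 2.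
  by rewrite exprMn sqr_sqrtr ?(ltW q0) //; field; rewrite gt_eqF.
have hL1 : \forall n \near \oo, `|L n| <= 1 * `|n%:R `^ Delta| by move/eqoP : hL; exact.
have hl : \forall n \near \oo, 0 <= ((l n)%:R : R) <= n%:R `^ Delta.
  near=> n; rewrite ler0n /=.
  have h : `|L n| <= 1 * `|n%:R `^ Delta| by near: n; exact: hL1.
  have ln : (l n)%:R <= `|L n| by rewrite truncn_le.
  by rewrite (le_trans ln) // (le_trans h) // mul1r ger0_norm ?powR_ge0.
have level1 : \forall n \near \oo, 1 <= kappa rho * level x n.
  near=> n; rewrite mulrC -ler_pdivrMr //.
  by near: n; move/cvgryPge : (cvgy_level x); apply.
have ceps : eps @ \oo --> (0 : R).
  (* 136 = 72 + 8^2: [p2 n] contributes 72, and (8 Q)^2 contributes 64 because Q^2 is at most the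
     exponential of - level^2 and 1 + kappa^2 <= 2. *)
  have h : (fun n => 136 * (n%:R * ((l n)%:R *
      expR (- ((1 + kappa rho ^+ 2) * (level x n ^+ 2 / 2)))))) @ \oo --> (136 * 0 : R).
    by apply: cvgM; [exact: cvg_cst|exact: cvg_band_error hl].
  rewrite mulr0 in h; apply: (squeeze_cvgr _ (cvg_cst 0) h); near=> n.
  have l1 : 1 <= kappa rho * level x n by near: n.
  have lev1 : 1 <= level x n.
    have lev0 : 0 < level x n by have := lt_le_trans ltr01 l1; rewrite pmulr_rgt0.
    by rewrite (le_trans l1) // ler_piMl // ltW.
  rewrite /eps !mulr_ge0 ?addr_ge0 ?sqr_ge0 ?mulr_ge0 ?expR_ge0 //=.
  rewrite (mulrCA 136) ler_wpM2l // (mulrCA 136) ler_wpM2l //.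
  have Q1 : Q n <= expR (- (level x n ^+ 2 / 2)).
    have su : Num.sqrt q <= u n by rewrite ler_peMr // ltW.
    by rewrite (le_trans (normal_tail_exp s0 su)) // sqr_sqrtr ?(ltW q0) // u2.
  have Q2 : Q n ^+ 2 <= expR (- ((1 + kappa rho ^+ 2) * (level x n ^+ 2 / 2))).
    rewrite (le_trans (lerXn2r 2 _ _ Q1)) ?nnegrE ?normal_tail_ge0 ?expR_ge0 //.
    rewrite -expRM_natl ler_expR mulrN lerN2 ler_wpM2r ?divr_ge0 ?sqr_ge0 //.
    by rewrite (_ : 2%:R = 1 + 1) // lerD2l expr_le1 // ltW.
  rewrite /p2 u2 (_ : (8 * Q n) ^+ 2 = 64 * Q n ^+ 2); last by ring.
  by move: Q2; move: (Q n ^+ 2) (expR _) => a b; lra.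
have hlo : (fun n => (1 - 8 * Q n) ^+ n - eps n) @ \oo --> expR (- expR (- x)).
  by rewrite -[X in _ --> X]subr0; apply: cvgB => //; exact: cvg_pow_1B.
have hup : (fun n => (1 - pl n) ^+ n + eps n) @ \oo --> expR (- expR (- x)).
  by rewrite -[X in _ --> X]addr0; apply: cvgD => //; exact: cvg_pow_1B.
apply: (squeeze_cvgr _ hlo hup); near=> n.
have lam0 : 0 < ln n%:R :> R by near: n; move/cvgryPgt : (@cvgy_lnn R); apply.
have n0 : (0 < n)%N by near: n; exact: nbhs_infty_gt.
have l1 : 1 <= kappa rho * level x n by near: n.
have lev0 : 0 < level x n by have := lt_le_trans ltr01 l1; rewrite pmulr_rgt0.
have a0 : 0 < norm_a q n by rewrite sqrtr_gt0 divr_gt0 ?mulr_gt0.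
rewrite /=; have -> : [set w | norm_a q n * (max_range q (@W n) w - norm_b q n) <= x] =
    [set w | max_range q (@W n) w <= u n].
  by apply/seteqP; split => w /=; rewrite /u -norm_level // -ler_pdivlMl // (mulrC _^-1) lerBlDl.
apply: (max_range_bounds (hW n) q0 hrho) => //.
- move=> i j; rewrite neq_ltn => /orP[|ij]; first exact: hSigma.
  by rewrite (correlation_sym (hW n)); exact: hSigma.
- move=> i j ij; apply: hband; rewrite (le_lt_trans (ler_norm _)) //.
  rewrite (lt_le_trans (truncnS_gt _)) // -/(l n).
  rewrite -natrB; last by rewrite (leq_trans _ (ltnW ij)) // leq_addr.
  by rewrite normr_nat ler_nat ltn_subRL.
- by rewrite mulr_ge0 // ltW.
- by rewrite mulrCA ler_peMr // ltW.
- have : 0 < n%:R * pl n by near: n; apply: (cvgr_gt _ cpl); exact: expR_gt0.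
  by rewrite pmulr_rgt0 ?ltr0n // => /ltW.
- apply: ltW; near: n; apply: (cvgr_lt (0 : R)) => //; exact: cvg0_natM cQ.
Unshelve. all: by end_near. Qed.
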